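(* For every fixed $n\in\mathbb{N}$ there is a function $f:\mathbb{N}\to\mathbb{N}$ such that, for every $k\in\mathbb{N}$, every $K_n$-minor-free graph $G$ with pathwidth at least $f(k)$ contains a subdivision of $T_k$ or the line graph of a subdivision of $T_k$ as an induced subgraph.
   Context: Graphs are finite, simple and undirected. $T_k$ denotes the complete binary tree of height $k$: the rooted tree in which every non-leaf vertex has exactly two children and every path from the root to a leaf has exactly $k$ edges. A subdivision of a graph $G$ is any graph obtained from $G$ by replacing each edge $uv$ by a path (possibly of length one) with end-vertices $u$ and $v$ whose internal vertices are new vertices private to that path. The line graph $L(G)$ has vertex set $E(G)$, two vertices being adjacent if the corresponding edges share an end-vertex. A graph $G$ contains $H$ as an induced subgraph if a graph isomorphic to $H$ can be obtained from $G$ by deleting vertices. A graph $H$ is a minor of $G$ if a graph isomorphic to $H$ can be obtained from $G$ by vertex deletions, edge deletions and edge contractions; $G$ is $K_n$-minor-free if the complete graph $K_n$ on $n$ vertices is not a minor of $G$. A path-decomposition of $G$ is a collection $(W_x : x\in V(P))$ of subsets of $V(G)$ indexed by the vertices of a path $P$ such that every edge of $G$ has both ends in some $W_x$, and for each $v\in V(G)$ the set $\{x : v\in W_x\}$ induces a (non-empty) connected subpath of $P$; its width is $\max_x |W_x|-1$, and the pathwidth of $G$ is the minimum width of a path-decomposition of $G$. *)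

(* Defs.v *)
From mathcomp Require Import all_boot boolp.

Set Implicit Arguments.
Unset Strict Implicit.
Unset Printing Implicit Defensive.

Record sgraph := SGraph {
  vertex :> finType;
  adj : rel vertex;
  adj_sym : symmetric adj;
  adj_irr : irreflexive adj }.

Notation "x -- y" := (adj x y) (at level 30, no associativity).

Definition iso (G H : sgraph) : Prop :=
  exists2 phi : G -> H, bijective phi & forall x y, (phi x -- phi y) = (x -- y).

Section Induced.
Variables (G : sgraph) (S : {set G}).

Definition induced_rel : rel {x | x \in S} := fun x y => val x -- val y.

Lemma induced_sym : symmetric induced_rel.
Proof. by move=> x y; apply: adj_sym. Qed.

Lemma induced_irr : irreflexive induced_rel.
Proof. by move=> x; apply: adj_irr. Qed.

Definition induced : sgraph := SGraph induced_sym induced_irr.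

End Induced.

Definition induced_subgraph (H G : sgraph) : Prop :=
  exists S : {set G}, iso H (induced S).

Section LineGraph.
Variable G : sgraph.

Definition edges : {set {set G}} :=
  [set e | [exists x, exists y, (x -- y) && (e == [set x; y])]].

Definition line_rel : rel {e | e \in edges} :=
  fun e f => (e != f) && (val e :&: val f != set0).

Lemma line_sym : symmetric line_rel.
Proof. by move=> e f; rewrite /line_rel eq_sym setIC. Qed.

Lemma line_irr : irreflexive line_rel.
Proof. by move=> e; rewrite /line_rel eqxx. Qed.

Definition line_graph : sgraph := SGraph line_sym line_irr.

End LineGraph.

Section Complete.
Variable n : nat.

Definition complete_rel : rel 'I_n := fun i j => i != j.

Lemma complete_sym : symmetric complete_rel.
Proof. by move=> i j; rewrite /complete_rel eq_sym. Qed.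

Lemma complete_irr : irreflexive complete_rel.
Proof. by move=> i; rewrite /complete_rel eqxx. Qed.

Definition complete : sgraph := SGraph complete_sym complete_irr.

End Complete.

(* A vertex at depth d is the bit sequence of length d that encodes, from its *)
(* last bit to its first, the path reaching it from the root [::]; its        *)
(* children are obtained by adding one bit at the front.                      *)
Section BinaryTree.
Variable k : nat.

Definition is_child (s t : k.-bseq bool) : bool :=
  [exists b, (t : seq bool) == b :: s].

Definition bintree_rel : rel (k.-bseq bool) :=
  fun s t => is_child s t || is_child t s.

Lemma bintree_sym : symmetric bintree_rel.
Proof. by move=> s t; rewrite /bintree_rel orbC. Qed.

Lemma bintree_irr : irreflexive bintree_rel.
Proof.
move=> s; rewrite /bintree_rel orbb; apply/existsP => -[b /eqP/(congr1 size)/=].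
by move/eqP; rewrite eqn_leq ltnn andbF.
Qed.

Definition bintree : sgraph := SGraph bintree_sym bintree_irr.

End BinaryTree.

(* H is a subdivision of G: br embeds the vertices of G, and each edge uv is  *)
(* replaced by the path br u :: rcons (inner u v) (br v), where inner u v     *)
(* lists the new vertices from u to v (it is empty for a path of length one). *)
(* The values inner u v for u, v not adjacent are irrelevant. As inner is     *)
(* reversed when u and v are swapped, sd_adj needs only one orientation.      *)
Record is_subdivision_via (G H : sgraph) (br : G -> H)
    (inner : G -> G -> seq H) : Prop := IsSubdivisionVia {
  sd_br_inj : injective br;
  sd_rev : forall u v, u -- v -> inner v u = rev (inner u v);
  sd_uniq : forall u v, u -- v -> uniq (inner u v);
  sd_new : forall u v w, u -- v -> br w \notin inner u v;
  sd_private : forall u v u' v' x, u -- v -> u' -- v' ->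
    x \in inner u v -> x \in inner u' v' -> [set u; v] = [set u'; v'];
  sd_vertex : forall x,
    (exists u, x = br u) \/ (exists u v, u -- v /\ x \in inner u v);
  sd_adj : forall x y, x -- y <->
    exists u v, u -- v /\ infix [:: x; y] (br u :: rcons (inner u v) (br v)) }.

Definition is_subdivision (G H : sgraph) : Prop :=
  exists br inner, @is_subdivision_via G H br inner.

Definition del_vertex (G : sgraph) (x : G) : sgraph := induced [set~ x].

Section DelEdge.
Variables (G : sgraph) (x y : G).

Definition del_edge_rel : rel G :=
  fun z w => (z -- w) && ([set z; w] != [set x; y]).

Lemma del_edge_sym : symmetric del_edge_rel.
Proof. by move=> z w; rewrite /del_edge_rel adj_sym setUC. Qed.

Lemma del_edge_irr : irreflexive del_edge_rel.
Proof. by move=> z; rewrite /del_edge_rel adj_irr. Qed.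

Definition del_edge : sgraph := SGraph del_edge_sym del_edge_irr.

End DelEdge.

(* In the contraction of the edge xy, the merged vertex is represented by x.  *)
Section Contract.
Variables (G : sgraph) (x y : G).

Definition contract_rel : rel {z : G | z != y} := fun z w =>
  (z != w) && [|| val z -- val w,
                  (val z == x) && (y -- val w) |
                  (val w == x) && (y -- val z)].

Lemma contract_sym : symmetric contract_rel.
Proof.
move=> z w; rewrite /contract_rel eq_sym (adj_sym (val z)).
by congr (_ && (_ || _)); rewrite orbC.
Qed.

Lemma contract_irr : irreflexive contract_rel.
Proof. by move=> z; rewrite /contract_rel eqxx. Qed.

Definition contract : sgraph := SGraph contract_sym contract_irr.

End Contract.

Inductive minor (H : sgraph) : sgraph -> Prop :=
| MinorIso (G : sgraph) of iso H G : minor H G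
| MinorDelVertex (G : sgraph) (x : G) of minor H (del_vertex x) : minor H G
| MinorDelEdge (G : sgraph) (x y : G) of x -- y & minor H (del_edge x y) : minor H G
| MinorContract (G : sgraph) (x y : G) of x -- y & minor H (contract x y) : minor H G.

Definition minor_free (H G : sgraph) : Prop := ~ minor H G.

(* The path P has vertices 0, ..., m in this order, so that its non-empty     *)
(* connected subpaths are the intervals a, ..., b with a <= b.                *)
Definition path_decomposition (G : sgraph) (m : nat)
    (W : 'I_m.+1 -> {set G}) : Prop :=
  (forall x y, x -- y -> exists i, (x \in W i) && (y \in W i)) /\
  (forall v, exists a b : 'I_m.+1, a <= b /\
     forall i : 'I_m.+1, (v \in W i) = (a <= i <= b)).

(* Subtraction is truncated: for the graph without vertices, the width of the *)
(* decompositions is 0 instead of -1.                                         *)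
Definition width (G : sgraph) (m : nat) (W : 'I_m.+1 -> {set G}) : nat :=
  (\max_i #|W i|) - 1.

Definition has_decomposition (G : sgraph) (w : nat) : Prop :=
  exists m (W : 'I_m.+1 -> {set G}), path_decomposition W /\ width W = w.

Lemma ex_decomposition (G : sgraph) : exists w, `[< has_decomposition G w >].
Proof.
pose W (i : 'I_1) := [set: G].
exists (width W); apply/asboolP; exists 0, W; split=> //; split=> [x y _|v].
  by exists ord0; rewrite !inE.
by exists ord0, ord0; split=> // i; rewrite !inE ord1.
Qed.

Definition pathwidth (G : sgraph) : nat := ex_minn (ex_decomposition G).

(* Main.v *)
(* First, large pathwidth forces the complete binary tree of large height as  *)
(* a minor (Diestel's proof of the excluded forest theorem), since a linear   *)
(* layout of small vertex separation number gives a path-decomposition.       *)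
(* Next, let A carry a large binary tree model in a graph without K_n minor   *)
(* and let R be connected and disjoint from A. If every large submodel of A   *)
(* sees R, contract these submodels: by induction on n the contracted graph   *)
(* has a K_(n-1) minor, which R completes to a K_n minor, or the tree as an   *)
(* induced minor. Otherwise some large submodel is anticomplete to R.         *)
(* Cleaning in this way, one chooses two anticomplete large submodels A1, A2, *)
(* connects a root vertex z to both by a connected set X, cleans each from X, *)
(* and recurses in A1 and A2 from vertices of the neighbourhood of X: this    *)
(* builds the binary tree as an induced minor.                                *)
(* Finally, in an induced minor model each branch set can be thinned to       *)
(* induced paths that meet in a single vertex or in a triangle. A Ramsey      *)
(* argument on the tree makes all branchings of the same kind, which gives a  *)
(* subdivision of T_k or the line graph of one.                               *)

(* Large pathwidth enters only through [tree_model] and [good_pathwidth]: if no layout of all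
   vertices has vertex separation number at most N, every tree on N vertices is a minor, because a
   layout can be extended as long as its boundary is linked, by Menger's theorem ([linkage]), to the
   branch sets built so far.

   The absence of a K_n minor enters only through [clique_or_induced_tree]. The alternative behind
   it is [clean_or_hit]: a connected set R either misses a tall submodel altogether, or sees every
   block of a contracted tall model, and then R adds one branch set to a clique found there.
   Excluding cliques therefore allows cleaning at a bounded cost in height, and [rootedP] spends
   that height to build an induced model from its root downwards.

   The rest holds in every graph. Three vertices are joined inside a connected set by induced paths
   that meet in a vertex or in a triangle ([leg], [spider]), so [induced_minor_itree] turns an
   induced model into an induced tree whose branchings are claws or triangles. By [itree_ramsey] one
   kind suffices. A tree with claws only is a subdivision ([itree_claw]). A tree with triangles only
   is, without its root, a line graph of a subdivision, each vertex standing for the edge to its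
   parent ([itree_triangle]). *)
Require Import Defs.
From mathcomp Require Import all_boot.
From mathcomp Require Import boolp zify.

Set Implicit Arguments.
Unset Strict Implicit.
Unset Printing Implicit Defensive.

(** * Connectivity *)

Section PointwiseSets.
Variable T : finType.
Implicit Types A B : {set T}.

Lemma disjP A B : reflect (forall x, x \in A -> x \in B -> False) [disjoint A & B].
Proof.
rewrite -setI_eq0; apply: (iffP eqP) => [AB0 x xA xB|AB0].
  by have := in_set0 x; rewrite -AB0 inE xA xB.
by apply/setP=> x; rewrite !inE; apply/negP => /andP[/AB0 H /H].
Qed.

Lemma subset_at A B x : A \subset B -> (x \in A) ==> (x \in B).
Proof. by move/subsetP=> s; apply/implyP/s. Qed.

Lemma disjoint_at A B x : [disjoint A & B] -> ~~ ((x \in A) && (x \in B)).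
Proof. by move/disjP=> s; apply/negP => /andP[/s H /H]. Qed.

End PointwiseSets.

(* Decides membership goals at the point x by a truth table over the atoms. *)
Ltac at_point x :=
  repeat match goal with
  | H : is_true (_ \subset _) |- _ => generalize (subset_at x H); clear H
  | H : is_true [disjoint _ & _] |- _ => generalize (disjoint_at x H); clear H
  end;
  repeat match goal with
  | H : is_true (x \in _) |- _ => revert H
  | H : is_true (x \notin _) |- _ => revert H
  end;
  rewrite ?inE;
  repeat match goal with
  | |- context [x \in ?A] => case: (x \in A) => //=
  | |- context [x == ?y] => case: (x == y) => //=
  end.

Ltac set_auto :=
  intros;
  match goal with
  | |- is_true (_ \subset _) =>
      let x := fresh "x" in apply/subsetP => x; at_point x
  | |- is_true [disjoint _ & _] =>
      let x := fresh "x" in apply/disjP => x; at_point x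
  | |- _ = _ => let x := fresh "x" in apply/setP => x; at_point x
  end.

Section Connectivity.
Variables (V : finType) (e : rel V).
Implicit Types (A B C D S : {set V}) (x y : V).

Definition touch A B := [exists x in A, exists y in B, e x y].

(** Connectivity is expressed by cuts instead of paths: it then applies as it stands to [touch e] on
    sets, and transfers by moving one cut. *)
Definition conn A :=
  (A != set0) &&
  [forall B : {set V}, [&& B \subset A, B != set0 & B != A] ==>
     touch B (A :\: B)].

Lemma touchP A B :
  reflect (exists x y, [/\ x \in A, y \in B & e x y]) (touch A B).
Proof.
apply: (iffP exists_inP) => [[x xA /exists_inP[y yB exy]]|[x [y [xA yB exy]]]].
  by exists x, y.
by exists x => //; apply/exists_inP; exists y.
Qed.

Lemma touchI A B x y : x \in A -> y \in B -> e x y -> touch A B.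
Proof. by move=> xA yB exy; apply/touchP; exists x, y. Qed.

Lemma ntouchP A B :
  reflect (forall x y, x \in A -> y \in B -> ~~ e x y) (~~ touch A B).
Proof.
apply: (iffP negP) => [nt x y xA yB|nt /touchP[x [y [xA yB exy]]]].
  by apply/negP => exy; apply: nt; apply: touchI exy.
by move/negP: (nt x y xA yB).
Qed.

Lemma touchS A B A' B' :
  A \subset A' -> B \subset B' -> touch A B -> touch A' B'.
Proof.
move=> /subsetP sA /subsetP sB /touchP[x [y [xA yB exy]]].
exact: touchI (sA x xA) (sB y yB) exy.
Qed.

Lemma ntouchS A B A' B' :
  A' \subset A -> B' \subset B -> ~~ touch A B -> ~~ touch A' B'.
Proof. by move=> sA sB; apply: contraNN; apply: touchS. Qed.

Lemma conn_neq0 A : conn A -> exists x, x \in A.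
Proof. by case/andP => /set0Pn. Qed.

Lemma conn_cut A B :
  conn A -> B \subset A -> B != set0 -> B != A -> touch B (A :\: B).
Proof. by case/andP => _ /forallP/(_ B)/implyP H *; apply: H; apply/and3P. Qed.

Hypothesis e_sym : symmetric e.

Lemma touch_sym A B : touch A B = touch B A.
Proof.
by apply/touchP/touchP => -[x [y [xA yB exy]]]; exists y, x; rewrite e_sym.
Qed.

(** By symmetry an edge leaving a part of A also leaves its complement, so the side containing x may
    be chosen. *)
Lemma conn_from A x : x \in A ->
  (forall B, x \in B -> B \subset A -> B != A -> touch B (A :\: B)) -> conn A.
Proof.
move=> xA H; apply/andP; split; first by apply/set0Pn; exists x.
apply/forallP => B; apply/implyP => /and3P[BA B0 BnA].
case: (boolP (x \in B)) => [xB|xB]; first exact: H.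
have {1}<- : A :\: (A :\: B) = B by set_auto.
rewrite touch_sym; apply: H; first by rewrite inE xB.
- by set_auto.
- case/set0Pn: B0 => y yB; apply/eqP => /setP/(_ y).
  by rewrite inE yB (subsetP BA).
Qed.

Lemma conn1 x : conn [set x].
Proof.
apply: (@conn_from _ x); rewrite ?inE // => B xB.
rewrite subset1 => /orP[/eqP->|/eqP B0]; first by rewrite eqxx.
by rewrite B0 inE in xB.
Qed.

Lemma connU A B : conn A -> conn B ->
  touch A B || (A :&: B != set0) -> conn (A :|: B).
Proof.
move=> cA cB AB; have [x xA] := conn_neq0 cA.
apply: (@conn_from _ x); first by rewrite inE xA.
move=> C xC CAB CnAB; case: (boolP (A \subset C)) => [AC|nAC]; last first.
  have AC0 : A :&: C != set0 by apply/set0Pn; exists x; rewrite inE xA.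
  have ACA : A :&: C != A by apply: contraNneq nAC => <-; rewrite subsetIr.
  by apply: touchS (conn_cut cA (subsetIl A C) AC0 ACA); set_auto.
have nBC : ~~ (B \subset C).
  by apply: contraNN CnAB => BC; rewrite eqEsubset CAB subUset AC.
case: (eqVneq (B :&: C) set0) => [BC0|BC0].
  case/orP: AB => [|/set0Pn[y /setIP[yA yB]]].
    apply: touchS => //; apply/subsetP => y yB; rewrite !inE yB orbT andbT.
    by apply/negP => yC; have := in_set0 y; rewrite -BC0 inE yB yC.
  by have := in_set0 y; rewrite -BC0 inE yB (subsetP AC).
have BCB : B :&: C != B by apply: contraNneq nBC => <-; rewrite subsetIr.
by apply: touchS (conn_cut cB (subsetIl B C) BC0 BCB); set_auto.
Qed.

Lemma connU1 A x y : conn A -> y \in A -> e x y -> conn (x |: A).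
Proof.
by move=> cA yA exy; apply: connU cA _; rewrite ?conn1 // (touchI _ yA exy) ?inE.
Qed.

Lemma component S A : conn A -> A \subset S ->
  exists C, [/\ A \subset C, C \subset S, conn C & ~~ touch C (S :\: C)].
Proof.
move=> cA AS; pose P C := [&& A \subset C, C \subset S & conn C].
have PA : P A by rewrite /P subxx AS.
case: (arg_maxnP (fun C => #|C|) PA) => C /and3P[AC CS cC] maxC.
exists C; split=> //; apply/negP => /touchP[x [y [xC /setDP[yS yC] exy]]].
have /maxC : P (y |: C).
  rewrite /P (connU1 cC xC) 1?e_sym // subUset sub1set yS CS.
  by rewrite (subset_trans AC) ?subsetUr.
by rewrite /= cardsU1 yC add1n ltnn.
Qed.

(** Replaces the argument that follows a path out of C up to its first vertex outside S. In the
    applications S is D without some unwanted vertices. *)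
Lemma component_exit D S C : conn D -> C \subset S -> S \subset D ->
  conn C -> ~~ touch C (S :\: C) -> S != D -> touch C (D :\: S).
Proof.
move=> cD CS SD cC nt SnD.
have CnD : C != D.
  by apply: contraNneq SnD => CD; rewrite eqEsubset SD -CD.
have C0 : C != set0 by case/andP: cC.
have /touchP[x [y [xC /setDP[yD yC] exy]]] :=
  conn_cut cD (subset_trans CS SD) C0 CnD.
apply: (touchI xC _ exy); rewrite inE yD andbT.
by apply: contraNN nt => yS; apply: (touchI xC _ exy); rewrite inE yS yC.
Qed.

End Connectivity.

(** * Large pathwidth forces a binary tree minor *)

Section Linkage.
Variables (V : finType) (e0 : rel V).
Hypothesis e0sym : symmetric e0.
Implicit Types (e : rel V) (X Y Z S : {set V}) (u v : V).

(** Locked so that rewriting with [inE] does not unfold boundaries. *)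
Definition bd e X :=
  locked [set x in X | [exists y, (y \notin X) && e x y]].

Lemma bdP e X x :
  reflect (x \in X /\ exists2 y, y \notin X & e x y) (x \in bd e X).
Proof.
rewrite /bd -lock inE; apply: (iffP andP) => -[xX H]; split=> //.
  by case/existsP: H => y /andP[]; exists y.
by apply/existsP; case: H => y yX exy; exists y; rewrite yX.
Qed.

Lemma bd_sub e X : bd e X \subset X.
Proof. by apply/subsetP => x /bdP[]. Qed.

Lemma bd_add e X y : bd e (y |: X) \subset y |: bd e X.
Proof.
apply/subsetP => x /bdP[]; rewrite !inE => /orP[->//|xX] [z].
rewrite !inE negb_or => /andP[_ zX] exz; apply/orP; right.
by apply/bdP; split=> //; exists z.
Qed.

(** One-sided deletion: u leaves every boundary, while the other vertices still see u and keep their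
    status. The price is a relation that is no longer symmetric. *)
Definition del_out e u : rel V := fun x y => (x != u) && e x y.

Lemma bd_del_out e u X : bd (del_out e u) X = bd e X :\ u.
Proof.
apply/setP => x; rewrite in_setD1 /del_out.
apply/bdP/andP => [[xX [y yX /andP[xu exy]]]|[xu /bdP[xX [y yX exy]]]].
  by split=> //; apply/bdP; split=> //; exists y.
by split=> //; exists y => //; rewrite xu.
Qed.

(** Disjoint connected sets play the role of Menger's paths. Boundaries refer to [e], which loses
    edges during the induction, and connectivity to the original symmetric [e0]. *)
Definition linked e X Y k := exists S (f : V -> {set V}),
  [/\ S \subset bd e Y, #|S| = k,
      forall s, s \in S -> [/\ s \in f s, conn e0 (f s),
        f s \subset (X :\: Y) :|: bd e Y & ~~ [disjoint f s & bd e X]] &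
      forall s t, s \in S -> t \in S -> s != t -> [disjoint f s & f t]].

(** Both linkages use up all k boundary vertices of Z and can be glued there. The inner sets lie in
    Z and the outer ones meet Z only in its boundary, one vertex each, so sets that are not glued
    together stay disjoint. *)
Lemma linked_trans e X Y Z k : Y \subset Z -> Z \subset X -> #|bd e Z| = k ->
  linked e Z Y k -> linked e X Z k -> linked e X Y k.
Proof.
move=> YZ ZX tight [S [f [SY Sk fS fd]]] [S' [f' [S'Z S'k fS' fd']]].
have S'E : S' = bd e Z by apply/eqP; rewrite eqEcard S'Z S'k tight leqnn.
have tP s : s \in S -> exists t, t \in f s :&: bd e Z.
  by case/fS=> _ _ _; rewrite -setI_eq0 => /set0Pn.
pose t s := odflt s [pick x in f s :&: bd e Z].
have {}tP s : s \in S -> (t s \in f s) /\ (t s \in bd e Z).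
  move=> /tP[x xP]; rewrite /t; case: pickP => [y|/(_ x)]; last by rewrite xP.
  by rewrite inE => /andP.
have t_inj : {in S &, injective t}.
  move=> a b aS bS ab; apply/eqP; apply: contraT => nab.
  have /disjP/(_ (t a)) [] := fd a b aS bS nab; first by case: (tP a aS).
  by rewrite ab; case: (tP b bS).
have tS : t @: S = bd e Z.
  apply/eqP; rewrite eqEcard card_in_imset // Sk tight leqnn andbT.
  by apply/subsetP => _ /imsetP[s sS ->]; case: (tP s sS).
have meet a b : a \in S -> b \in S -> forall x, x \in f a -> x \in f' (t b) -> a = b.
  move=> aS bS x xa xb; have [_ _ fa _] := fS a aS.
  have tbS : t b \in S' by rewrite S'E; case: (tP b bS).
  have [_ _ fb _] := fS' _ tbS.
  have xZ : x \in Z.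
    by have := subsetP fa x xa; rewrite !inE => /orP[/andP[]//|/(subsetP (bd_sub e Y))/(subsetP YZ)].
  have xB : x \in bd e Z by have := subsetP fb x xb; rewrite inE !inE xZ.
  have xS' : x \in S' by rewrite S'E.
  have xtb : x = t b.
    apply/eqP; apply: contraT => nxb.
    by have /disjP/(_ x)[] := fd' x (t b) xS' tbS nxb => //; case: (fS' x xS').
  rewrite -tS in xB; case/imsetP: xB => c cS xc.
  have ca : c = a.
    apply/eqP; apply: contraT => nca.
    by have /disjP/(_ x)[] := fd c a cS aS nca => //; rewrite xc; case: (tP c cS).
  by rewrite -ca; apply: t_inj => //; rewrite -xc.
exists S, (fun s => f s :|: f' (t s)); split=> // [s sS|a b aS bS nab].
  have [sf cf ff _] := fS s sS; have [tf tZ] := tP s sS.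
  have tS' : t s \in S' by rewrite S'E.
  have [tf' cf' ff' mf'] := fS' _ tS'.
  split; first by rewrite inE sf.
  - apply: connU => //; apply/orP; right; apply/set0Pn; exists (t s).
    by rewrite inE tf tf'.
  - rewrite subUset; apply/andP; split.
      by apply: subset_trans ff _; set_auto.
    apply/subsetP => x xf'; case: (boolP (x \in Y)) => xY; last first.
      rewrite in_setU in_setD xY /=; apply/orP; left.
      case/setUP: (subsetP ff' x xf') => [/setDP[]//|/(subsetP (bd_sub e Z))].
      exact: (subsetP ZX).
    have xZ := subsetP YZ x xY.
    have xB : x \in bd e Z by have := subsetP ff' x xf'; rewrite inE !inE xZ.
    case/bdP: xB => _ [y yZ exy]; rewrite inE; apply/orP; right.
    by apply/bdP; split=> //; exists y => //; apply: contraNN yZ => /(subsetP YZ).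
  - by apply: contraNN mf'; set_auto.
apply/disjP => x /setUP[xa|xa] /setUP[xb|xb].
- by have /disjP/(_ x)[] := fd a b aS bS nab.
- by move/eqP: nab; apply; apply: (meet a b aS bS x).
- by move/eqP: nab; apply; apply/esym; apply: (meet b a bS aS x).
have ta : t a \in S' by rewrite S'E; case: (tP a aS).
have tb : t b \in S' by rewrite S'E; case: (tP b bS).
have nt : t a != t b by apply: contraNneq nab => /t_inj ->.
by have /disjP/(_ x)[] := fd' _ _ ta tb nt.
Qed.

(* Menger's theorem, separators being the boundaries of the sets between Y    *)
(* and X. Deleting the edges that leave u removes at most u from any          *)
(* boundary, so the induction only has to avoid boundaries of exact size k.   *)
Lemma linkage e X Y k : subrel e e0 -> Y \subset X ->
  (forall Z, Y \subset Z -> Z \subset X -> k <= #|bd e Z|) -> linked e X Y k.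
Proof.
have [m] := ubnP (#|X :\: Y| + #|bd e Y|).
elim: m => // m IH in e X Y k * => lem ee0 YX bnd.
case: k bnd => [|k] bnd.
  exists set0, (fun=> set0); rewrite cards0 sub0set.
  by split=> // s; rewrite inE.
have sub_del u : subrel (del_out e u) e0 by move=> x y /andP[_ /ee0].
(* A tight set strictly between Y and X splits the problem into two smaller ones. *)
case: (boolP [exists Z : {set V}, [&& Y \proper Z, Z \proper X & #|bd e Z| == k.+1]]).
  case/existsP => Z /and3P[YZ ZX /eqP tight].
  have Y1 := proper_sub YZ; have Z1 := proper_sub ZX.
  have kY := bnd Y (subxx _) YX.
  have lt1 : #|Z :\: Y| < #|X :\: Y|.
    apply: proper_card; apply/properP; split; first by apply: setSD.
    case/properP: ZX => _ [x xX xZ]; exists x; rewrite !inE ?xX ?(negbTE xZ) ?andbF ?andbT //.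
    by apply: contraNN xZ => /(subsetP Y1).
  have lt2 : #|X :\: Z| < #|X :\: Y|.
    apply: proper_card; apply/properP; split; first by apply: setDS.
    case/properP: YZ => _ [x xZ xY]; exists x; rewrite !inE ?xY ?xZ //.
    by rewrite (subsetP Z1).
  apply: (linked_trans Y1 Z1 tight).
    apply: IH => //; first by lia.
    by move=> W YW WZ; apply: bnd => //; apply: subset_trans WZ Z1.
  apply: IH => //; first by lia.
  by move=> W YW WZ; apply: bnd => //; apply: subset_trans Y1 YW.
rewrite negb_exists => /forallP notight.
(* A vertex u on both boundaries forms a set of the linkage alone; deleting it costs every boundary
   at most one vertex. *)
case: (boolP [disjoint bd e Y & bd e X]) => [dYX|]; last first.
  rewrite -setI_eq0 => /set0Pn[u /setIP[uY uX]].
  have [||S [f [SY Sk fS fd]]] := IH (del_out e u) X Y k _ (sub_del u) YX.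
  - by move: lem; rewrite bd_del_out (cardsD1 u (bd e Y)) uY; lia.
  - move=> Z YZ ZX; have := bnd Z YZ ZX; rewrite bd_del_out (cardsD1 u (bd e Z)).
    by case: (u \in _); lia.
  rewrite bd_del_out in SY fS.
  have uS : u \notin S by apply/negP => /(subsetP SY); rewrite !inE eqxx.
  have uf s : s \in S -> u \notin f s.
    case/fS=> _ _ ff _; apply/negP => /(subsetP ff); rewrite !inE eqxx /= orbF.
    by rewrite (subsetP (bd_sub e Y)).
  exists (u |: S), (fun s => if s == u then [set u] else f s); split.
  - rewrite subUset sub1set uY; apply: subset_trans SY _; exact: subsetDl.
  - by rewrite cardsU1 uS Sk.
  - move=> s; rewrite !inE; case: eqVneq => [-> _|su /= sS].
      split; rewrite ?inE ?eqxx ?conn1 //.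
        by rewrite sub1set inE uY orbT.
      by apply/negP => /disjP/(_ u (set11 u) uX).
    have [sf cf ff mf] := fS s sS; split=> //.
      by apply: subset_trans ff _; apply: setUS; apply: subsetDl.
    by apply: contraNN mf; rewrite bd_del_out; set_auto.
  move=> s t; rewrite !inE; case: (eqVneq s u) => [->|su]; case: (eqVneq t u) => [->|tu] //=.
  - by move=> _ tS _; rewrite disjoints1; apply: uf.
  - by move=> sS _ _; rewrite disjoint_sym disjoints1; apply: uf.
  exact: fd.
have kY := bnd Y (subxx _) YX.
have [u uY] : exists u, u \in bd e Y by apply/set0Pn; rewrite -card_gt0; lia.
have uX : u \notin bd e X by apply/negP => uX; have /disjP/(_ u)[] := dYX.
(* Deleting u is harmless: without tight sets, every Z strictly between Y and X has a vertex to
   spare, and u is not on the boundary of X. *)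
have bnd' Z : Y \proper Z -> Z \subset X -> k < #|bd (del_out e u) Z|.
  move=> YZ ZX; rewrite bd_del_out.
  have := bnd Z (proper_sub YZ) ZX; rewrite (cardsD1 u (bd e Z)).
  case: (boolP (u \in bd e Z)) => uZ //= le.
  have := notight Z; rewrite YZ /=.
  have -> : Z \proper X.
    by rewrite properEneq ZX andbT; apply: contraNneq uX => <-.
  by rewrite (cardsD1 u (bd e Z)) uZ /=; lia.
case: (ltnP k.+1 #|bd e Y|) => [ltY|geY].
  have [||S [f [SY Sk fS fd]]] := IH (del_out e u) X Y k.+1 _ (sub_del u) YX.
  - by move: lem; rewrite bd_del_out (cardsD1 u (bd e Y)) uY; lia.
  - move=> Z YZ ZX; case: (eqVneq Y Z) => [<-|YnZ].
      by rewrite bd_del_out; move: ltY; rewrite (cardsD1 u (bd e Y)) uY.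
    by apply: bnd' => //; rewrite properEneq YnZ YZ.
  rewrite bd_del_out in SY fS; exists S, f; split=> //.
    by apply: subset_trans SY _; apply: subsetDl.
  move=> s sS; have [sf cf ff mf] := fS s sS; split=> //.
    by apply: subset_trans ff _; apply: setUS; apply: subsetDl.
  by apply: contraNN mf; rewrite bd_del_out; set_auto.
(* Now Y has exactly k+1 boundary vertices. A neighbour v of u outside Y is moved into Y and takes
   the place of u; the set found for v is finally extended by u. *)
have uinY : u \in Y by apply: (subsetP (bd_sub e Y)).
case/bdP: (uY) => _ [v vY euv].
have vX : v \in X.
  apply: contraNT uX => vX; apply/bdP; split; last by exists v.
  exact: (subsetP YX).
have vYX : v |: Y \subset X by rewrite subUset sub1set vX.
have bd'Y : bd (del_out e u) (v |: Y) \subset v |: (bd e Y :\ u).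
  by rewrite -bd_del_out; apply: bd_add.
have [||S [f [SY Sk fS fd]]] := IH (del_out e u) X (v |: Y) k.+1 _ (sub_del u) vYX.
- have : #|bd (del_out e u) (v |: Y)| <= #|bd e Y|.
    apply: leq_trans (subset_leq_card bd'Y) _.
    by rewrite cardsU1 (cardsD1 u (bd e Y)) uY; case: (v \notin _).
  suff lt : #|X :\: (v |: Y)| < #|X :\: Y|.
    by move=> le; move: lem lt le; clear; lia.
  apply: proper_card; apply/properP; split; first by set_auto.
  by exists v; rewrite !inE ?eqxx ?vX ?vY.
- move=> Z YZ ZX; apply: bnd' => //; apply/properP; split.
    by apply: subset_trans YZ; apply: subsetUr.
  by exists v => //; apply: (subsetP YZ); rewrite !inE eqxx.
have uS : u \notin S by apply/negP => /(subsetP SY)/(subsetP bd'Y); rewrite !inE eqxx;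
   case: (eqVneq u v) vY => // <-; rewrite uinY.
have ff s : s \in S -> f s \subset X :\: Y :|: bd e Y.
  case/fS => _ _ ff _; apply: subset_trans ff _; rewrite subUset; apply/andP; split.
    by set_auto.
  apply: subset_trans bd'Y _; rewrite subUset sub1set !inE vX vY /=.
  by set_auto.
have uf s : s \in S -> u \notin f s.
  case/fS=> _ _ fs _; apply/negP => /(subsetP fs); rewrite 3!inE uinY orbT /=.
  by rewrite bd_del_out !inE eqxx.
have mf s : s \in S -> ~~ [disjoint f s & bd e X].
  case/fS=> _ _ _; apply: contraNN; rewrite bd_del_out; set_auto.
case: (boolP (v \in S)) => vS; last first.
  exists S, f; split=> // [|s sS].
    apply/subsetP => s sS; have := subsetP bd'Y s (subsetP SY s sS).
    by rewrite in_setU1 => /orP[/eqP sv|/setDP[]//]; rewrite sv (negbTE vS) in sS.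
  by have [sf cf _ _] := fS s sS; split; [| | apply: ff|apply: mf].
exists (u |: (S :\ v)), (fun s => if s == u then u |: f v else f s).
have [vf cfv _ _] := fS v vS.
split.
- rewrite subUset sub1set uY; apply/subsetP => s /setD1P[sv sS].
  have := subsetP bd'Y s (subsetP SY s sS).
  by rewrite in_setU1 (negbTE sv) /= => /setDP[].
- by rewrite cardsU1 !inE (negbTE uS) andbF -Sk (cardsD1 v S) vS.
- move=> s; rewrite !inE; case: eqVneq => [-> _|su /= /andP[sv sS]].
    split; rewrite ?inE ?eqxx //.
    + by apply: (connU1 e0sym cfv vf); apply: ee0.
    + by rewrite subUset sub1set inE uY orbT ff.
    by have := mf v vS; apply: contraNN; set_auto.
  by have [sf cf _ _] := fS s sS; split; [| | apply: ff|apply: mf].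
move=> s t; rewrite !inE; case: (eqVneq s u) => [->|su]; case: (eqVneq t u) => [->|tu] //=.
- move=> _ /andP[tv tS] _; have := fd v t vS tS; rewrite eq_sym tv => /(_ isT).
  by move=> d; have := uf t tS; rewrite -disjoints1 => d'; set_auto.
- move=> /andP[tv tS] _ _; have := fd v s vS tS; rewrite eq_sym tv => /(_ isT).
  by move=> d; have := uf s tS; rewrite -disjoints1 => d'; set_auto.
by move=> /andP[_ sS] /andP[_ tS]; apply: fd.
Qed.

End Linkage.

(** * Growing a tree model along a linear layout *)

Section TreeModel.
Variables (V : finType) (e : rel V).
Hypothesis e_sym : symmetric e.
Implicit Types X Y Z P : {set V}.

(* X is the vertex set of an initial segment of a linear layout of vertex     *)
(* separation number at most w.                                               *)
Inductive good (w : nat) : {set V} -> Prop :=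
| Good0 : good w set0
| GoodAdd X v : good w X -> v \notin X -> #|bd e (v |: X)| <= w ->
    good w (v |: X).

Lemma bd_submod Z P :
  #|bd e (Z :&: P)| + #|bd e (Z :|: P)| <= #|bd e Z| + #|bd e P|.
Proof.
rewrite -cardsUI -[leqRHS]cardsUI; apply: leq_add; apply: subset_leq_card.
  apply/subsetP => x /setUP[/bdP[xZP [y yZP exy]]|/bdP[xZP [y yZP exy]]].
    move: xZP yZP; rewrite !inE => /andP[xZ xP]; rewrite negb_and.
    by case/orP=> yn; apply/orP; [left|right]; apply/bdP; split=> //; exists y.
  move: xZP yZP; rewrite !inE negb_or => xZP /andP[yZ yP].
  by case/orP: xZP => xn; apply/orP; [left|right]; apply/bdP; split=> //; exists y.
apply/subsetP => x /setIP[/bdP[/setIP[xZ xP] _] /bdP[_ [y yZP exy]]].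
move: yZP; rewrite !inE negb_or => /andP[yZ yP].
by apply/andP; split; apply/bdP; split=> //; exists y.
Qed.

(** Intersect each initial segment P of the layout of X with Z. Since the union of Z and P has at
    least as large a boundary as Z, submodularity bounds the boundary of the intersection by that of
    P. *)
Lemma good_sub w X Z : good w X -> Z \subset X ->
  (forall Z', Z \subset Z' -> Z' \subset X -> #|bd e Z| <= #|bd e Z'|) ->
  good w Z.
Proof.
move=> gX ZX minZ; suff H P : good w P -> P \subset X -> good w (Z :&: P).
  by have := H X gX (subxx X); have/setIidPl -> := ZX.
elim=> [|{}P v gP IH vP bdP']; first by rewrite setI0 => _; left.
rewrite subUset sub1set => /andP[vX PX].
case: (boolP (v \in Z)) => vZ; last first.
  have -> : Z :&: (v |: P) = Z :&: P; last exact: IH.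
  by apply/setP => x; rewrite !inE; case: eqVneq => // ->; rewrite (negbTE vZ).
have E : Z :&: (v |: P) = v |: (Z :&: P).
  by apply/setP => x; rewrite !inE; case: eqVneq => // ->; rewrite vZ.
rewrite E; apply: GoodAdd; [exact: IH|by rewrite inE negb_and vP orbT|].
rewrite -E; have := bd_submod Z (v |: P).
have : #|bd e Z| <= #|bd e (Z :|: (v |: P))|.
  by apply: minZ; rewrite ?subsetUl // !subUset ZX sub1set vX PX.
by lia.
Qed.

Lemma good_max w i Y : good w Y -> #|bd e Y| <= i ->
  exists X, [/\ Y \subset X, good w X, #|bd e X| <= i &
    forall Z, good w Z -> X \subset Z -> #|bd e Z| <= i -> Z = X].
Proof.
move=> gY bY; pose Q X := [&& Y \subset X, `[< good w X >] & #|bd e X| <= i].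
have QY : Q Y by rewrite /Q subxx bY andbT; apply/asboolP.
case: (arg_maxnP (fun C : {set V} => #|C|) QY) => X /and3P[YX /asboolP gX bX] maxX.
exists X; split=> // Z gZ XZ bZ; apply/esym/eqP; rewrite eqEcard XZ; apply: maxX.
by rewrite /Q (subset_trans YX XZ) bZ andbT; apply/asboolP.
Qed.

(* Diestel's proof of the excluded forest theorem: the model grows together   *)
(* with a layout whose boundary it meets in every branch set.                 *)
Lemma tree_model (pa : nat -> nat) N :
  (forall v, 0 < v < N -> pa v < v) -> ~ good N setT ->
  exists B : nat -> {set V},
    [/\ forall v, v < N -> conn e (B v),
        forall u v, u < v -> v < N -> [disjoint B u & B v] &
        forall v, 0 < v < N -> touch e (B (pa v)) (B v)].
Proof.
move=> paP ngood.
(* The vertices [b v] on the boundary of X keep the branch sets extendable, and the maximality of X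
   provides the lower bounds that Menger's theorem asks for. *)
suff H i : i <= N -> exists X (B : nat -> {set V}) (b : nat -> V),
    [/\ [/\ good N X, #|bd e X| <= i &
         forall Z, good N Z -> X \subset Z -> #|bd e Z| <= i -> Z = X],
        forall v, v < i -> [/\ conn e (B v), B v \subset X & b v \in B v :&: bd e X],
        forall u v, u < v -> v < i -> [disjoint B u & B v] &
        forall v, 0 < v < i -> touch e (B (pa v)) (B v)].
  have [X [B [b [_ HB HD HT]]]] := H N (leqnn N).
  by exists B; split=> // v /HB[].
elim: i => [_|i IH iN].
  have b0 : #|bd e set0| <= 0.
    by apply: leq_trans (subset_leq_card (bd_sub e set0)) _; rewrite cards0.
  have [X [_ gX bX mX]] := good_max (Good0 N) b0.
  case: (eqVneq X setT) => [XT|]; first by rewrite XT in gX.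
  rewrite -subTset => /subsetPn[x0 _ _].
  by exists X, (fun=> set0), (fun=> x0); split=> // v; rewrite ?ltn0 ?andbF.
have [X [B [b [[gX bX mX] HB HD HT]]]] := IH (ltnW iN).
(* The new branch set starts at a vertex y outside X that sees the branch set of the parent. *)
have [y yX yP] : exists2 y, y \notin X & 0 < i -> e (b (pa i)) y.
  case: (posnP i) => [i0|i_gt0].
    case: (eqVneq X setT) => [XT|]; first by rewrite XT in gX.
    by rewrite -subTset => /subsetPn[y _ yX]; exists y; rewrite // i0.
  have /HB[_ _ /setIP[_ /bdP[_ [y yX bpy]]]] : pa i < i by apply: paP; rewrite i_gt0.
  by exists y.
pose Y := y |: X.
have bY : bd e Y \subset y |: bd e X by apply: bd_add.
have ybX : y \notin bd e X by apply: contraNN yX; apply: (subsetP (bd_sub e X)).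
have cbY : #|bd e Y| <= i.+1.
  by apply: leq_trans (subset_leq_card bY) _; rewrite cardsU1 ybX.
have XY : X \subset Y by apply: subsetUr.
have gY : good N Y by apply: GoodAdd => //; apply: leq_trans cbY iN.
(* A smaller boundary would contradict the maximality of X. It follows that the boundary of X has
   exactly i vertices, one in each branch set. *)
have cbY' : #|bd e Y| = i.+1.
  apply/eqP; rewrite eqn_leq cbY ltnNge; apply/negP => /(mX Y gY XY) YX.
  by case/negP: yX; rewrite -YX setU11.
have cX : #|bd e X| = i.
  apply/eqP; rewrite eqn_leq bX /=.
  have := subset_leq_card bY; rewrite cbY' cardsU1 ybX; lia.
have bYE : bd e Y = y |: bd e X.
  by apply/eqP; rewrite eqEcard bY cbY' cardsU1 ybX cX add1n leqnn.
have [X' [YX' gX' bX' mX']] := good_max gY cbY.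
(* Otherwise a set W of least boundary between Y and X' would be good by [good_sub], with boundary
   at most i, and would properly contain X. *)
have bnd Z : Y \subset Z -> Z \subset X' -> i.+1 <= #|bd e Z|.
  move=> YZ ZX'; pose Q (W : {set V}) := (Y \subset W) && (W \subset X').
  have QZ : Q Z by rewrite /Q YZ.
  case: (arg_minnP (fun C : {set V} => #|bd e C|) QZ) => W /andP[YW WX'] minW.
  apply: leq_trans (minW Z QZ); rewrite ltnNge; apply/negP => cW.
  have gW : good N W.
    apply: (good_sub gX' WX') => W' WW' W'X'; apply: minW.
    by rewrite /Q (subset_trans YW WW').
  have WX := mX W gW (subset_trans XY YW) cW.
  by case/negP: yX; rewrite -WX (subsetP YW) // setU11.
have [S [f [SY Sk fS fd]]] := linkage e_sym (fun _ _ => id) YX' bnd.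
have SE : S = bd e Y by apply/eqP; rewrite eqEcard SY Sk cbY' leqnn.
have bS v : v < i -> b v \in S.
  by case/HB=> _ _ /setIP[_]; rewrite SE bYE in_setU1 orbC => ->.
have yS : y \in S by rewrite SE bYE setU11.
have ynb v : v < i -> b v != y.
  by case/HB=> _ _ /setIP[_ bv]; apply: contraNneq ybX => <-.
have bsurj w : w \in bd e X -> exists2 v, v < i & w = b v.
  have binj : injective (fun v : 'I_i => b v).
    move=> u v buv; apply: val_inj; case: (ltngtP u v) => // uv.
      have /disjP/(_ (b u))[] := HD u v uv (ltn_ord v).
        by case: (HB u (ltn_ord u)) => _ _ /setIP[].
      by rewrite buv; case: (HB v (ltn_ord v)) => _ _ /setIP[].
    have /disjP/(_ (b u))[] := HD v u uv (ltn_ord u).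
      by rewrite buv; case: (HB v (ltn_ord v)) => _ _ /setIP[].
    by case: (HB u (ltn_ord u)) => _ _ /setIP[].
  have <- : [set b v | v : 'I_i] = bd e X.
    apply/eqP; rewrite eqEcard card_imset // card_ord cX leqnn andbT.
    by apply/subsetP => _ /imsetP[v _ ->]; case: (HB v (ltn_ord v)) => _ _ /setIP[].
  by case/imsetP => v _ ->; exists v.
have fB s v x : s \in S -> v < i -> x \in f s -> x \in B v -> s = b v.
  move=> sS vi xf xB; have [_ _ ff _] := fS s sS; have [_ BX bv] := HB v vi.
  have xX := subsetP BX x xB; have xY := subsetP XY x xX.
  have xbY : x \in bd e Y by have := subsetP ff x xf; rewrite inE in_setD xY.
  have xs : x = s.
    apply/eqP; apply: contraT => nxs; have xS : x \in S by rewrite SE.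
    by have /disjP/(_ x)[] := fd x s xS sS nxs => //; case: (fS x xS).
  have : x \in bd e X.
    by move: xbY; rewrite bYE in_setU1 => /orP[/eqP xy|//]; rewrite -xy xX in yX.
  case/bsurj => v' v'i xb; rewrite -xs xb.
  have : b v' \in B v' by case: (HB v' v'i) => _ _ /setIP[].
  rewrite -xb => xB'; case: (ltngtP v v') => [vv'|vv'|-> //].
    by have /disjP/(_ x xB xB')[] := HD v v' vv' v'i.
  by have /disjP/(_ x xB' xB)[] := HD v' v vv' vi.
(* The linkage prolongs every old branch set to the new boundary, and its set at y is the new branch
   set. *)
pose B' v := if v == i then f y else B v :|: f (b v).
pose b' v := odflt y [pick x in B' v :&: bd e X'].
have fd' s t x : s \in S -> t \in S -> x \in f s -> x \in f t -> s = t.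
  move=> sS tS xs xt; apply/eqP; apply: contraT => st.
  by have /disjP/(_ x xs xt)[] := fd s t sS tS st.
have fX' s : s \in S -> f s \subset X'.
  case/fS=> _ _ ff _; apply: subset_trans ff _; rewrite subUset subsetDl.
  by apply: subset_trans (bd_sub e Y) YX'.
exists X', B', b'; split=> //.
- move=> v; rewrite ltnS leq_eqVlt => vi.
  have [cB' BX' mB'] : [/\ conn e (B' v), B' v \subset X' &
      ~~ [disjoint B' v & bd e X']].
    rewrite /B'; case: eqVneq vi => [_ _|_ /= vi]; first by have [] := fS y yS;
      split=> //; apply: fX'.
    have [sf cf ff mf] := fS _ (bS v vi); have [cB BX /setIP[bB _]] := HB v vi.
    split; last by apply: contraNN mf; set_auto.
      apply: connU => //; apply/orP; right; apply/set0Pn; exists (b v).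
      by rewrite inE bB sf.
    by rewrite subUset fX' ?bS // (subset_trans BX) // (subset_trans XY).
  split=> //; move: mB'; rewrite -setI_eq0 => /set0Pn[x xP].
  by rewrite /b'; case: pickP => [//|/(_ x)]; rewrite xP.
- move=> u v uv; rewrite ltnS /B' => vi.
  have ui := leq_trans uv vi; rewrite (ltn_eqF ui).
  apply/disjP => x; move: vi; rewrite leq_eqVlt; case: eqVneq => [_ _|_ /= vi].
    case/setUP => [xB xf|xf xf'].
      by have /eqP := fB y u x yS ui xf xB; rewrite eq_sym (negbTE (ynb u ui)).
    by have /eqP := fd' _ _ _ (bS u ui) yS xf xf'; rewrite (negbTE (ynb u ui)).
  have buv : b u <> b v.
    move=> buv; have /disjP/(_ (b u))[] := HD u v uv vi.
      by case: (HB u ui) => _ _ /setIP[].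
    by rewrite buv; case: (HB v vi) => _ _ /setIP[].
  case/setUP => xu /setUP[xv|xv].
  - by have /disjP/(_ x)[] := HD u v uv vi.
  - by apply: buv; apply/esym; apply: (fB _ _ x _ ui xv xu); apply: bS.
  - by apply: buv; apply: (fB _ _ x _ vi xu xv); apply: bS.
  by apply: buv; apply: (fd' _ _ x _ _ xu xv); apply: bS.
move=> v /andP[v0]; rewrite ltnS leq_eqVlt /B' => vi.
have pv : pa v < v.
  by apply: paP; rewrite v0 /=; case/orP: vi => [/eqP ->//|/ltn_trans]; apply.
case: eqVneq vi pv => [-> _ pi|_ /= vi pv].
  rewrite (ltn_eqF pi); have [_ _ /setIP[bB _]] := HB _ pi.
  have [yf _ _ _] := fS y yS.
  apply: (@touchI _ _ _ _ (b (pa i)) y); rewrite ?inE ?bB //.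
  by apply: yP; apply: leq_ltn_trans pi.
rewrite (ltn_eqF (ltn_trans pv vi)).
by apply: touchS (HT v _); rewrite ?subsetUl // v0.
Qed.

End TreeModel.

(** * From linear layouts to path-decompositions *)

Lemma good_layout (V : finType) (e : rel V) w X : good e w X ->
  exists s : seq V, [/\ uniq s, s =i X &
    forall i, #|bd e [set x in take i s]| <= w].
Proof.
have bd0 : #|bd e set0| <= w.
  by apply: leq_trans (subset_leq_card (bd_sub e set0)) _; rewrite cards0.
elim=> [|{}X v _ [s [Us sX bs]] vX bX].
  exists [::]; split.
  - by [].
  - by move=> x; rewrite inE.
  - move=> i; suff -> : [set x in take i [::]] = set0 :> {set V} by [].
    by apply/setP => x; rewrite !inE.
exists (rcons s v); split; first by rewrite rcons_uniq sX vX.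
  by move=> x; rewrite mem_rcons !inE sX.
move=> i; rewrite -cats1 take_cat; case: ltnP => // le.
case: (posnP (i - size s)) => [->|gt0].
  rewrite take0 cats0; have := bs (size s); by rewrite take_size.
rewrite take_oversize //; suff -> : [set x in s ++ [:: v]] = v |: X by [].
by apply/setP => x; rewrite !inE mem_cat inE sX orbC.
Qed.

(** The bag at position i consists of the vertex there and of the boundary of the earlier vertices.
    A vertex then occupies the bags from its own position up to the last position among itself and
    its neighbours. *)
Lemma good_pathwidth (G : sgraph) w : good (@adj G) w setT -> pathwidth G <= w.
Proof.
case/good_layout => s [Us sT bs].
suff [m [W [Wd Ww]]] : exists m (W : 'I_m.+1 -> {set G}),
    path_decomposition W /\ width W <= w.
  rewrite /pathwidth; case: ex_minnP => w0 _ minw; apply: leq_trans Ww.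
  by apply: minw; apply/asboolP; exists m, W.
have mem_s v : v \in s by rewrite sT inE.
case Es: {1}s => [|x0 s'].
  exists 0, (fun=> set0); split; last by rewrite /width big_ord1 cards0.
  by split=> [x|v]; have := mem_s; rewrite Es => /(_ _); [move/(_ x)|move/(_ v)].
have size_s : size s = (size s').+1 by rewrite Es.
have idxP v : index v s < (size s').+1 by rewrite -size_s index_mem.
pose idx v := Ordinal (idxP v).
exists (size s'), (fun i : 'I__ => nth x0 s i |: bd (@adj G) [set x in take i s]).
have memW v (i : 'I_(size s').+1) :
    (v \in nth x0 s i |: bd (@adj G) [set x in take i s]) =
    (index v s == i) || (index v s < i) && [exists y, (i <= index y s) && (v -- y)].
  rewrite in_setU1; congr (_ || _).
    apply/eqP/eqP => [->|<-]; last by rewrite nth_index.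
    by rewrite index_uniq // size_s.
  apply/bdP/andP => [[]|[vi /existsP[y /andP[iy vy]]]].
    rewrite inE in_take // => vi [y]; rewrite inE in_take // -leqNgt => yi vy.
    by split=> //; apply/existsP; exists y; rewrite yi.
  by rewrite inE in_take //; split=> //; exists y; rewrite // inE in_take // -leqNgt.
split; last first.
  rewrite /width leq_subLR; apply/bigmax_leqP => i _; rewrite add1n.
  apply: leq_trans (leq_card_setU _ _) _; rewrite cards1 add1n ltnS; exact: bs.
split=> [x y xy|v].
  wlog lt : x y xy / index x s < index y s.
    move=> H; case: (ltngtP (index x s) (index y s)) => [lt|lt|E].
    - exact: H.
    - by case: (H y x) => // [|i]; rewrite 1?adj_sym // andbC; exists i.
    - by have := adj_irr x; rewrite {2}(_ : x = y) ?xy //; apply: (index_inj x (mem_s x) (mem_s y) E).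
  exists (idx y); rewrite !memW /= eqxx andbT lt.
  by apply/orP; right; apply/existsP; exists y; rewrite leqnn.
pose Q (l : 'I_(size s').+1) := (l == idx v) || (v -- nth x0 s l).
have Qv : Q (idx v) by rewrite /Q eqxx.
case: (arg_maxnP (fun l : 'I__ => l : nat) Qv) => b Qb maxb.
exists (idx v), b; split=> [|i]; first exact: maxb.
rewrite memW /=; apply/orP/andP => [[/eqP vi|/andP[vi /existsP[y /andP[iy vy]]]]|[vi ib]].
- by rewrite -vi leqnn; split=> //; apply: (maxb (idx v)).
- split; first exact: ltnW.
  by apply: leq_trans iy _; apply: (maxb (idx y)); rewrite /Q /= nth_index // vy orbT.
rewrite leq_eqVlt in vi; case/orP: vi => vi; [by left|right].
rewrite vi; apply/existsP; exists (nth x0 s b); rewrite index_uniq ?size_s // ib.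
case/orP: Qb => [/eqP bv|//]; rewrite bv /= in ib.
by have := leq_ltn_trans ib vi; rewrite ltnn.
Qed.

(** * Binary tree models as nested vertex sets *)

Section TreeModels.
Variables (V : finType) (e : rel V).
Implicit Types (A B C D S X Z R U : {set V}).

Definition node (P : {set V} -> {set V} -> Prop) Z A :=
  exists Z1 A1 Z2 A2,
    [/\ conn e Z, P Z1 A1, P Z2 A2 &
     [/\ A = Z :|: (A1 :|: A2), [disjoint Z & A1 :|: A2], [disjoint A1 & A2],
         touch e Z Z1 & touch e Z Z2]].

(** Imposed at every level, the three negative conditions make branch sets of nonadjacent tree
    vertices anticomplete. *)
Definition inode (P : {set V} -> {set V} -> Prop) Z A :=
  exists Z1 A1 Z2 A2,
    [/\ conn e Z, P Z1 A1, P Z2 A2,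
     [/\ A = Z :|: (A1 :|: A2), [disjoint Z & A1 :|: A2], [disjoint A1 & A2],
         touch e Z Z1 & touch e Z Z2] &
     [/\ ~~ touch e A1 A2, ~~ touch e Z (A1 :\: Z1) & ~~ touch e Z (A2 :\: Z2)]].

(* [btm M Z A]: the complete binary tree of height M has a minor model with   *)
(* union A of branch sets and root branch set Z; [ibtm] is the same for       *)
(* induced minors.                                                            *)
Fixpoint btm M Z A : Prop :=
  if M is M'.+1 then node (btm M') Z A else conn e Z /\ A = Z.

Fixpoint ibtm M Z A : Prop :=
  if M is M'.+1 then inode (ibtm M') Z A else conn e Z /\ A = Z.

Lemma btmS M Z A : btm M.+1 Z A -> node (btm M) Z A. Proof. by []. Qed.
Lemma ibtmS M Z A : ibtm M.+1 Z A -> inode (ibtm M) Z A. Proof. by []. Qed.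

Definition clique_model n A := exists B : nat -> {set V},
  [/\ forall i, i < n -> conn e (B i), forall i, i < n -> B i \subset A &
      forall i j, i < j -> j < n -> [disjoint B i & B j] /\ touch e (B i) (B j)].

Hypothesis e_sym : symmetric e.

Lemma btm_root M Z A : btm M Z A -> [/\ conn e Z, Z \subset A & conn e A].
Proof.
elim: M Z A => [|M IH] Z A /=; first by case=> cZ ->.
case=> Z1 [A1 [Z2 [A2 [cZ t1 t2 [-> _ _ ZZ1 ZZ2]]]]].
have [_ ZA1 cA1] := IH _ _ t1; have [_ ZA2 cA2] := IH _ _ t2.
split; rewrite ?subsetUl // setUA; apply: connU => //.
  by apply: connU; rewrite // (touchS _ ZA1 ZZ1).
by rewrite (touchS _ ZA2 ZZ2) // subsetUl.
Qed.

Lemma ibtm_root M Z A : ibtm M Z A -> conn e Z /\ Z \subset A.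
Proof.
case: M => [|M] /=; first by case=> cZ ->.
by case=> Z1 [A1 [Z2 [A2 [cZ _ _ [-> _ _ _ _] _]]]]; split; rewrite ?subsetUl.
Qed.

(** If one of the two grandchild models below [Z1] misses both a and b, keep it and let Y be the
    rest of A. Otherwise each of them contains one of a and b, so Z with the first child model can
    serve as Y, leaving a grandchild model below [Z2]. *)
Lemma btm_avoid M Z A a b : btm M.+2 Z A -> a \in A -> b \in A ->
  exists Y Z' A', [/\ conn e Y, a \in Y, b \in Y, Y \subset A &
    [/\ btm M Z' A', A' \subset A & [disjoint Y & A']]].
Proof.
case/btmS=> Z1 [A1 [Z2 [A2 [cZ t1 t2 [EA dZ d12 ZZ1 ZZ2]]]]] aA bA.
have [cZ2 ZA2 cA2] := btm_root t2; have [_ ZA1 cA1] := btm_root t1.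
case/btmS: t1 => Z11 [A11 [Z12 [A12 [cZ1 t11 t12 [EA1 dZ1 d11 ZZ11 ZZ12]]]]].
case/btmS: t2 => Z21 [A21 [Z22 [A22 [_ t21 t22 [EA2 dZ2 d22 ZZ21 ZZ22]]]]].
have [_ ZA11 cA11] := btm_root t11; have [_ ZA12 cA12] := btm_root t12.
have [_ ZA21 cA21] := btm_root t21; have [_ ZA22 cA22] := btm_root t22.
have cY1 : conn e (Z :|: A2).
  by apply: connU; rewrite // (touchS _ ZA2 ZZ2).
have sub B : B \subset A1 -> B \subset A by move=> ?; rewrite EA; set_auto.
have Z1A1 : Z1 \subset A1 by rewrite EA1 subsetUl.
case: (boolP ((a \in A11) || (b \in A11))) => [in11|]; last first.
  rewrite negb_or => /andP[na nb].
  exists (Z :|: A2 :|: (Z1 :|: A12)), Z11, A11; split.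
  - apply: connU => //; first by apply: connU; rewrite // (touchS _ ZA12 ZZ12).
    by rewrite (touchS _ _ ZZ1) // ?subsetUl.
  - move: aA na; rewrite EA EA1 !inE; case: (a \in A11) => //.
    by case/or3P=> [->|/or3P[->|//|->]|->]; rewrite ?orbT.
  - move: bA nb; rewrite EA EA1 !inE; case: (b \in A11) => //.
    by case/or3P=> [->|/or3P[->|//|->]|->]; rewrite ?orbT.
  - by rewrite EA EA1; set_auto.
  by split=> //; rewrite ?EA EA1 in dZ d12 *; set_auto.
case: (boolP ((a \in A12) || (b \in A12))) => [in12|]; last first.
  rewrite negb_or => /andP[na nb].
  exists (Z :|: A2 :|: (Z1 :|: A11)), Z12, A12; split.
  - apply: connU => //; first by apply: connU; rewrite // (touchS _ ZA11 ZZ11).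
    by rewrite (touchS _ _ ZZ1) // ?subsetUl.
  - move: aA na; rewrite EA EA1 !inE; case: (a \in A12) => //.
    by case/or3P=> [->|/or3P[->|->|//]|->]; rewrite ?orbT.
  - move: bA nb; rewrite EA EA1 !inE; case: (b \in A12) => //.
    by case/or3P=> [->|/or3P[->|->|//]|->]; rewrite ?orbT.
  - by rewrite EA EA1; set_auto.
  by split=> //; rewrite ?EA EA1 in dZ d12 *; set_auto.
exists (Z :|: A1), Z21, A21; split.
- by apply: connU; rewrite // (touchS _ ZA1 ZZ1).
- have d : [disjoint A11 & A12] by []; rewrite inE EA1 !inE.
  case/orP: in11 => [->|b11]; rewrite ?orbT //.
  by case/orP: in12 => [->|b12]; rewrite ?orbT //; have /disjP/(_ b)[] := d.
- have d : [disjoint A11 & A12] by []; rewrite inE EA1 !inE.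
  case/orP: in11 => [a11|->]; rewrite ?orbT //.
  by case/orP: in12 => [a12|->]; rewrite ?orbT //; have /disjP/(_ a)[] := d.
- by rewrite EA; set_auto.
by split=> //; rewrite ?EA EA2 in dZ d12 *; set_auto.
Qed.

End TreeModels.

Fixpoint btree_size i := if i is i'.+1 then (btree_size i' + btree_size i').+1 else 1.

(* The parent function of the complete binary tree of height i whose          *)
(* vertices are numbered in preorder.                                         *)
Fixpoint preorder_parent i v :=
  if i is i'.+1 then
    if v <= btree_size i' then if v == 1 then 0 else (preorder_parent i' v.-1).+1
    else if v == (btree_size i').+1 then 0
    else preorder_parent i' (v - (btree_size i').+1) + (btree_size i').+1
  else 0.

Lemma btree_size_gt0 i : 0 < btree_size i. Proof. by case: i. Qed.

Lemma preorder_parent_lt i v : 0 < v < btree_size i -> preorder_parent i v < v.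
Proof.
elim: i v => [|i IH] v /=; first by lia.
have s_gt0 := btree_size_gt0 i.
move=> vi; case: ifP => vs; case: ifP => v1; try lia.
  by have := IH v.-1; lia.
by have := IH (v - (btree_size i).+1); lia.
Qed.

Lemma preorder_btm (V : finType) (e : rel V) i (B : nat -> {set V}) :
  (forall v, v < btree_size i -> conn e (B v)) ->
  (forall u v, u < v -> v < btree_size i -> [disjoint B u & B v]) ->
  (forall v, 0 < v < btree_size i -> touch e (B (preorder_parent i v)) (B v)) ->
  btm e i (B 0) (\bigcup_(v < btree_size i) B v).
Proof.
elim: i B => [|i IH] B cB dB tB.
  by split; [apply: cB|rewrite big_ord1].
have s_gt0 := btree_size_gt0 i; set s := btree_size i in IH cB dB tB s_gt0 *.
exists (B 1), (\bigcup_(v < s) B v.+1), (B s.+1), (\bigcup_(v < s) B (v + s.+1)).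
split; first exact: cB.
- apply: (IH (fun v => B v.+1)) => [v vs|u v uv vs|v vs].
  + by apply: cB; rewrite /= -/s; lia.
  + by apply: dB; rewrite /= -/s; lia.
  have := tB v.+1; rewrite /= -/s; have -> : v < s by lia.
  by have -> : (v.+1 == 1) = false by [lia]; apply; lia.
- apply: (IH (fun v => B (v + s.+1))) => [v vs|u v uv vs|v vs].
  + by apply: cB; rewrite /= -/s; lia.
  + by apply: dB; rewrite /= -/s; lia.
  have := tB (v + s.+1); rewrite /= -/s; have -> : (v + s.+1 <= s) = false by lia.
  by have -> : (v + s.+1 == s.+1) = false by [lia]; rewrite addnK; apply; lia.
split.
- apply/setP => x; rewrite !inE; apply/bigcupP/or3P.
    case=> -[v /= vs] _ xB; case: (posnP v) => [v0|v0]; first by rewrite -v0; constructor.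
    case: (leqP v s) => lvs.
      have v1 : v.-1 < s by lia.
      by apply: Or32; apply/bigcupP; exists (Ordinal v1); rewrite //= prednK.
    have v1 : v - s.+1 < s by rewrite -/s in vs; lia.
    by apply: Or33; apply/bigcupP; exists (Ordinal v1); rewrite //= subnK.
  case=> [xB|/bigcupP[v _ xB]|/bigcupP[v _ xB]].
  + by exists ord0.
  + have vs : v.+1 < (s + s).+1 by have := ltn_ord v; lia.
    by exists (Ordinal vs).
  have vs : v + s.+1 < (s + s).+1 by have := ltn_ord v; lia.
  by exists (Ordinal vs).
- apply/disjP => x x0; rewrite inE => /orP[]/bigcupP[v _ xB]; have vs := ltn_ord v.
    have /disjP/(_ x x0 xB)[] : [disjoint B 0 & B v.+1].
    by apply: dB; rewrite /= -/s; lia.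
  have /disjP/(_ x x0 xB)[] : [disjoint B 0 & B (v + s.+1)].
  by apply: dB; rewrite /= -/s; lia.
- apply/disjP => x /bigcupP[u _ xu] /bigcupP[v _ xv].
  have us := ltn_ord u; have vs := ltn_ord v.
  have /disjP/(_ x xu xv)[] : [disjoint B u.+1 & B (v + s.+1)].
  by apply: dB; rewrite /= -/s; lia.
- by have := tB 1; rewrite /= -/s s_gt0; apply; lia.
by have := tB s.+1; rewrite /= -/s ltnn eqxx; apply; lia.
Qed.

(** * From minors to induced minors *)

Section Components.
Variables (V : finType) (e : rel V).
Hypothesis e_sym : symmetric e.
Implicit Types (B C S : {set V}).

Lemma component_absorb S C B : ~~ touch e C (S :\: C) -> conn e B ->
  B \subset S -> touch e C B || (C :&: B != set0) -> B \subset C.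
Proof.
move=> nt cB BS CB; have BC0 : B :&: C != set0.
  case/orP: CB => [/touchP[x [y [xC yB exy]]]|]; last by rewrite setIC.
  apply/set0Pn; exists y; rewrite inE yB; apply: contraNT nt => yC.
  by apply: (touchI xC _ exy); rewrite inE yC (subsetP BS).
case: (eqVneq (B :&: C) B) => [<-|BCB]; first exact: subsetIr.
case/negP: nt; apply: touchS (conn_cut cB (subsetIl B C) BC0 BCB); set_auto.
Qed.

End Components.

(* The relation [touch e] on {set V} plays the role of the graph obtained by  *)
(* contracting the members of a family J of disjoint connected sets.          *)
Section Contraction.
Variables (V : finType) (e : rel V).
Hypothesis e_sym : symmetric e.
Variable J : {set {set V}}.
Hypothesis J_conn : forall S, S \in J -> conn e S.
Hypothesis J_disj : forall S T, S \in J -> T \in J -> S != T -> [disjoint S & T].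
Implicit Types (F K : {set {set V}}).

Lemma cover_disjoint F K : F \subset J -> K \subset J -> [disjoint F & K] ->
  [disjoint cover F & cover K].
Proof.
move=> FJ KJ dFK; apply/disjP => x /bigcupP[S SF xS] /bigcupP[T TK xT].
have ST : S != T by apply/eqP => ST; have /disjP/(_ S SF)[] := dFK; rewrite ST.
by have /disjP/(_ x xS xT) := J_disj (subsetP FJ S SF) (subsetP KJ T TK) ST.
Qed.

Lemma touch_cover F K : touch (touch e) F K = touch e (cover F) (cover K).
Proof.
apply/touchP/touchP => [[S [T [SF TK /touchP[x [y [xS yT exy]]]]]]|].
  by exists x, y; split=> //; apply/bigcupP; [exists S|exists T].
case=> x [y [/bigcupP[S SF xS] /bigcupP[T TK yT] exy]].
by exists S, T; split=> //; apply: (touchI xS yT exy).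
Qed.

(** A cut of the union either splits a member of F, which is connected, or is a union of members and
    gives a cut of F. *)
Lemma conn_cover F : F \subset J -> conn (touch e) F -> conn e (cover F).
Proof.
move=> FJ cF; have [S0 S0F] := conn_neq0 cF.
have [x0 x0S] := conn_neq0 (J_conn (subsetP FJ _ S0F)).
apply: (@conn_from _ _ e_sym _ x0); first by apply/bigcupP; exists S0.
move=> B x0B BF BnF.
case: (boolP [exists S in F, (S :&: B != set0) && ~~ (S \subset B)]).
  case/exists_inP => S SF /andP[SB0 nSB].
  have SBS : S :&: B != S by apply: contraNneq nSB => <-; apply: subsetIr.
  have := conn_cut (J_conn (subsetP FJ S SF)) (subsetIl S B) SB0 SBS.
  apply: touchS; first exact: subsetIr.
  apply/subsetP => x /setDP[xS]; rewrite !inE xS /= => ->.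
  by apply/bigcupP; exists S.
rewrite negb_exists_in => /forall_inP H.
have {}H S x : S \in F -> x \in S -> x \in B -> S \subset B.
  move=> SF xS xB; have := H S SF; rewrite negb_and !negbK => /orP[/eqP SB0|//].
  by have := in_set0 x; rewrite -SB0 inE xS xB.
pose C := [set S in F | S \subset B].
have CF : C \subset F by apply/subsetP => T; rewrite inE => /andP[].
have C0 : C != set0 by apply/set0Pn; exists S0; rewrite inE S0F (H S0 x0).
have CnF : C != F.
  apply: contraNneq BnF => CF'; rewrite eqEsubset BF; apply/bigcupsP => S.
  by rewrite -CF' inE => /andP[].
have := conn_cut cF CF C0 CnF; rewrite touch_cover; apply: touchS.
  by apply/bigcupsP => S; rewrite inE => /andP[].
apply/subsetP => x /bigcupP[S]; rewrite !inE => /andP[nC SF] xS.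
apply/andP; split; last by apply/bigcupP; exists S.
by apply: contraNN nC => xB; rewrite SF (H S x).
Qed.

Lemma coverU F K : cover (F :|: K) = cover F :|: cover K.
Proof. exact: bigcup_setU. Qed.

Lemma ibtm_cover k (Z A : {set {set V}}) : A \subset J ->
  ibtm (touch e) k Z A -> ibtm e k (cover Z) (cover A).
Proof.
elim: k Z A => [|k IH] Z A AJ.
  by case=> cZ AZ; rewrite AZ in AJ *; split=> //; apply: conn_cover.
case/ibtmS=> Z1 [A1 [Z2 [A2 [cZ m1 m2 [EA dZ d12 t1 t2] [n12 n1 n2]]]]].
have [_ ZA1] := ibtm_root m1; have [_ ZA2] := ibtm_root m2.
have [ZJ A1J A2J] : [/\ Z \subset J, A1 \subset J & A2 \subset J].
  by move: AJ; rewrite EA !subUset => /and3P.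
have diff (B B' : {set {set V}}) : B' \subset J -> ~~ touch (touch e) Z (B :\: B') ->
    ~~ touch e (cover Z) (cover B :\: cover B').
  move=> B'J /ntouchP nt; apply/ntouchP => x y /bigcupP[S SZ xS].
  case/setDP=> /bigcupP[T TB yT] yB'; apply: contraT; rewrite negbK => exy.
  suff TB'' : T \in B :\: B'.
    by have := nt S T SZ TB''; rewrite (touchI xS yT exy).
  rewrite inE TB andbT; apply: contraNN yB' => TB'.
  by apply/bigcupP; exists T.
exists (cover Z1), (cover A1), (cover Z2), (cover A2); split.
- exact: conn_cover.
- exact: IH.
- exact: IH.
- split; rewrite -?touch_cover //.
  + by rewrite EA !coverU.
  + by rewrite -coverU; apply: cover_disjoint; rewrite // subUset A1J.
  + exact: cover_disjoint.
split; rewrite -?touch_cover //; apply: diff => //.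
  exact: subset_trans ZA1 A1J.
exact: subset_trans ZA2 A2J.
Qed.

(** Each lifted branch set contains a whole member of J, so a set that sees all members of J sees
    all branch sets. *)
Lemma clique_cover n : clique_model (touch e) n J ->
  exists B : nat -> {set V},
  [/\ forall i, i < n -> conn e (B i),
      forall i, i < n -> exists2 S, S \in J & S \subset B i,
      forall i, i < n -> B i \subset cover J &
      forall i j, i < j -> j < n -> [disjoint B i & B j] /\ touch e (B i) (B j)].
Proof.
case=> B [cB BJ dtB]; exists (fun i => cover (B i)); split=> [i ni|i ni|i ni|i j ij jn].
- by apply: conn_cover; [apply: BJ|apply: cB].
- have [S SB] := conn_neq0 (cB i ni); exists S; first exact: (subsetP (BJ i ni)).
  by apply/subsetP => x xS; apply/bigcupP; exists S.
- by apply/bigcupsP => S /(subsetP (BJ i ni)) SJ; apply/subsetP => x xS; apply/bigcupP; exists S.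
have [d t] := dtB i j ij jn; rewrite -touch_cover; split=> //.
by apply: cover_disjoint => //; apply: BJ => //; apply: ltn_trans jn.
Qed.

End Contraction.

(** * Cleaning a tree model, and induced models grown from a root vertex *)

Section CleanOrHit.
Variables (V : finType) (e : rel V).
Hypothesis e_sym : symmetric e.
Implicit Types (A B C D S X Z R U : {set V}).

(* If every block of height h sees R, the blocks are contracted, which costs  *)
(* two levels per level of the new model: a branch set absorbs one grandchild *)
(* block on each side to see R, and its other grandchildren become children.  *)
Lemma clean_or_hit R h j Z A : btm e (h + j.*2) Z A ->
  (exists Z' A', [/\ btm e h Z' A', A' \subset A & ~~ touch e R A']) \/
  (exists X J, [/\ btm (touch e) j [set X] J, Z \subset X,
     forall S, S \in J -> [/\ conn e S, S \subset A & touch e R S] &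
     forall S T, S \in J -> T \in J -> S != T -> [disjoint S & T]]).
Proof.
have t_sym : symmetric (touch e) by move=> S T; apply: touch_sym.
elim: j Z A => [|j IH] Z A.
  rewrite addn0 => m; have [cZ ZA cA] := btm_root e_sym m.
  case: (boolP (touch e R A)) => RA; last by left; exists Z, A.
  right; exists A, [set A]; split=> //.
  - by split; rewrite ?conn1.
  - by move=> S /set1P ->.
  by move=> S T /set1P-> /set1P->; rewrite eqxx.
rewrite doubleS !addnS.
case/btmS=> Z1 [A1 [Z2 [A2 [cZ m1 m2 [EA dZ d12 ZZ1 ZZ2]]]]].
have sub1 : A1 \subset A by rewrite EA; set_auto.
have sub2 : A2 \subset A by rewrite EA; set_auto.
case/btmS: m1 => Z11 [A11 [Z12 [A12 [cZ1 m11 m12 [EA1 dZ1 d11 ZZ11 ZZ12]]]]].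
case/btmS: m2 => Z21 [A21 [Z22 [A22 [cZ2 m21 m22 [EA2 dZ2 d22 ZZ21 ZZ22]]]]].
have [_ ZA11 cA11] := btm_root e_sym m11.
have [_ ZA21 cA21] := btm_root e_sym m21.
have clean B : B \subset A ->
    (exists Z' A', [/\ btm e h Z' A', A' \subset B & ~~ touch e R A']) ->
    exists Z' A', [/\ btm e h Z' A', A' \subset A & ~~ touch e R A'].
  by move=> BA [Z' [A' [? A'B ?]]]; exists Z', A'; split=> //; apply: subset_trans BA.
have [cl|[X11 [J11 [b11 _ J11P _]]]] := IH _ _ m11.
  by left; apply: clean cl; apply: subset_trans sub1; rewrite EA1; set_auto.
have [cl|[X12 [J12 [b12 ZX12 J12P J12d]]]] := IH _ _ m12.
  by left; apply: clean cl; apply: subset_trans sub1; rewrite EA1; set_auto.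
have [cl|[X22 [J22 [b22 ZX22 J22P J22d]]]] := IH _ _ m22.
  by left; apply: clean cl; apply: subset_trans sub2; rewrite EA2; set_auto.
have [_ XJ12 _] := btm_root t_sym b12; rewrite sub1set in XJ12.
have [_ XJ22 _] := btm_root t_sym b22; rewrite sub1set in XJ22.
have RA11 : touch e R A11.
  have [_ XJ11 _] := btm_root t_sym b11; rewrite sub1set in XJ11.
  by have [_ XA11 RX11] := J11P _ XJ11; apply: touchS RX11.
(* [A11] contains a block that sees R, and [Z1] and [Z2] lead to the remaining grandchildren [A12]
   and [A22]. *)
right; pose X := (Z :|: (Z1 :|: A11)) :|: (Z2 :|: A21).
have cX : conn e X.
  apply: connU => //.
  - apply: connU => //; first by apply: connU; rewrite // (touchS _ ZA11 ZZ11).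
    by rewrite (touchS _ _ ZZ1) // subsetUl.
  - by apply: connU; rewrite // (touchS _ ZA21 ZZ21).
  by rewrite (touchS _ _ ZZ2) // subsetUl.
have XA : X \subset A by rewrite EA EA1 EA2 /X; clear; set_auto.
have RX : touch e R X by apply: touchS RA11 => //; rewrite /X; clear; set_auto.
have dX12 : [disjoint X & A12].
  by rewrite /X; rewrite EA1 EA2 in dZ d12; clear - dZ d12 dZ1 d11; set_auto.
have dX22 : [disjoint X & A22].
  by rewrite /X; rewrite EA1 EA2 in dZ d12; clear - dZ d12 dZ2 d22; set_auto.
have d1222 : [disjoint A12 & A22].
  by rewrite EA1 EA2 in d12; clear - d12; set_auto.
have A12A : A12 \subset A by rewrite EA EA1; clear; set_auto.
have A22A : A22 \subset A by rewrite EA EA2; clear; set_auto.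
have disj S B : conn e S -> S \subset B -> forall C, [disjoint C & B] -> [disjoint C & S] /\ S != C.
  move=> cS SB C CB; have dCS : [disjoint C & S] by clear - SB CB; set_auto.
  split=> //; have [x xS] := conn_neq0 cS; apply/eqP => SC.
  by have /disjP/(_ x) := dCS; rewrite -SC xS; apply.
have XnJ S : S \in J12 :|: J22 -> [disjoint X & S] /\ S != X.
  by case/setUP => [/J12P|/J22P][cS SA _]; [apply: (disj _ A12)|apply: (disj _ A22)].
exists X, ([set X] :|: (J12 :|: J22)); split.
- exists [set X12], J12, [set X22], J22; split=> //; first exact: conn1.
  split=> //.
  + by apply/disjP => S /set1P-> /XnJ[_]; rewrite eqxx.
  + apply/disjP => S /J12P[cS SA _] /J22P[_ SA' _].
    have [x xS] := conn_neq0 cS.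
    by have /disjP/(_ x (subsetP SA x xS) (subsetP SA' x xS)) := d1222.
  + apply: (@touchI _ _ _ _ X X12); rewrite ?inE //.
    by apply: touchS ZZ12; rewrite // /X; clear; set_auto.
  apply: (@touchI _ _ _ _ X X22); rewrite ?inE //.
  by apply: touchS ZZ22; rewrite // /X; clear; set_auto.
- by rewrite /X; clear; set_auto.
- move=> S /setU1P[-> //|/setUP[/J12P|/J22P] [cS SA RS]]; split=> //.
    exact: subset_trans A12A.
  exact: subset_trans A22A.
move=> S T /setU1P[->|SJ] /setU1P[->|TJ]; first by rewrite eqxx.
- by case: (XnJ _ TJ).
- by rewrite disjoint_sym; case: (XnJ _ SJ).
move=> ST; case/setUP: SJ => SJ; case/setUP: TJ => TJ.
- exact: J12d.
- have [_ SA _] := J12P _ SJ; have [_ TA _] := J22P _ TJ; clear - d1222 SA TA; set_auto.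
- have [_ SA _] := J22P _ SJ; have [_ TA _] := J12P _ TJ; clear - d1222 SA TA; set_auto.
exact: J22d.
Qed.

End CleanOrHit.

(** Height spent per level, from the outside: one level to get two child models, c to clean them
    from each other, two for [btm_avoid], c to clean from the connecting set. *)
Fixpoint rooted_height c i :=
  if i is i'.+1 then ((rooted_height c i' + c).+2 + c).+1 else 0.

Section Rooted.
Variables (V : finType) (e : rel V).
Hypothesis e_sym : symmetric e.
Implicit Types (A B C D K S X Y Z R U : {set V}).
Variables (A0 : {set V}) (c : nat).
Hypothesis clean : forall h R Z A, conn e R -> R \subset A0 -> A \subset A0 ->
  [disjoint R & A] -> btm e (h + c) Z A ->
  exists Z' A', [/\ btm e h Z' A', A' \subset A & ~~ touch e R A'].

(** Prescribing z in the root branch set makes the construction recursive: z is the vertex by which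
    the branch set above sees the new model. *)
Definition rooted i := forall z C Z A, conn e C -> z \notin C ->
  z |: C \subset A0 -> touch e [set z] C -> A \subset C ->
  btm e (rooted_height c i) Z A ->
  exists Z' U, [/\ z \in Z', ibtm e i Z' U & U \subset z |: C].

(** Clean A' from X and let C be the component of the cleaned model in A without X and its
    neighbours. The first vertex z met on leaving C is a neighbour of X outside X. The model grown
    from z into C is seen by X only in its root, since X has no neighbour in C. *)
Lemma rooted_branch i A A' Z X : rooted i -> conn e A -> A \subset A0 ->
  A' \subset A -> btm e (rooted_height c i + c) Z A' ->
  conn e X -> X \subset A0 -> [disjoint X & A'] ->
  touch e X A || (X :&: A != set0) ->
  exists Z' U, [/\ ibtm e i Z' U, U \subset A, [disjoint X & U],
     ~~ touch e X (U :\: Z') & touch e X Z'].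
Proof.
move=> IH cA AA0 A'A m cX XA0 dX hit.
have [Z' [A'' [m' A''A' nXA'']]] :=
  clean cX XA0 (subset_trans A'A AA0) dX m.
pose N := X :|: [set y | touch e X [set y]].
have NP y : reflect (y \in X \/ exists2 x, x \in X & e x y) (y \in N).
  rewrite !inE; apply: (iffP orP) => -[yX|]; [by left| |by left|].
    by case/touchP => x [_ [xX /set1P-> exy]]; right; exists x.
  by case=> x xX exy; right; apply: (touchI xX _ exy); rewrite inE.
have A''S : A'' \subset A :\: N.
  apply/subsetP => y yA''; have yA' := subsetP A''A' y yA''.
  rewrite inE (subsetP A'A) // andbT; apply/NP => -[yX|[x xX exy]].
    by have /disjP/(_ y yX yA') := dX.
  by case/negP: nXA''; apply: touchI exy.
have SA : A :\: N \subset A by apply: subsetDl.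
have [_ _ cA''] := btm_root e_sym m'.
have [C [A''C CS cC nC]] := component e_sym cA'' A''S.
have SnA : A :\: N != A.
  have [y yA yN] : exists2 y, y \in A & y \in N.
    case/orP: hit => [/touchP[x [y [xX yA exy]]]|/set0Pn[y /setIP[yX yA]]].
      by exists y => //; apply/NP; right; exists x.
    by exists y => //; apply/NP; left.
  by apply/eqP => /setP/(_ y); rewrite inE yN yA.
have /touchP[w [z [wC zAS ewz]]] := component_exit cA CS SA cC nC SnA.
have nXC x w' : x \in X -> w' \in C -> ~~ e x w'.
  move=> xX w'C; apply/negP => exw; have := subsetP CS w' w'C.
  by rewrite inE => /andP[/NP[]]; right; exists x.
have [zA zN] : z \in A /\ z \in N.
  by move: zAS; rewrite !in_setD => /andP[]; case: (z \in A); rewrite ?andbT ?andbF // negbK.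
have zX : z \notin X by apply: contraL ewz => zX; rewrite e_sym; apply: nXC.
have [|[x xX exz]] := NP z zN; first by rewrite (negbTE zX).
have zC : z \notin C by apply: contraL exz => zC; apply: nXC.
have CA : C \subset A := subset_trans CS SA.
have zCA : z |: C \subset A by rewrite subUset sub1set zA.
have [|Z3 [U [zZ mU UzC]]] := IH z C Z' A'' cC zC (subset_trans zCA AA0) _ A''C m'.
  by apply: (touchI _ wC); rewrite ?inE // e_sym.
exists Z3, U; split=> //.
- exact: subset_trans zCA.
- apply/disjP => y yX /(subsetP UzC)/setU1P[yz|/(subsetP CS)]; first by rewrite -yz yX in zX.
  by rewrite inE => /andP[/NP[]]; left.
- apply/ntouchP => y y' yX /setDP[/(subsetP UzC)/setU1P[->|y'C] y'Z]; first by rewrite zZ in y'Z.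
  exact: nXC.
exact: touchI xX zZ exz.
Qed.

(* If the component K of z outside A1 and A2 does not see A2, the path from z *)
(* to A2 is led through A1.                                                   *)
Lemma connector D z A1 A2 Z1 K M : conn e D -> A1 \subset D -> A2 \subset D ->
  z \in K -> conn e K -> K \subset D :\: (A1 :|: A2) ->
  ~~ touch e K (D :\: (A1 :|: A2) :\: K) ->
  btm e M.+2 Z1 A1 -> conn e A2 -> [disjoint A1 & A2] -> ~~ touch e A1 A2 ->
  touch e K A1 ->
  exists X Z1' A1', [/\ z \in X, conn e X, X \subset D, [disjoint X & A2] &
    [/\ touch e X A2, touch e X A1 || (X :&: A1 != set0), btm e M Z1' A1',
        A1' \subset A1 & [disjoint X & A1']]].
Proof.
move=> cD A1D A2D zK cK KS nK m1 cA2 dA nA KA1.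
have [_ _ cA1] := btm_root e_sym m1.
case: (boolP (touch e K A2)) => KA2.
  case/touchP: (KA1) => x [a [xK aA1 exa]].
  (* Here [btm_avoid] only serves to descend two levels. *)
  have [Y [Z' [A' [_ _ _ _ [m' A'A1 _]]]]] := btm_avoid e_sym m1 aA1 aA1.
  exists K, Z', A'; split=> //; try by clear - KS; set_auto.
  by split; rewrite ?KA1 //; clear - KS A'A1; set_auto.
pose S2 := D :\: A2.
have KS2 : K \subset S2 by rewrite /S2; clear -KS; set_auto.
have [K2 [KK2 K2S cK2 nK2]] := component e_sym cK KS2.
have A1K2 : A1 \subset K2.
  apply: (component_absorb nK2 cA1); first by rewrite /S2; clear - A1D dA; set_auto.
  by rewrite (touchS KK2 _ KA1).
have S2D : S2 \subset D by apply: subsetDl.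
have S2nD : S2 != D.
  have [y yA2] := conn_neq0 cA2; apply/eqP => /setP/(_ y).
  by rewrite inE yA2 (subsetP A2D).
have /touchP[x [y [xK2 yDS exy]]] := component_exit cD K2S S2D cK2 nK2 S2nD.
have yA2 : y \in A2.
  by move: yDS; rewrite !in_setD; case: (y \in A2) => //=; case: (y \in D).
(* The vertex before A2 cannot lie in A1, which is anticomplete to A2. *)
have xS : x \in D :\: (A1 :|: A2).
  have /setDP[xD xA2] := subsetP K2S x xK2.
  rewrite in_setD in_setU (negbTE xA2) xD orbF andbT.
  by apply: contraNN nA => xA1; apply: touchI exy.
have [K' [xK' K'S cK' nK']] : exists K', [/\ [set x] \subset K', K' \subset D :\: (A1 :|: A2),
    conn e K' & ~~ touch e K' (D :\: (A1 :|: A2) :\: K')].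
  by apply: component; rewrite ?conn1 ?sub1set.
rewrite sub1set in xK'.
have K'K2 : K' \subset K2.
  apply: (component_absorb nK2 cK'); first by rewrite /S2; clear - K'S; set_auto.
  by apply/orP; right; apply/set0Pn; exists x; rewrite inE xK2.
have [a1 a1A1] := conn_neq0 cA1.
have K'nK2 : K' != K2.
  apply/eqP => E; have : a1 \in K' by rewrite E (subsetP A1K2).
  by move/(subsetP K'S); rewrite !inE a1A1.
have K'0 : K' != set0 by apply/set0Pn; exists x.
have /touchP[w [b [wK' /setDP[bK2 bK'] ewb]]] := conn_cut cK2 K'K2 K'0 K'nK2.
have bA1 : b \in A1.
  have := subsetP K2S b bK2; rewrite in_setD => /andP[bA2 bD].
  apply: contraNT nK' => bA1; apply: (touchI wK' _ ewb).
  by rewrite !inE negb_or bA1 bA2 bD bK'.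
case/touchP: (KA1) => x1 [a [x1K aA1 exa]].
(* A1 is entered from K at a and left towards K' from b; Y joins a and b while sparing a
   submodel. *)
have [Y [Z' [A' [cY aY bY YA1 [m' A'A1 dYA']]]]] := btm_avoid e_sym m1 aA1 bA1.
exists (K :|: Y :|: K'), Z', A'; split.
- by rewrite !inE zK.
- apply: connU => //; first by apply: connU => //; rewrite (touchI x1K aY exa).
  rewrite touch_sym //; apply/orP; left; apply: (touchI wK' _ ewb).
  by rewrite inE bY orbT.
- by clear - KS K'S YA1 A1D; set_auto.
- by clear - KS K'S YA1 dA; set_auto.
split=> //.
- by apply: (touchI _ yA2 exy); rewrite inE xK' orbT.
- by apply/orP; right; apply/set0Pn; exists a; rewrite !inE aA1 aY orbT.
- by clear - KS K'S A'A1 dYA'; set_auto.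
Qed.

(** The two child models are cleaned from each other, and [connector] joins z to both by a set X
    sparing a submodel in each. X becomes the root branch set, and [rooted_branch] grows the two
    subtrees. *)
Lemma rootedP i : rooted i.
Proof.
elim: i => [|i IH] z C Z A cC zC zCA0 tz AC.
  by move=> _; exists [set z], [set z]; split; rewrite ?inE ?subsetUl //; split; rewrite ?conn1.
case/btmS=> Z1 [A1 [Z2 [A2 [_ m1 m2 [EA _ dA _ _]]]]].
have A1C : A1 \subset C by apply: subset_trans AC; rewrite EA; clear; set_auto.
have A2C : A2 \subset C by apply: subset_trans AC; rewrite EA; clear; set_auto.
have CA0 : C \subset A0 by apply: subset_trans zCA0; apply: subsetUr.
have [_ _ cA1] := btm_root e_sym m1.
have [Z2' [A2' [m2' A2A nA12]]] :=
  clean cA1 (subset_trans A1C CA0) (subset_trans A2C CA0) dA m2.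
have [_ _ cA2'] := btm_root e_sym m2'.
have A2'C : A2' \subset C := subset_trans A2A A2C.
have dA21 : [disjoint A2' & A1] by clear - A2A dA; set_auto.
have [Z1' [A1' [m1' A1A nA21]]] :=
  clean cA2' (subset_trans A2'C CA0) (subset_trans A1C CA0) dA21 m1.
have [_ _ cA1'] := btm_root e_sym m1'.
have A1'C : A1' \subset C := subset_trans A1A A1C.
have dA' : [disjoint A1' & A2'] by clear - A1A dA21; set_auto.
have nA12' : ~~ touch e A1' A2' by rewrite touch_sym.
have cD : conn e (z |: C) by apply: connU; rewrite ?conn1 ?tz.
have CD : C \subset z |: C by apply: subsetUr.
clear Z A AC Z1 A1 Z2 A2 m1 m2 EA dA A1C A2C cA1 A2A nA12 dA21 A1A nA21.
pose S := (z |: C) :\: (A1' :|: A2').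
have zS : z \in S.
  by rewrite !inE eqxx andbT negb_or !(contraNN (subsetP _ z) zC).
have [K [zK KS cK nK]] : exists K, [/\ [set z] \subset K, K \subset S, conn e K &
    ~~ touch e K (S :\: K)] by apply: component; rewrite ?conn1 ?sub1set.
rewrite sub1set in zK.
have SD : S \subset z |: C by apply: subsetDl.
have SnD : S != z |: C.
  have [a aA1] := conn_neq0 cA1'; apply/eqP => /setP/(_ a).
  by rewrite !inE aA1 (subsetP A1'C) // orbT.
have := component_exit cD KS SD cK nK SnD.
have A1D := subset_trans A1'C CD; have A2D := subset_trans A2'C CD.
have -> : (z |: C) :\: S = A1' :|: A2' by rewrite /S; clear - A1D A2D; set_auto.
move=> KA; wlog KA1 : Z1' A1' Z2' A2' m1' m2' cA1' cA2' A1'C A2'C dA' nA12' @S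
    zS KS nK SD SnD A1D A2D KA / touch e K A1'.
  move=> H; case/touchP: (KA) => x [y [xK /setUP[yA|yA] exy]].
    by apply: (H _ _ _ _ m1' m2') => //; apply: touchI exy.
  apply: (H _ _ _ _ m2' m1') => //; rewrite 1?disjoint_sym 1?touch_sym //.
  - by rewrite (setUC A2').
  - by rewrite (setUC A2').
  - by rewrite touch_sym // (setUC A2').
  - by rewrite (setUC A2').
  - by rewrite (setUC A2').
  - by rewrite touch_sym // (setUC A2').
  by rewrite touch_sym //; apply: touchI exy.
have [X [Z3 [A3 [zX cX XD dX2 [tX2 hit1 m3 A3A1 dX3]]]]] :=
  connector cD A1D A2D zK cK KS nK m1' cA2' dA' nA12' KA1.
have XA0 := subset_trans XD zCA0.
have [U1 [V1 [mU1 U1A dXU1 nX1 tX1]]] :=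
  rooted_branch IH cA1' (subset_trans A1'C CA0) A3A1 m3 cX XA0 dX3 hit1.
have [a aA2] := conn_neq0 cA2'.
have [_ [Z4 [A4 [_ _ _ _ [m4 A4A2 _]]]]] := btm_avoid e_sym m2' aA2 aA2.
have dX4 : [disjoint X & A4] by clear - A4A2 dX2; set_auto.
have hit2 : touch e X A2' || (X :&: A2' != set0) by rewrite tX2.
have [U2 [V2 [mU2 U2A dXU2 nX2 tX2']]] :=
  rooted_branch IH cA2' (subset_trans A2'C CA0) A4A2 m4 cX XA0 dX4 hit2.
exists X, (X :|: (V1 :|: V2)); split=> //; last first.
  by clear - XD U1A U2A A1D A2D; set_auto.
exists U1, V1, U2, V2; split=> //; split=> //.
- by clear - dXU1 dXU2; set_auto.
- by clear - U1A U2A dA'; set_auto.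
exact: ntouchS U1A U2A nA12'.
Qed.

End Rooted.

(** M does not depend on the vertex type, so the induction hypothesis applies to the contracted
    graph, whose vertices are sets. If neither outcome holds, hitting is impossible, hence cleaning
    always works and [rootedP] yields the induced model. *)
Lemma clique_or_induced_tree n k : exists M, forall (V : finType) (e : rel V) Z A,
  symmetric e -> btm e M Z A ->
  clique_model e n A \/ exists Z' U, ibtm e k Z' U /\ U \subset A.
Proof.
elim: n => [|n [j IH]].
  by exists 0 => V e Z A _ _; left; exists (fun=> set0); split.
(* Cleaning costs two levels for each of the j levels of the contracted model; the extra level
   provides a vertex z outside the child model in which to grow the tree. *)
exists (rooted_height j.*2 k).+1 => V e Z A e_sym m.
case: (EM (exists Z' U, ibtm e k Z' U /\ U \subset A)) => [|nI]; first by right.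
case: (EM (clique_model e n.+1 A)) => [|nC]; first by left.
right; have clean h (R Z' A' : {set V}) : conn e R -> R \subset A -> A' \subset A ->
    [disjoint R & A'] -> btm e (h + j.*2) Z' A' ->
    exists Z'' A'', [/\ btm e h Z'' A'', A'' \subset A' & ~~ touch e R A''].
  move=> cR RA A'A dR m'; case: (clean_or_hit e_sym R m') => // -[X [J [mJ _ JP Jd]]].
  have Jc S : S \in J -> conn e S by case/JP.
  have JA : cover J \subset A'.
    by apply/bigcupsP => S /JP[].
  have t_sym : symmetric (touch e) by move=> S T; apply: touch_sym.
  case: (IH _ _ _ _ t_sym mJ) => [/(clique_cover e_sym Jc Jd)[B [cB BJ BA dtB]]|].
    (* R sees every block, hence every lifted branch set, and completes the clique model. *)
    case: nC; exists (fun i => if i < n then B i else R); split=> [i _|i _|i l il].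
    - by case: ifP => // /cB.
    - by case: ifP => // /BA BJ'; apply: subset_trans (subset_trans JA A'A).
    rewrite ltnS => ln; rewrite (leq_trans il ln); case: ltnP => [lt|_]; first exact: dtB.
    have lti := leq_trans il ln; split.
      have := BA i lti; clear - JA dR => BA; set_auto.
    have [S SJ SB] := BJ i lti; have [_ _ RS] := JP S SJ.
    by rewrite touch_sym // (touchS _ SB RS).
  case=> Z'' [U [mU UJ]]; case: nI; exists (cover Z''), (cover U); split.
    exact: (ibtm_cover e_sym Jc Jd UJ mU).
  apply: subset_trans (subset_trans JA A'A); apply/bigcupsP => S SU.
  by apply: (bigcup_sup S) => //; apply: (subsetP UJ).
case/btmS: m => Z1 [A1 [Z2 [A2 [cZ m1 _ [EA dZ _ tZ1 _]]]]].
have [_ ZA1 cA1] := btm_root e_sym m1.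
case/touchP: tZ1 => z [y [zZ yZ1 ezy]].
have zA1 : z \notin A1 by apply/negP => zA; have /disjP/(_ z zZ) := dZ; rewrite inE zA; apply.
have zA : z |: A1 \subset A.
  by rewrite EA subUset sub1set inE zZ /=; clear; set_auto.
have [|Z' [U [_ mU UA]]] := rootedP e_sym clean cA1 zA1 zA _ (subxx _) m1.
  by apply: (touchI _ (subsetP ZA1 y yZ1) ezy); rewrite inE.
by exists Z', U; split=> //; apply: subset_trans zA.
Qed.

(** * Branchings: claws and triangles *)

Section InducedTrees.
Variables (V : finType) (e : rel V).
Implicit Types (A B C D K S U W X Y Z : {set V}).

Definition attach y z U := y \notin U /\ forall u, u \in U -> e y u = (u == z).

(* itree cl tr i y U: U induces in e a subdivision of the complete binary     *)
(* tree of height i, with a path from y to its root, in which every branching *)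
(* vertex y with children z1, z2 may be turned into the triangle y, z1, z2    *)
(* (case b = true). The flags cl and tr tell which branchings are allowed.    *)
Inductive itree (cl tr : bool) : nat -> V -> {set V} -> Prop :=
| ILeaf y : itree cl tr 0 y [set y]
| IStep i y z U : itree cl tr i z U -> attach y z U -> itree cl tr i y (y |: U)
| IFork (b : bool) i y z1 U1 z2 U2 : (if b then tr else cl) ->
    itree cl tr i z1 U1 -> itree cl tr i z2 U2 -> [disjoint U1 & U2] ->
    attach y z1 U1 -> attach y z2 U2 ->
    (forall u v, u \in U1 -> v \in U2 -> e u v = [&& b, u == z1 & v == z2]) ->
    itree cl tr i.+1 y (y |: (U1 :|: U2)).

Lemma itree_root cl tr i y U : itree cl tr i y U -> y \in U.
Proof. by case=> *; rewrite !inE eqxx. Qed.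

(** The topmost branching decides which bound is lowered. At a triangle, ask both subtrees for a
    claw tree of full height or a triangle tree one lower: one of the former suffices, and two of
    the latter are joined by the triangle. A claw is treated dually. *)
Lemma itree_ramsey a b i y U : itree true true i y U -> i = a + b ->
  exists2 U' : {set V}, U' \subset U & itree true false a y U' \/ itree false true b y U'.
Proof.
move=> t; elim: t a b => {i y U}[y|i y z U t IH [yU att]|
  f i y z1 U1 z2 U2 _ t1 IH1 t2 IH2 dU [yU1 att1] [yU2 att2] E] a b.
- by move=> ab; exists [set y] => //; left; have -> : a = 0 by [lia]; constructor.
- move=> /IH[U' U'U t']; exists (y |: U'); first exact: setUS.
  have att' : attach y z U'.
    split; first by apply: contraNN yU; apply: (subsetP U'U).
    by move=> u /(subsetP U'U); apply: att.
  by case: t' => t'; [left|right]; apply: IStep t' att'.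
move=> ab; have rootU : [set y] \subset y |: (U1 :|: U2) by rewrite sub1set setU11.
case: a ab => [_|a]; first by exists [set y] => //; left; constructor.
case: b => [_|b ab]; first by exists [set y] => //; right; constructor.
have att' z (U U' : {set V}) : U' \subset U -> y \notin U ->
    (forall u, u \in U -> e y u = (u == z)) -> attach y z U'.
  move=> U'U yU att; split; first by apply: contraNN yU; apply: (subsetP U'U).
  by move=> u /(subsetP U'U); apply: att.
have goal1 (c d : bool) (U1' U2' : {set V}) : U1' \subset U1 -> U2' \subset U2 -> (if f then d else c) ->
    forall j, itree c d j z1 U1' -> itree c d j z2 U2' ->
    y |: (U1' :|: U2') \subset y |: (U1 :|: U2) /\ itree c d j.+1 y (y |: (U1' :|: U2')).
  move=> s1 s2 fP j t1' t2'; split; first by rewrite setUS ?setUSS.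
  apply: (@IFork c d f j y z1 U1' z2 U2' fP) => //.
  - by clear - s1 s2 dU; set_auto.
  - exact: att' att1.
  - exact: att' att2.
  by move=> u v /(subsetP s1) uU /(subsetP s2); apply: E.
have goal2 j c d z (U U' : {set V}) : U \subset U1 :|: U2 -> U' \subset U -> y \notin U ->
    (forall u, u \in U -> e y u = (u == z)) -> itree c d j z U' ->
    y |: U' \subset y |: (U1 :|: U2) /\ itree c d j y (y |: U').
  move=> UU U'U yU att t'; split; first by apply: setUS; apply: subset_trans UU.
  by apply: IStep t' _; apply: att' att.
case: f E goal1 => E goal1.
- have [|U1' s1 [t1'|t1']] := IH1 a.+1 b; first by lia.
    by have [? ?] := goal2 _ _ _ _ _ _ (subsetUl _ _) s1 yU1 att1 t1'; exists (y |: U1'); [|left].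
  have [|U2' s2 [t2'|t2']] := IH2 a.+1 b; first by lia.
    by have [? ?] := goal2 _ _ _ _ _ _ (subsetUr _ _) s2 yU2 att2 t2'; exists (y |: U2'); [|left].
  have [? ?] := goal1 false true _ _ s1 s2 isT _ t1' t2'.
  by exists (y |: (U1' :|: U2')); [|right].
have [|U1' s1 [t1'|t1']] := IH1 a b.+1; first by lia.
  have [|U2' s2 [t2'|t2']] := IH2 a b.+1; first by lia.
    have [? ?] := goal1 true false _ _ s1 s2 isT _ t1' t2'.
    by exists (y |: (U1' :|: U2')); [|left].
  by have [? ?] := goal2 _ _ _ _ _ _ (subsetUr _ _) s2 yU2 att2 t2'; exists (y |: U2'); [|right].
by have [? ?] := goal2 _ _ _ _ _ _ (subsetUl _ _) s1 yU1 att1 t1'; exists (y |: U1'); [|right].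
Qed.

Hypothesis e_sym : symmetric e.

Local Notation mtree := (itree true true).

(** The root q has a single neighbour in the tree, so a second branch can be hung on q itself, as
    [spider_direct] may have to do. *)
Definition stem i q W := exists v W0,
  [/\ mtree i v W0, attach q v W0 & W = q |: W0].

Lemma stem_mtree i q W : stem i q W -> mtree i q W.
Proof. by case=> v [W0 [t a ->]]; apply: IStep t a. Qed.

(** A set version of taking a shortest path from Z through D to w. If no neighbour of Z in D sees w,
    pass to a component K of D without the neighbours of Z, and recurse from the neighbour d of Z by
    which K is left. *)
Lemma leg Z D w W i : conn e D -> mtree i w W -> [disjoint D & W] ->
  touch e Z D -> ~~ touch e Z W -> touch e D [set w] -> ~~ touch e D (W :\ w) ->
  exists q W', [/\ stem i q W', q \in D, W' \subset D :|: W,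
    touch e Z [set q] & ~~ touch e Z (W' :\ q)].
Proof.
have [m] := ubnP #|D|; elim: m => // m IH in Z D * => ltD cD t dDW ZD nZW Dw nDW.
have attw d : d \in D -> e d w -> attach d w W.
  move=> dD edw; split; first by apply/negP => dW; have /disjP/(_ d dD dW) := dDW.
  move=> u uW; case: eqVneq => [->//|uw].
  by apply/negbTE; apply: (ntouchP _ _ _ nDW) => //; rewrite !inE uw.
case: (boolP [exists d in D, touch e Z [set d] && e d w]).
  case/exists_inP => d dD /andP[Zd dw]; exists d, (d |: W).
  have [dW _] := attw d dD dw.
  split=> //; first by exists w, W; split=> //; apply: attw.
    by rewrite setSU // sub1set.
  by apply: ntouchS nZW => //; clear; set_auto.
rewrite negb_exists_in => /forall_inP no.
case/touchP: (Dw) => x [_ [xD /set1P-> exw]].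
have Zx : ~~ touch e Z [set x] by have := no x xD; rewrite exw andbT.
pose S := [set d in D | ~~ touch e Z [set d]].
have [K [xK KS cK nK]] : exists K, [/\ [set x] \subset K, K \subset S, conn e K &
    ~~ touch e K (S :\: K)] by apply: component; rewrite ?conn1 // sub1set inE xD.
rewrite sub1set in xK.
have SD : S \subset D by apply/subsetP => d; rewrite inE => /andP[].
have SnD : S != D.
  case/touchP: ZD => z [d [zZ dD ezd]]; apply/eqP => /setP/(_ d).
  by rewrite inE dD (touchI zZ _ ezd) // inE.
have /touchP[k [d [kK dDS ekd]]] := component_exit cD KS SD cK nK SnD.
have [dD Zd] : d \in D /\ touch e Z [set d].
  by move: dDS; rewrite in_setD inE; case: (d \in D) => //=; rewrite andbT negbK.
have KD : K \subset D := subset_trans KS SD.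
have dK : d \notin K by apply: contraTN Zd => /(subsetP KS); rewrite inE => /andP[].
have dw : ~~ e d w by have := no d dD; rewrite Zd.
have ZK : ~~ touch e Z K.
  apply/ntouchP => a b aZ /(subsetP KS); rewrite inE => /andP[_ /ntouchP/(_ a b aZ)].
  by rewrite inE eqxx; apply.
have [||||||q [W' [st qK W'K dq nd]]] := IH [set d] K _ cK t.
- rewrite -ltnS; apply: leq_trans ltD; rewrite ltnS; apply: proper_card.
  by apply/properP; split; last by exists d.
- by clear - KD dDW; set_auto.
- by apply: (@touchI _ _ _ _ d k); rewrite ?inE // e_sym.
- apply/ntouchP => a b /set1P-> bW; case: (eqVneq b w) => [->//|bw].
  by apply: (ntouchP _ _ _ nDW) => //; rewrite !inE bw.
- by apply: (touchI xK _ exw); rewrite inE.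
- by apply: ntouchS nDW.
have dW' : d \notin W'.
  apply/negP => /(subsetP W'K); rewrite inE (negbTE dK) /= => dW.
  by have /disjP/(_ d dD dW) := dDW.
exists d, (d |: W'); split=> //.
- exists q, W'; split; [exact: stem_mtree|split=> // u uW'|by []].
  case: (eqVneq u q) => [->|uq].
    by case/touchP: dq => _ [_ [/set1P-> /set1P->]].
  by apply/negbTE; apply: (ntouchP _ _ _ nd); rewrite !inE ?eqxx ?uq.
- by rewrite subUset sub1set inE dD /=; clear - W'K KD; set_auto.
apply/ntouchP => a b aZ; rewrite !inE => /andP[/negbTE-> /= /(subsetP W'K)].
by case/setUP => bK; [apply: (ntouchP _ _ _ ZK)|apply: (ntouchP _ _ _ nZW)].
Qed.

(** Variant of [leg] for a tree whose root already lies in D. *)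
Lemma leg_from Z D v W i : conn e D -> mtree i v W -> v \in D ->
  [disjoint D :\ v & W] -> touch e Z D -> ~~ touch e Z (W :\ v) ->
  ~~ touch e (D :\ v) (W :\ v) ->
  exists q W', [/\ mtree i q W', q \in D, W' \subset D :|: W,
    touch e Z [set q] & ~~ touch e Z (W' :\ q)].
Proof.
move=> cD t vD dDW ZD nZW nDW; have vW := itree_root t.
case: (boolP (touch e Z [set v])) => Zv.
  by exists v, W; split=> //; apply: subsetUr.
case/touchP: ZD => z [x [zZ xD ezx]].
have xv : x != v by apply: contraNneq Zv => <-; apply: (touchI zZ _ ezx); rewrite inE.
have [K [xK KS cK nK]] : exists K, [/\ [set x] \subset K, K \subset D :\ v, conn e K &
    ~~ touch e K (D :\ v :\: K)] by apply: component; rewrite ?conn1 // sub1set !inE xv.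
rewrite sub1set in xK.
have SnD : D :\ v != D by apply/eqP => /setP/(_ v); rewrite !inE eqxx vD.
have /touchP[k [u [kK uD eku]]] := component_exit cD KS (subsetDl _ _) cK nK SnD.
have uv : u = v by move: uD; rewrite !inE; case: eqVneq => //=; case: (u \in D).
rewrite uv in eku.
have nZW' : ~~ touch e Z W.
  apply/ntouchP => a b aZ bW; case: (eqVneq b v) => [->|bv].
    by apply: (ntouchP _ _ _ Zv) => //; rewrite inE.
  by apply: (ntouchP _ _ _ nZW) => //; rewrite !inE bv.
have [|||q [W' [st qK W'K Zq nq]]] := leg cK t _ _ nZW' (touchI kK (set11 v) eku).
- by clear - KS dDW; set_auto.
- by apply: touchI ezx.
- by apply: ntouchS nDW => //; clear - KS; set_auto.
have KD : K \subset D by clear - KS; set_auto.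
exists q, W'; split=> //; [exact: stem_mtree|exact: (subsetP KD)|].
by apply: subset_trans W'K _; apply: setSU.
Qed.

Lemma itree_step i y z U W : mtree i z U -> y \notin U -> e y z ->
  (forall u, u \in U -> e y u -> u = z) -> mtree i y (y |: U).
Proof.
move=> t yU yz att; apply: IStep (t) _; split=> // u uU.
by case: (eqVneq u z) => [->//|uz]; apply/negbTE; apply: contraNN uz => /(att u uU) ->.
Qed.

Section Spider.
Variables (i : nat) (w1 w2 : V) (W1 W2 : {set V}).
Hypotheses (st1 : stem i w1 W1) (st2 : stem i w2 W2).
Hypotheses (dW : [disjoint W1 & W2]) (nW : ~~ touch e W1 W2).

(** A leg from the pair z, w1 to w2 starts at a vertex q seen by z or w1. If z sees q, the branching
    is at z, and is a triangle exactly when w1 also sees q. Otherwise it is a claw at w1, with z on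
    top. *)
Lemma spider_direct z D : z \notin D -> conn e (z |: D) ->
  [disjoint z |: D & W1 :|: W2] ->
  ~~ touch e (z |: D) (W1 :\ w1) -> ~~ touch e (z |: D) (W2 :\ w2) ->
  e z w1 -> ~~ e z w2 -> touch e D [set w2] ->
  exists2 W : {set V}, W \subset z |: (D :|: (W1 :|: W2)) & mtree i.+1 z W.
Proof.
move=> zD czD dzW n1 n2 zw1 zw2 /touchP[x [_ [xD /set1P-> exw]]].
have [K [xK KD cK nK]] : exists K, [/\ [set x] \subset K, K \subset D, conn e K &
    ~~ touch e K (D :\: K)] by apply: component; rewrite ?conn1 // sub1set.
rewrite sub1set in xK.
have DnD : D != z |: D by apply/eqP => /setP/(_ z); rewrite !inE eqxx (negbTE zD).
have /touchP[k [z' [kK zz ekz]]] := component_exit czD KD (subsetUr _ _) cK nK DnD.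
have {zz} zz' : z' = z.
  by move: zz; rewrite !inE; case: eqVneq => //=; case: (z' \in D).
rewrite zz' in ekz.
have w1W := itree_root (stem_mtree st1); have w2W := itree_root (stem_mtree st2).
have nzW u : u \in W2 -> ~~ e z u.
  move=> uW; case: (eqVneq u w2) => [->//|uw].
  by apply: (ntouchP _ _ _ n2); rewrite !inE ?eqxx ?uw.
have nKW : ~~ touch e K (W1 :\ w1).
  by apply: ntouchS n1 => //; clear - KD; set_auto.
have [|||||q [W [stq qK WK Zq nq]]] := @leg [set z; w1] K w2 W2 i cK (stem_mtree st2).
- by clear - KD dzW; set_auto.
- by apply: (@touchI _ _ _ _ z k); rewrite ?inE ?eqxx // e_sym.
- apply/ntouchP => a b; rewrite !inE => /orP[]/eqP-> bW; first exact: nzW.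
  exact: (ntouchP _ _ _ nW).
- by apply: (touchI xK _ exw); rewrite inE.
- by apply: ntouchS n2 => //; clear - KD; set_auto.
have zW1 : z \notin W1.
  by apply/negP => zW; have /disjP/(_ z) := dzW; rewrite !inE eqxx zW; apply.
have zW2 : z \notin W.
  apply/negP => /(subsetP WK)/setUP[/(subsetP KD)|zW]; first by rewrite (negbTE zD).
  by have /disjP/(_ z) := dzW; rewrite !inE eqxx zW orbT; apply.
have attz u : u \in W1 -> e z u -> u = w1.
  move=> uW; case: (eqVneq u w1) => // uw; apply: contraTeq => _.
  by apply: (ntouchP _ _ _ n1); rewrite !inE ?eqxx ?uw.
have attq u a : (a == z) || (a == w1) -> u \in W -> e a u -> u = q.
  move=> azw uW; case: (eqVneq u q) => // uq; apply: contraTeq => _.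
  by apply: (ntouchP _ _ _ nq); rewrite !inE ?uq ?uW.
have dW1W : [disjoint W1 & W] by clear - WK KD dW dzW; set_auto.
have WWD : W1 :|: W \subset D :|: (W1 :|: W2) by clear - WK KD; set_auto.
have cross u v : u \in W1 -> v \in W -> e u v -> u = w1 /\ v = q.
  move=> uW1 vW euv; suff uw : u = w1 by rewrite uw in euv *; rewrite (attq v w1) ?eqxx ?orbT.
  apply: contraTeq euv => uw.
  case/setUP: (subsetP WK v vW) => [vK|vW2]; last exact: (ntouchP _ _ _ nW).
  by rewrite e_sym; apply: (ntouchP _ _ _ nKW); rewrite ?inE ?uw.
case: (boolP (e z q)) => zq.
  exists (z |: (W1 :|: W)); first exact: setUS.
  apply: (@IFork true true (e w1 q) i z w1 W1 q W) => //.
  - by case: (e w1 q).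
  - exact: stem_mtree.
  - exact: stem_mtree.
  - split=> // u uW; apply/idP/eqP => [|->//]; exact: attz.
  - split=> // u uW; apply/idP/eqP => [|->//]; apply: attq uW; by rewrite eqxx.
  move=> u v uW vW; apply/idP/and3P => [euv|[wq /eqP-> /eqP->]//].
  by have [uw vq] := cross u v uW vW euv; rewrite uw vq in euv *; rewrite !eqxx.
have w1q : e w1 q.
  case/touchP: Zq => a [_ [aZ /set1P-> eaq]]; move: aZ; rewrite !inE.
  by case/orP=> /eqP az; rewrite az ?(negbTE zq) in eaq.
case: st1 => v1 [W0 [t1 [w1W0 att1] EW1]].
have W0W1 : W0 \subset W1 by rewrite EW1 subsetUr.
have tw1 : mtree i.+1 w1 (w1 |: (W0 :|: W)).
  apply: (@IFork true true false i w1 v1 W0 q W) => //.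
  - exact: stem_mtree.
  - by clear - W0W1 dW1W; set_auto.
  - split; first by apply/negP => w1W'; have /disjP/(_ w1 w1W w1W') := dW1W.
    by move=> u uW; apply/idP/eqP => [|->//]; apply: attq uW; rewrite eqxx orbT.
  move=> u v uW0 vW; apply/negbTE/negP => euv.
  have [uw _] := cross u v (subsetP W0W1 u uW0) vW euv.
  by rewrite -uw uW0 in w1W0.
have EW : w1 |: (W0 :|: W) = W1 :|: W by rewrite EW1 setUA.
rewrite EW in tw1; exists (z |: (W1 :|: W)); first exact: setUS.
apply: itree_step tw1 _ _ _ => //; first by rewrite inE negb_or zW1.
move=> u /setUP[uW|uW]; first exact: attz.
have zz : (z == z) || (z == w1) by rewrite eqxx.
by move=> ezu; have uq := attq u z zz uW ezu; rewrite uq (negbTE zq) in ezu.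
Qed.

End Spider.

(** An inclusion-minimal connection of three vertices consists of three induced paths meeting in a
    vertex or a triangle. The proof walks from z towards the branching, shrinking D. *)
Lemma spider i w1 w2 W1 W2 z D : stem i w1 W1 -> stem i w2 W2 ->
  [disjoint W1 & W2] -> ~~ touch e W1 W2 ->
  z \notin D -> conn e (z |: D) -> [disjoint z |: D & W1 :|: W2] ->
  ~~ touch e (z |: D) (W1 :\ w1) -> ~~ touch e (z |: D) (W2 :\ w2) ->
  touch e (z |: D) [set w1] -> touch e (z |: D) [set w2] ->
  exists2 W : {set V}, W \subset z |: (D :|: (W1 :|: W2)) & mtree i.+1 z W.
Proof.
move=> st1 st2 dW nW; have [m] := ubnP #|D|; elim: m => // m IH in z D *.
move=> ltD zD czD dzW n1 n2 tw1 tw2.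
have w1W := itree_root (stem_mtree st1); have w2W := itree_root (stem_mtree st2).
have zW : z \notin W1 :|: W2.
  by apply/negP => zW; have /disjP/(_ z) := dzW; rewrite zW !inE eqxx; apply.
have /andP[zW1 zW2] : (z \notin W1) && (z \notin W2) by move: zW; rewrite inE negb_or.
have inD w : touch e (z |: D) [set w] -> ~~ e z w -> touch e D [set w].
  case/touchP=> x [_ [/setU1P[->|xD] /set1P-> exw]]; first by rewrite exw.
  by move=> _; apply: touchI xD _ exw; rewrite inE.
have attz w U : ~~ touch e (z |: D) (U :\ w) -> forall u, u \in U -> e z u -> u = w.
  move=> n u uU; case: (eqVneq u w) => // uw; apply: contraTeq => _.
  by apply: (ntouchP _ _ _ n); rewrite !inE ?eqxx ?uw.
case: (boolP (e z w1)) => zw1; case: (boolP (e z w2)) => zw2.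
- exists (z |: (W1 :|: W2)); first by clear; set_auto.
  apply: (@IFork true true false i z w1 W1 w2 W2) => //.
  + exact: stem_mtree.
  + exact: stem_mtree.
  + split=> // u uW; apply/idP/eqP => [|->//]; exact: attz uW.
  + split=> // u uW; apply/idP/eqP => [|->//]; exact: attz uW.
  by move=> u v uW vW; apply/negbTE; apply: (ntouchP _ _ _ nW).
- by apply: (spider_direct st1 st2) => //; apply: inD.
- have [||||W WD t] := spider_direct st2 st1 _ _ zD czD _ n2 n1 zw2 zw1.
  + by rewrite disjoint_sym.
  + by rewrite touch_sym.
  + by rewrite (setUC W2).
  + exact: inD.
  + by exists W; rewrite // (setUC W1).
have tD1 := inD _ tw1 zw1; have tD2 := inD _ tw2 zw2.
have nzW u : u \in W1 :|: W2 -> ~~ e z u.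
  case/setUP=> uW; apply/negP => ezu.
    by have uw := attz _ _ n1 u uW ezu; rewrite uw (negbTE zw1) in ezu.
  by have uw := attz _ _ n2 u uW ezu; rewrite uw (negbTE zw2) in ezu.
pose S := [set d in D | ~~ e z d].
have SD : S \subset D by apply/subsetP => d; rewrite inE => /andP[].
have nzS u : u \in S -> ~~ e z u by rewrite inE => /andP[].
(* If one neighbour d of z already reaches both stems without using further   *)
(* neighbours of z, branch below d.                                           *)
case: (EM (exists d (E : {set V}), [/\ d \in D, e z d, E \subset S, conn e (d |: E) &
    touch e (d |: E) [set w1] /\ touch e (d |: E) [set w2]])).
  case=> d [E [dD ezd ES cdE [t1 t2]]].
  have dE : d \notin E by apply/negP => /(subsetP ES)/nzS; rewrite ezd.
  have ED : E \subset D := subset_trans ES SD.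
  have dED : d |: E \subset D by rewrite subUset sub1set dD.
  have dEz : d |: E \subset z |: D by apply: subset_trans dED _; apply: subsetUr.
  have [||||W WE t] := IH d E _ dE cdE _ _ _ t1 t2.
  - rewrite -ltnS; apply: leq_trans ltD; rewrite ltnS; apply: proper_card.
    by apply/properP; split; last by exists d.
  - by clear - dEz dzW; set_auto.
  - exact: ntouchS n1.
  - exact: ntouchS n2.
  exists (z |: W).
    by apply: setUS; apply: subset_trans WE _; clear - dED; set_auto.
  apply: itree_step t _ ezd _ => //.
    apply/negP => /(subsetP WE)/setU1P[zd|/setUP[/(subsetP ED)|]].
    + by rewrite zd dD in zD.
    + by rewrite (negbTE zD).
    by rewrite (negbTE zW).
  move=> u /(subsetP WE)/setU1P[//|/setUP[/(subsetP ES)/nzS/negbTE->//|uW]].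
  by rewrite (negbTE (nzW u uW)).
move=> no.
have reach w : touch e D [set w] -> exists d K, [/\ d \in D, e z d, K \subset S &
    (K = set0 /\ e d w) \/ [/\ conn e K, touch e K [set d] & touch e K [set w]]].
  case/touchP=> x [_ [xD /set1P-> exw]]; case: (boolP (e z x)) => ezx.
    by exists x, set0; split; rewrite ?sub0set //; left.
  have xS : x \in S by rewrite inE xD.
  have [K [xK KS cK nK]] : exists K, [/\ [set x] \subset K, K \subset S, conn e K &
    ~~ touch e K (S :\: K)] by apply: component; rewrite ?conn1 // sub1set.
  rewrite sub1set in xK; have SzD : S \subset z |: D by clear - SD; set_auto.
  have SnD : S != z |: D.
    by apply/eqP => /setP/(_ z); rewrite !inE eqxx (negbTE zD).
  have /touchP[k [d [kK dS ekd]]] := component_exit czD KS SzD cK nK SnD.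
  move: dS; rewrite in_setD in_setU1 => /andP[dS /orP[/eqP dz|dD]].
    by have := nzS k (subsetP KS k kK); rewrite e_sym -dz ekd.
  exists d, K; split=> //; first by move: dS; rewrite inE dD /= negbK.
  by right; split=> //; [apply: (touchI kK _ ekd)|apply: (touchI xK _ exw)]; rewrite inE.
have [d1 [K1 [d1D zd1 K1S P1]]] := reach _ tD1.
have [d2 [K2 [d2D zd2 K2S P2]]] := reach _ tD2.
have conn_of d (K : {set V}) w :
    (K = set0 /\ e d w) \/
      [/\ conn e K, touch e K [set d] & touch e K [set w]] ->
    conn e (d |: K) /\ touch e (d |: K) [set w].
  case=> [[-> edw]|[cK tKd tKw]].
    by rewrite setU0 conn1 //; split=> //; apply: (touchI (set11 d) (set11 w) edw).
  split; last by apply: touchS tKw => //; apply: subsetUr.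
  by apply: connU; rewrite ?conn1 // touch_sym // tKd.
have [c1 t1] := conn_of _ _ _ P1; have [c2 t2] := conn_of _ _ _ P2.
(* Since no single neighbour of z reaches both stems, the two connections are separated, except
   perhaps for the edge between d1 and d2. That edge decides between a claw and a triangle at z. *)
have sep d (K : {set V}) w d' (K' : {set V}) w' : d \in D -> e z d -> K \subset S -> K' \subset S ->
    (w = w1 /\ w' = w2) \/ (w = w2 /\ w' = w1) ->
    conn e (d |: K) -> touch e (d |: K) [set w] ->
    (K' = set0 /\ e d' w') \/
      [/\ conn e K', touch e K' [set d'] & touch e K' [set w']] ->
    [/\ ~~ touch e (d |: K) K', [disjoint d |: K & K'] &
        ~~ touch e (d |: K) [set w']].
  move=> dD zd KS K'S ww c t P.
  have bad (E : {set V}) : E \subset S -> conn e (d |: E) -> touch e (d |: E) [set w] ->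
      touch e (d |: E) [set w'] -> False.
    move=> ES cE tE tE'; apply: no; exists d, E; split=> //.
    by case: ww tE tE' => -[-> ->].
  split; last by apply/negP; apply: bad t.
  - case: P => [[-> _]|[cK' _ tK']].
      by apply/ntouchP => a b _; rewrite inE.
    apply/negP => tKK'; apply: (bad (K :|: K')); rewrite ?subUset ?KS // setUA.
    + by apply: connU; rewrite ?tKK'.
    + by apply: touchS t => //; apply: subsetUl.
    by apply: touchS tK' => //; apply: subsetUr.
  case: P => [[-> _]|[cK' _ tK']]; first by apply/disjP => a _; rewrite inE.
  rewrite -setI_eq0; apply/negPn/negP => tKK'.
  apply: (bad (K :|: K')); rewrite ?subUset ?KS // setUA.
  + by apply: connU; rewrite ?tKK' ?orbT.
  + by apply: touchS t => //; apply: subsetUl.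
  by apply: touchS tK' => //; apply: subsetUr.
have [n12 dd12 nw12] := sep _ _ _ _ _ _ d1D zd1 K1S K2S (or_introl (conj erefl erefl)) c1 t1 P2.
have [n21 dd21 nw21] := sep _ _ _ _ _ _ d2D zd2 K2S K1S (or_intror (conj erefl erefl)) c2 t2 P1.
have d12 : d1 != d2.
  apply/eqP => E; apply: no; exists d1, (K1 :|: K2); split; rewrite // ?subUset ?K1S //.
    have -> : d1 |: (K1 :|: K2) = (d1 |: K1) :|: (d2 |: K2).
      by rewrite E; clear; set_auto.
    apply: connU => //; apply/orP; right; apply/set0Pn; exists d1.
    by rewrite !inE E !eqxx.
  split; first by apply: touchS t1 => //; clear; set_auto.
  by apply: touchS t2 => //; rewrite E; clear; set_auto.
have D1D : d1 |: K1 \subset D by rewrite subUset sub1set d1D (subset_trans K1S).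
have D2D : d2 |: K2 \subset D by rewrite subUset sub1set d2D (subset_trans K2S).
have mk d (K : {set V}) w (W : {set V}) : stem i w W -> W \subset W1 :|: W2 -> conn e (d |: K) ->
    touch e (d |: K) [set w] -> e z d -> d \in D -> K \subset S ->
    ~~ touch e (z |: D) (W :\ w) ->
    exists W' : {set V}, [/\ mtree i d W', W' \subset (d |: K) :|: W & attach z d W'].
  move=> st WW c t zd dD KS n; have DKD : d |: K \subset D.
    by rewrite subUset sub1set dD (subset_trans KS).
  have DKz : d |: K \subset z |: D by clear - DKD; set_auto.
  have [||||q [W' [stq qK W'K zq nq]]] := @leg [set z] (d |: K) w W i c (stem_mtree st) _ _ _ t.
  - by clear - DKz dzW WW; set_auto.
  - by apply: (@touchI _ _ _ _ z d); rewrite ?inE ?eqxx.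
  - by apply/ntouchP => a b /set1P-> /(subsetP WW); apply: nzW.
  - exact: ntouchS n.
  have ezq : e z q by case/touchP: zq => _ [_ [/set1P-> /set1P->]].
  have qd : q = d.
    by case/setU1P: qK => // /(subsetP KS)/nzS; rewrite ezq.
  rewrite qd in stq nq; exists W'; split=> //; first exact: stem_mtree.
  split; first by apply/negP => /(subsetP W'K); clear - DKD zD WW zW; at_point z.
  move=> u uW; case: (eqVneq u d) => [->//|ud]; apply/negbTE.
  by apply: (ntouchP _ _ _ nq); rewrite !inE ?ud.
have [W1' [m1 W1'K att1]] := mk _ _ _ _ st1 (subsetUl _ _) c1 t1 zd1 d1D K1S n1.
have [W2' [m2 W2'K att2]] := mk _ _ _ _ st2 (subsetUr _ _) c2 t2 zd2 d2D K2S n2.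
exists (z |: (W1' :|: W2')).
  by apply: setUS; clear - W1'K W2'K D1D D2D; set_auto.
have dDD : [disjoint d1 |: K1 & d2 |: K2].
  apply/disjP => x; rewrite (in_setU1 x d2) => xD1 /orP[/eqP xd2|xK2]; last first.
    by have /disjP/(_ x xD1 xK2) := dd12.
  move: xD1; rewrite xd2 in_setU1 eq_sym (negbTE d12) /= => d2K1.
  by have /disjP/(_ d2 _ d2K1) := dd21; rewrite setU11; apply.
apply: (@IFork true true (e d1 d2) i z d1 W1' d2 W2') => //.
- by case: (e d1 d2).
- have : [disjoint D & W1 :|: W2] by clear - dzW; set_auto.
  by clear - W1'K W2'K dDD dW D1D D2D => ?; set_auto.
move=> u v uW vW; apply/idP/and3P => [euv|[ed /eqP-> /eqP->]//].
suff [ud vd] : u = d1 /\ v = d2 by rewrite ud vd !eqxx in euv *.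
have nDW1 a b : a \in D -> b \in W1 -> e a b -> b = w1.
  move=> aD bW; case: (eqVneq b w1) => // bw; apply: contraTeq => _.
  by apply: (ntouchP _ _ _ n1); rewrite !inE ?aD ?orbT ?bw.
have nDW2 a b : a \in D -> b \in W2 -> e a b -> b = w2.
  move=> aD bW; case: (eqVneq b w2) => // bw; apply: contraTeq => _.
  by apply: (ntouchP _ _ _ n2); rewrite !inE ?aD ?orbT ?bw.
case/setUP: (subsetP W1'K u uW) => [uD|uW1]; case/setUP: (subsetP W2'K v vW) => [vD|vW2].
- case/setU1P: (vD) => [vd2|vK2]; last by have := ntouchP _ _ _ n12 u v uD vK2; rewrite euv.
  case/setU1P: (uD) => [//|uK1].
  by have := ntouchP _ _ _ n21 v u vD uK1; rewrite e_sym euv.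
- have vw := nDW2 u v (subsetP D1D u uD) vW2 euv.
  by have := ntouchP _ _ _ nw12 u v uD; rewrite vw inE eqxx -vw euv => /(_ isT).
- have := nDW1 v u (subsetP D2D v vD) uW1; rewrite e_sym => /(_ euv) uw.
  by have := ntouchP _ _ _ nw21 v u vD; rewrite uw inE eqxx -uw e_sym euv => /(_ isT).
by have := ntouchP _ _ _ nW u v uW1 vW2; rewrite euv.
Qed.

(** A set version of following a path from Y through D up to its first vertex that sees K. *)
Lemma last_contact D Y K : conn e D -> touch e Y D -> touch e D K ->
  exists D' z, [/\ conn e D', D' \subset D, z \in D', touch e Y D' &
    touch e [set z] K /\ ~~ touch e (D' :\ z) K].
Proof.
move=> cD YD DK; case: (boolP [exists z in D, touch e Y [set z] && touch e [set z] K]).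
  case/exists_inP=> z zD /andP[Yz zK]; exists [set z], z; split; rewrite ?conn1 ?inE ?sub1set //.
  by split=> //; rewrite setDv; apply/ntouchP => a b; rewrite inE.
rewrite negb_exists_in => /forall_inP no.
case/touchP: YD => y [x [yY xD eyx]].
have Yx : touch e Y [set x] by apply: touchI yY (set11 x) eyx.
pose S := [set d in D | ~~ touch e [set d] K].
have SD : S \subset D by apply/subsetP => d; rewrite inE => /andP[].
have xS : x \in S by rewrite inE xD; have := no x xD; rewrite Yx.
have [C [xC CS cC nC]] : exists C, [/\ [set x] \subset C, C \subset S, conn e C &
    ~~ touch e C (S :\: C)] by apply: component; rewrite ?conn1 // sub1set.
rewrite sub1set in xC.
have SnD : S != D.
  case/touchP: DK => d [k [dD kK edk]]; apply/eqP => /setP/(_ d).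
  by rewrite inE dD (touchI (set11 d) kK edk).
have /touchP[c [z [cC' zDS ecz]]] := component_exit cD CS SD cC nC SnD.
have [zD zK] : z \in D /\ touch e [set z] K.
  by move: zDS; rewrite in_setD inE; case: (z \in D) => //=; rewrite andbT negbK.
exists (z |: C), z; split.
- by apply: (connU1 e_sym cC cC'); rewrite e_sym.
- by rewrite subUset sub1set zD (subset_trans CS SD).
- by rewrite setU11.
- by apply: (touchI yY _ eyx); rewrite inE xC orbT.
split=> //; apply/ntouchP => a b; rewrite !inE => /andP[/negbTE-> /= /(subsetP CS)].
by rewrite inE => /andP[_ /ntouchP n] bK; apply: n; rewrite ?inE.
Qed.

(** Each level of the tree uses three levels of branch sets: Z carries the path coming from Y, its
    child H the branching, and the children of H the stems of the two arms. [last_contact] makes a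
    single vertex z of Z see H, so the path from above and the spider below share only z. *)
Lemma induced_minor_itree i Y Z U : ibtm e (3 * i) Z U -> [disjoint Y & U] ->
  touch e Y Z -> ~~ touch e Y (U :\: Z) ->
  exists q W, [/\ mtree i q W, q \in Z, W \subset U, touch e Y [set q] &
    ~~ touch e Y (W :\ q)].
Proof.
elim: i Y Z U => [|i IH] Y Z U.
  case=> cZ -> _ /touchP[y [q [yY qZ eyq]]] _; exists q, [set q]; split=> //.
  - by constructor.
  - by rewrite sub1set.
  - exact: (touchI yY (set11 q) eyq).
  by rewrite setDv; apply/ntouchP => a b _; rewrite inE.
have -> : 3 * i.+1 = (3 * i).+3 by lia.
case/ibtmS=> H [A [_ [A' [cZ mA _ [EU dZ _ ZH _] [_ nZA _]]]]] dY YZ nY.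
have dZA : [disjoint Z & A] by clear - dZ; set_auto.
have AU : A \subset U by rewrite EU; clear; set_auto.
have [cH HA] := ibtm_root mA.
have arm Zs As : ibtm e (3 * i).+1 Zs As -> touch e H Zs -> As \subset A ->
    ~~ touch e H (As :\: Zs) -> exists w W, [/\ stem i w W, W \subset As,
      touch e H [set w] & ~~ touch e H (W :\ w)].
  case/ibtmS=> Z1 [A1 [_ [A2 [cZs m1 _ [EA d1 _ t1 _] [_ n1 _]]]]] HZs AsA nH.
  have d1' : [disjoint Zs & A1] by clear - d1; set_auto.
  have A1s : A1 \subset As by rewrite EA; clear; set_auto.
  have [q [W [mq _ WA1 tq nq]]] := IH Zs Z1 A1 m1 d1' t1 n1.
  have [||w [W' [st wZ W'Z tw nw]]] := @leg H Zs q W i cZs mq _ HZs _ tq nq.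
  - by clear - d1' WA1; set_auto.
  - by apply: ntouchS nH => //; clear - WA1 A1s d1'; set_auto.
  exists w, W'; split=> //; apply: subset_trans W'Z _.
  by rewrite EA; clear - WA1; set_auto.
case/ibtmS: mA => Z1 [A1 [Z2 [A2 [_ m1 m2 [EA dH d12 HZ1 HZ2] [n12 nH1 nH2]]]]].
have A1A : A1 \subset A by rewrite EA; clear; set_auto.
have A2A : A2 \subset A by rewrite EA; clear; set_auto.
have [w1 [W1 [st1 W1A t1 n1]]] := arm _ _ m1 HZ1 A1A nH1.
have [w2 [W2 [st2 W2A t2 n2]]] := arm _ _ m2 HZ2 A2A nH2.
have [D' [z [cD' D'Z zD' YD' [zH nD'H]]]] := last_contact cZ YZ ZH.
have zZ := subsetP D'Z z zD'.
have zA : z \notin A by apply/negP => zA; have /disjP/(_ z zZ zA) := dZA.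
have nzA u : u \in A :\: H -> ~~ e z u by move=> uA; apply: (ntouchP _ _ _ nZA).
have ext w (W j : {set V}) : ~~ touch e H (W :\ w) -> W \subset j -> [disjoint H & j] -> j \subset A ->
    ~~ touch e (z |: H) (W :\ w).
  move=> n Wj dHj jA; apply/ntouchP => a b /setU1P[->|aH] bW; last exact: (ntouchP _ _ _ n).
  apply: nzA; case/setD1P: bW => _ bW; rewrite inE (subsetP jA) ?(subsetP Wj) // andbT.
  by apply/negP => bH; have /disjP/(_ b bH (subsetP Wj b bW)) := dHj.
have dH1 : [disjoint H & A1] by clear - dH; set_auto.
have dH2 : [disjoint H & A2] by clear - dH; set_auto.
have [|||||||||W' W'A mW'] := @spider i w1 w2 W1 W2 z H st1 st2.
- by clear - W1A W2A d12; set_auto.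
- exact: ntouchS n12.
- by apply: contraNN zA; apply: (subsetP HA).
- by apply: connU; rewrite ?conn1 ?zH.
- apply/disjP => x /setU1P[->|xH].
    by clear - zA W1A W2A A1A A2A; at_point z.
  by clear - xH dH1 dH2 W1A W2A; at_point x.
- exact: ext n1 W1A dH1 A1A.
- exact: ext n2 W2A dH2 A2A.
- by apply: touchS t1 => //; apply: subsetUr.
- by apply: touchS t2 => //; apply: subsetUr.
have W'zA : W' \subset z |: A.
  by apply: subset_trans W'A _; apply: setUS; clear - HA W1A W2A A1A A2A; set_auto.
have W'z : W' :\ z \subset A by clear - W'zA; set_auto.
have [|||q [W [mq qD WD tq nq]]] := @leg_from Y D' z W' i.+1 cD' mW' zD' _ YD'.
- by clear - W'zA D'Z dZA; set_auto.
- by apply: ntouchS nY => //; clear - W'z AU dZA; set_auto.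
- apply/ntouchP => a b aD bW; have bA := subsetP W'z b bW.
  case: (boolP (b \in H)) => bH; first exact: (ntouchP _ _ _ nD'H).
  apply: (ntouchP _ _ _ nZA); rewrite ?inE ?bH //.
  by case/setD1P: aD => _ /(subsetP D'Z).
exists q, W; split=> //; first exact: (subsetP D'Z).
apply: subset_trans WD _; rewrite EU; clear - W'zA D'Z zZ.
by apply/subsetP => x; case: (eqVneq x z) => [->|xz]; rewrite ?inE ?zZ //; move: xz; at_point x.
Qed.

End InducedTrees.

(** * Subdivisions and line graphs *)

Local Arguments infix : simpl never.

Lemma infix2_single (T : eqType) (x z y : T) : infix [:: x; z] [:: y] = false.
Proof. by rewrite /infix /= andbF. Qed.

Section Layout.
Variables (T : finType) (x0 : T).
Implicit Types (q : seq bool -> seq T) (s t : seq bool) (U : {set T}).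

(* A subdivision of the complete binary tree of height k, rooted at y, is     *)
(* described by the lists q s: the vertex of depth [size s] coded by s is the *)
(* last element of q s and is preceded there by the inner vertices of the     *)
(* subdivided edge leading to it.                                             *)
Record layout k U y q : Prop := Layout {
  lay_root : ohead (q [::]) = Some y;
  lay_ne : forall s, size s <= k -> q s != [::];
  lay_uniq : forall s, size s <= k -> uniq (q s);
  lay_disj : forall s t x, size s <= k -> size t <= k ->
    x \in q s -> x \in q t -> s = t;
  lay_mem : forall x, x \in U <-> exists2 s, size s <= k & x \in q s }.

(** The whole subdivided edge, both ends included; at the root there is no upper end to prepend. *)
Definition lay_path q s :=
  if s is _ :: s' then last x0 (q s') :: q s else q s.

Definition parent k q x z := exists2 s, size s <= k & infix [:: x; z] (lay_path q s).

(** The two vertices just below a branching vertex, adjacent when the branching is a triangle. *)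
Definition siblings k q x z := exists s c,
  [/\ size s < k, ohead (q (c :: s)) = Some x & ohead (q (~~ c :: s)) = Some z].

Definition lay_adj b k q x z := [\/ parent k q x z, parent k q z x | b /\ siblings k q x z].

Lemma ohead_mem (A : eqType) (l : seq A) x : ohead l = Some x -> x \in l.
Proof. by case: l => //= a l [->]; rewrite mem_head. Qed.

Lemma last_mem (l : seq T) : l != [::] -> last x0 l \in l.
Proof. by case/lastP: l => [//|l a] _; rewrite last_rcons mem_rcons mem_head. Qed.

Lemma layout_path_mem k U y q s x : layout k U y q -> size s <= k ->
  x \in lay_path q s -> x \in U.
Proof.
move=> L sk xs; apply/(lay_mem L); case: s sk xs => [|c s] sk /=; first by exists [::].
rewrite inE => /orP[/eqP->|xq]; last by exists (c :: s).
exists s; first by apply: ltnW.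
exact: last_mem (lay_ne L (ltnW sk)).
Qed.

Lemma lay_adj_mem b k U y q x z : layout k U y q -> lay_adj b k q x z ->
  x \in U /\ z \in U.
Proof.
move=> L; suff H u v : parent k q u v -> u \in U /\ v \in U.
  case=> [/H//|/H[]//|[_ [s [c [sk /ohead_mem xq /ohead_mem zq]]]]].
  by split; apply/(lay_mem L); [exists (c :: s)|exists (~~ c :: s)].
case=> s sk /mem_infix H; split; apply: (layout_path_mem L sk); apply: H;
  by rewrite !inE eqxx ?orbT.
Qed.

Definition cons_root y q s := if s is [::] then y :: q [::] else q s.

Lemma layout_cons k U z y q : layout k U z q -> y \notin U ->
  layout k (y |: U) y (cons_root y q).
Proof.
move=> L yU; have nq s : size s <= k -> y \notin q s.
  by move=> sk; apply: contraNN yU => yq; apply/(lay_mem L); exists s.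
have qC s x : x \in cons_root y q s -> (x = y /\ s = [::]) \/ x \in q s.
  by case: s => [|c s] /=; [rewrite inE => /orP[/eqP->|]|]; auto.
split=> //.
- by case=> [|c s] //; apply: (lay_ne L).
- by case=> [|c s] //= sk; rewrite ?(nq [::]) //; apply: (lay_uniq L).
- move=> s t x sk tk /qC[[xy ->]|xs] /qC[[xy' ->]|xt] //.
  + by have := nq t tk; rewrite -xy xt.
  + by have := nq s sk; rewrite -xy' xs.
  exact: (lay_disj L sk tk xs xt).
move=> x; split=> [/setU1P[->|/(lay_mem L)[s sk xs]]|[s sk /qC[[-> _]|xs]]].
- by exists [::]; rewrite //= mem_head.
- by exists s => //; case: s xs {sk} => //= xs; rewrite inE xs orbT.
- by rewrite setU11.
by apply/setU1P; right; apply/(lay_mem L); exists s.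
Qed.

Lemma lay_adj_cons b k U z y q u v : layout k U z q -> y \notin U ->
  lay_adj b k (cons_root y q) u v <->
  [\/ lay_adj b k q u v, u = y /\ v = z | v = y /\ u = z].
Proof.
move=> L yU; have parE x w : parent k (cons_root y q) x w <->
    parent k q x w \/ (x = y /\ w = z).
  have pE s : s != [::] -> lay_path (cons_root y q) s = lay_path q s.
    case: s => [|c [|d s]] //= _; have := lay_ne L (leq0n k : size [::] <= k).
    by case: (q [::]).
  have := lay_root L; case Eq: (q [::]) => [|a l] //= [az]; rewrite az in Eq.
  have E0 : infix [:: x; w] (y :: q [::]) = (x == y) && (w == z) || infix [:: x; w] (q [::]).
    by rewrite Eq infix_consl !prefix_cons prefix0s andbT.
  split=> [[s sk]|[[s sk]|[-> ->]]].
  - case: (eqVneq s [::]) => [->|s0]; last by rewrite pE //; left; exists s.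
    by rewrite /= E0 => /orP[/andP[/eqP-> /eqP->]|]; [right|left; exists [::]].
  - case: (eqVneq s [::]) => [->|s0 xw]; last by exists s; rewrite ?pE.
    by move=> xw; exists [::]; rewrite //= E0 orbC xw.
  by exists [::]; rewrite //= Eq infix_consl !prefix_cons prefix0s !eqxx.
have sE : siblings k (cons_root y q) u v = siblings k q u v by [].
split.
  case=> [/parE[p|p]|/parE[p|p]|sb].
  - by apply: Or31; apply: Or31.
  - by apply: Or32.
  - by apply: Or31; apply: Or32.
  - by apply: Or33.
  by apply: Or31; apply: Or33.
case=> [[p|p|sb]|uv|uv]; [apply: Or31|apply: Or32|apply: Or33|apply: Or31|apply: Or32] => //;
  by apply/parE; auto.
Qed.

(** Children are coded by a bit added in front, so the last bit of s is the choice made at the root,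
    and the other bits form the code within that subtree. *)
Definition join_root y (q : bool -> seq bool -> seq T) s :=
  if s is a :: s' then q (last a s') (belast a s') else [:: y].

Lemma join_root_rcons y (q : bool -> seq bool -> seq T) s c : join_root y q (rcons s c) = q c s.
Proof. by case: s => [|a s] //=; rewrite last_rcons belast_rcons. Qed.

Lemma layout_join k (U : bool -> {set T}) (z : bool -> T) y
    (q : bool -> seq bool -> seq T) :
  (forall c, layout k (U c) (z c) (q c)) -> [disjoint U true & U false] ->
  (forall c, y \notin U c) ->
  layout k.+1 (y |: (U true :|: U false)) y (join_root y q).
Proof.
move=> L dU yU; have nq c s : size s <= k -> y \notin q c s.
  by move=> sk; apply: contraNN (yU c) => yq; apply/(lay_mem (L c)); exists s.
have inU c s x : size s <= k -> x \in q c s -> x \in U c.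
  by move=> sk xs; apply/(lay_mem (L c)); exists s.
have cU c d x : x \in U c -> x \in U d -> c = d.
  case: c d => -[] // xt xf; first by have /disjP/(_ x xt xf) := dU.
  by have /disjP/(_ x xf xt) := dU.
split=> //.
- elim/last_ind=> [//|s c _]; rewrite join_root_rcons size_rcons ltnS.
  exact: (lay_ne (L c)).
- elim/last_ind=> [//|s c _]; rewrite join_root_rcons size_rcons ltnS.
  exact: (lay_uniq (L c)).
- elim/last_ind=> [|s c _]; elim/last_ind=> [//|t d _] x; rewrite !join_root_rcons ?size_rcons ?ltnS.
  + by move=> _ tk; rewrite inE => /eqP->; rewrite (negbTE (nq d t tk)).
  + by move=> sk _ xq; rewrite inE => /eqP xy; have := nq c s sk; rewrite -xy xq.
  move=> sk tk xs xt; have cd := cU c d x (inU _ _ _ sk xs) (inU _ _ _ tk xt).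
  by rewrite -cd in xt *; rewrite (lay_disj (L c) sk tk xs xt).
move=> x; split=> [/setU1P[->|xU]|[s]].
- by exists [::]; rewrite //= mem_head.
- have [c /(lay_mem (L c))[s sk xs]] : exists c, x \in U c.
    by case/setUP: xU; [exists true|exists false].
  by exists (rcons s c); rewrite ?size_rcons ?join_root_rcons.
elim/last_ind: s => [_|s c _]; first by rewrite inE => /eqP->; rewrite setU11.
rewrite join_root_rcons size_rcons ltnS => sk /(inU _ _ _ sk) xU.
by rewrite !inE; case: c xU => ->; rewrite ?orbT.
Qed.

Lemma lay_adj_join b k (U : bool -> {set T}) (z : bool -> T) y
    (q : bool -> seq bool -> seq T) u v :
  (forall c, layout k (U c) (z c) (q c)) ->
  lay_adj b k.+1 (join_root y q) u v <->
  [\/ exists c, lay_adj b k (q c) u v, exists c, u = y /\ v = z c,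
      exists c, v = y /\ u = z c | b /\ exists c, u = z c /\ v = z (~~ c)].
Proof.
move=> L; have parE x w : parent k.+1 (join_root y q) x w <->
    (exists c, parent k (q c) x w) \/ (exists c, x = y /\ w = z c).
  have p1 c : infix [:: x; w] (y :: q c [::]) =
      (x == y) && (w == z c) || infix [:: x; w] (q c [::]).
    have := lay_root (L c); case: (q c [::]) => [|a l] //= [<-].
    by rewrite infix_consl !prefix_cons prefix0s andbT.
  have pE s c : lay_path (join_root y q) (rcons s c) =
      if s is [::] then y :: q c [::] else lay_path (q c) s.
    by case: s => [|d s] //=; rewrite join_root_rcons last_rcons belast_rcons.
  split=> [[s]|[[c [s sk xw]]|[c [xy wz]]]].
  - elim/last_ind: s => [|s c _]; first by rewrite /= infix2_single.
    rewrite size_rcons ltnS pE; case: s => [_|d s sk xw].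
      rewrite p1 => /orP[/andP[/eqP-> /eqP->]|xw]; [by right; exists c|].
      by left; exists c, [::].
    by left; exists c, (d :: s).
  - exists (rcons s c); rewrite ?size_rcons // pE.
    by case: s sk xw => //= _; rewrite p1 => ->; rewrite orbT.
  exists (rcons [::] c) => //; rewrite pE /= p1 xy wz !eqxx //.
have sibE : siblings k.+1 (join_root y q) u v <->
    (exists c, siblings k (q c) u v) \/ (exists c, u = z c /\ v = z (~~ c)).
  split=> [[s [c []]]|[[d [s [c [sk qu qv]]]]|[c [-> ->]]]].
  - elim/last_ind: s => [_|s d _] /=.
      rewrite !(lay_root (L _)) => -[<-] [<-]; by right; exists c.
    rewrite size_rcons ltnS !last_rcons !belast_rcons => sk qu qv.
    by left; exists d, s, c.
  - exists (rcons s d), c; rewrite size_rcons ltnS -!rcons_cons !join_root_rcons.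
    by split.
  by exists [::], c; split=> //=; rewrite (lay_root (L _)).
split.
  case=> [/parE[[c p]|p]|/parE[[c p]|p]|[bT /sibE[[c sb]|sb]]].
  - by apply: Or41; exists c; apply: Or31.
  - by apply: Or42.
  - by apply: Or41; exists c; apply: Or32.
  - by apply: Or43.
  - by apply: Or41; exists c; apply: Or33.
  by apply: Or44.
case=> [[c [p|p|[bT sb]]]|p|p|[bT sb]].
- by apply: Or31; apply/parE; left; exists c.
- by apply: Or32; apply/parE; left; exists c.
- by apply: Or33; split=> //; apply/sibE; left; exists c.
- by apply: Or31; apply/parE; right.
- by apply: Or32; apply/parE; right.
by apply: Or33; split=> //; apply/sibE; right.
Qed.

Lemma layout_leaf y : layout 0 [set y] y (fun s => if s is [::] then [:: y] else [::]).
Proof.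
split=> //; try by case.
- by move=> [|//] [|//].
move=> x; split=> [/set1P->|[[|//] _]]; first by exists [::]; rewrite ?mem_head.
by rewrite !inE.
Qed.

End Layout.

Section LayoutOfTree.
Variables (G : sgraph) (x0 : G) (b : bool).
Implicit Types (U : {set G}) (y z : G).

Definition induced_layout k U y q := layout k U y q /\
  forall u v, u \in U -> v \in U -> (u -- v <-> lay_adj x0 b k q u v).

Lemma induced_layout_leaf y :
  induced_layout 0 [set y] y (fun s => if s is [::] then [:: y] else [::]).
Proof.
split; first exact: layout_leaf.
move=> u v /set1P-> /set1P->; rewrite adj_irr; split=> // -[||].
- by case=> -[|//] _ /=; rewrite infix2_single.
- by case=> -[|//] _ /=; rewrite infix2_single.
by case=> _ [s [c [//]]].
Qed.

Lemma induced_layout_step k U y z q : induced_layout k U z q ->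
  attach (@adj G) y z U -> induced_layout k (y |: U) y (cons_root y q).
Proof.
case=> L adjL [yU att]; split; first exact: layout_cons L yU.
have zU : z \in U by apply/(lay_mem L); exists [::]; rewrite //; apply: ohead_mem (lay_root L).
have yz : y -- z by rewrite att ?eqxx.
move=> u v; rewrite (lay_adj_cons x0 b u v L yU).
have nU w w' : ~ lay_adj x0 b k q w w' \/ (w != y /\ w' != y).
  case: (EM (lay_adj x0 b k q w w')) => [/(lay_adj_mem L)[wU w'U]|]; [right|by left].
  by split; [apply: contraNneq yU => <-|apply: contraNneq yU => <-].
case/setU1P=> [->|uU] /setU1P[->|vU].
- rewrite adj_irr; split=> // -[/(lay_adj_mem L)[]|[_ yz']|[_ yz']]; first by rewrite (negbTE yU).
    by rewrite -yz' (negbTE yU) in zU.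
  by rewrite -yz' (negbTE yU) in zU.
- rewrite att //; split=> [/eqP->|]; first by apply: Or32.
  case=> [/(lay_adj_mem L)[]|[_ ->]|[vy _]]; rewrite ?eqxx ?(negbTE yU) //.
  by rewrite -vy vU in yU.
- rewrite adj_sym att //; split=> [/eqP->|]; first by apply: Or33.
  case=> [/(lay_adj_mem L)[]|[uy _]|[_ ->]]; rewrite ?eqxx ?(negbTE yU) //.
  by rewrite -uy uU in yU.
rewrite adjL //; split=> [|[//|[uy _]|[vy _]]]; first by apply: Or31.
  by rewrite -uy uU in yU.
by rewrite -vy vU in yU.
Qed.

Lemma induced_layout_join k (U : bool -> {set G}) (z : bool -> G) y
    (q : bool -> seq bool -> seq G) :
  (forall c, induced_layout k (U c) (z c) (q c)) -> [disjoint U true & U false] ->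
  (forall c, attach (@adj G) y (z c) (U c)) ->
  (forall u v, u \in U true -> v \in U false ->
     u -- v = [&& b, u == z true & v == z false]) ->
  induced_layout k.+1 (y |: (U true :|: U false)) y (join_root y q).
Proof.
move=> LA dU att cross; have L c : layout k (U c) (z c) (q c) by case: (LA c).
have yU c : y \notin U c by case: (att c).
have attE c u : u \in U c -> y -- u = (u == z c) by case: (att c) => _; apply.
split; first exact: layout_join L dU yU.
have zU c : z c \in U c.
  by apply/(lay_mem (L c)); exists [::]; rewrite //; apply: ohead_mem (lay_root (L c)).
have cU c d x : x \in U c -> x \in U d -> c = d.
  case: c d => -[] // xt xf; first by have /disjP/(_ x xt xf) := dU.
  by have /disjP/(_ x xf xt) := dU.
have crossE c u v : u \in U c -> v \in U (~~ c) -> u -- v = [&& b, u == z c & v == z (~~ c)].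
  case: c => /= uU vU; first exact: cross.
  by rewrite adj_sym cross // andbCA andbC -andbA.
have memU x : x \in U true :|: U false -> exists c, x \in U c.
  by case/setUP; [exists true|exists false].
have nyU c x : x \in U c -> x <> y by move=> xU xy; have := yU c; rewrite -xy xU.
have adjU w w' : (exists c, lay_adj x0 b k (q c) w w') -> exists c, w \in U c /\ w' \in U c.
  by case=> c /(lay_adj_mem (L c)); exists c.
move=> u v; rewrite (lay_adj_join x0 b y u v L).
case/setU1P=> [->|/memU[c uU]] /setU1P[->|/memU[d vU]].
- rewrite adj_irr; split=> // -[/adjU[c [/nyU//]]|[c [_ yz]]|[c [_ yz]]|[_ [c [yz _]]]].
  + by have := nyU _ _ (zU c) (esym yz).
  + by have := nyU _ _ (zU c) (esym yz).
  by have := nyU _ _ (zU c) (esym yz).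
- rewrite (attE d) //; split=> [/eqP->|]; first by apply: Or42; exists d.
  case=> [/adjU[c [/nyU//]]|[c [_ vz]]|[c [/(nyU _ _ vU)//]]|[_ [c [yz _]]]].
    by rewrite vz (cU d c v) ?eqxx //; rewrite vz zU.
  by have := nyU _ _ (zU c) (esym yz).
- rewrite adj_sym (attE c) //; split=> [/eqP->|]; first by apply: Or43; exists c.
  case=> [/adjU[d [_ /nyU//]]|[d [/(nyU _ _ uU)//]]|[d [_ uz]]|[_ [d [_ yz]]]].
    by rewrite uz (cU c d u) ?eqxx //; rewrite uz zU.
  by have := nyU _ _ (zU (~~ d)) (esym yz).
case: (eqVneq c d) => [cd|cd].
  rewrite -cd in vU; have [_ ->] := LA c => //; split=> [a|]; first by apply: Or41; exists c.
  case=> [[d' a]|[d' [/(nyU _ _ uU)//]]|[d' [/(nyU _ _ vU)//]]|[_ [d' [ud vd]]]].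
    by have [uU' _] := lay_adj_mem (L d') a; rewrite (cU c d' u).
  have c1 : c = d' by apply: (cU c d' u) => //; rewrite ud zU.
  have c2 : c = ~~ d' by apply: (cU c (~~ d') v) => //; rewrite vd zU.
  by move: c2; rewrite c1; case: (d').
have dc : d = ~~ c by case: (c) (d) cd => -[].
rewrite dc in vU *; rewrite (crossE c) //; split=> [/and3P[bT /eqP-> /eqP->]|].
  by apply: Or44; split=> //; exists c.
case=> [/adjU[d' [uU' vU']]|[d' [/(nyU _ _ uU)//]]|[d' [/(nyU _ _ vU)//]]|[bT [d' [ud vd]]]].
  have c1 := cU c d' u uU uU'; have c2 := cU (~~ c) d' v vU vU'.
  by move: c2; rewrite -c1; case: (c).
have c1 : c = d' by apply: (cU c d' u) => //; rewrite ud zU.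
by rewrite ud vd bT c1 !eqxx.
Qed.

Lemma itree_layout k y U : itree (@adj G) (~~ b) b k y U ->
  exists q, induced_layout k U y q.
Proof.
elim=> {k y U}[y|k y z U _ [q L] att|f k y z1 U1 z2 U2 fb _ [q1 L1] _ [q2 L2] dU a1 a2 cross].
- by exists (fun s => if s is [::] then [:: y] else [::]); apply: induced_layout_leaf.
- by exists (cons_root y q); apply: induced_layout_step att.
have fE : f = b by move: fb; case: (f); case: (b).
pose pick A (a1 a2 : A) (c : bool) := if c then a1 else a2.
exists (join_root y (pick _ q1 q2)).
apply: (@induced_layout_join k (pick _ U1 U2) (pick _ z1 z2) y (pick _ q1 q2)) => //.
- by case.
- by case.
by move=> u v uU vU; rewrite cross // fE.
Qed.

(* Dropping the path that leads to the topmost branching vertex. *)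
Lemma itree_layout_top k y U : itree (@adj G) (~~ b) b k y U ->
  exists r (U' : {set G}) q, induced_layout k U' r q /\ q [::] = [:: r].
Proof.
elim=> {k y U}[y|//|f k y z1 U1 z2 U2 fb t1 _ t2 _ dU a1 a2 cross].
  exists y, [set y], (fun s => if s is [::] then [:: y] else [::]).
  by split=> //; apply: induced_layout_leaf.
have [q1 L1] := itree_layout t1; have [q2 L2] := itree_layout t2.
have fE : f = b by move: fb; case: (f); case: (b).
pose pick A (a1 a2 : A) (c : bool) := if c then a1 else a2.
exists y, (y |: (U1 :|: U2)), (join_root y (pick _ q1 q2)); split=> //.
apply: (@induced_layout_join k (pick _ U1 U2) (pick _ z1 z2) y (pick _ q1 q2)) => //.
- by case.
- by case.
by move=> u v uU vU; rewrite cross // fE.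
Qed.

End LayoutOfTree.

Section ConsecutivePairs.
Variable T : eqType.
Implicit Types (l : seq T) (x z p : T).

Lemma infix2_index l x z : uniq l -> infix [:: x; z] l ->
  [/\ x \in l, z \in l & index z l = (index x l).+1].
Proof.
move=> Ul /infixP[a [b El]]; rewrite El in Ul *.
move: Ul; rewrite cat_uniq /= !inE !negb_or => /and3P[_ ha /andP[/andP[xz _] _]].
case/andP: ha => xa /andP[za _].
rewrite !mem_cat !inE !eqxx !orbT; split=> //.
by rewrite !index_cat (negbTE xa) (negbTE za) /= !eqxx (negbTE xz) addn0 addn1.
Qed.

Lemma infix2_pred a l x : x \in l -> exists p, infix [:: p; x] (a :: l).
Proof.
case/splitPr=> l1 l2; exists (last a l1); apply/infixP; exists (belast a l1), l2.
by rewrite -cat_cons lastI cat_rcons.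
Qed.

Lemma infix2_last l x z : uniq (rcons l x) -> ~~ infix [:: x; z] (rcons l x).
Proof.
move=> Ul; apply/negP => /(infix2_index Ul)[_ zl E].
have := Ul; rewrite rcons_uniq => /andP[xl _].
move: zl; rewrite -index_mem E size_rcons -cats1 index_cat (negbTE xl) /= eqxx.
by rewrite addn0 ltnn.
Qed.

Lemma infix2_consE x z a l : infix [:: x; z] (a :: l) =
  (x == a) && (ohead l == Some z) || infix [:: x; z] l.
Proof.
rewrite infix_consl prefix_cons; case: l => [|b l] //=.
by rewrite prefix0s andbT (eq_sym z).
Qed.

End ConsecutivePairs.

(** * The tree described by a layout is a subdivision *)

Section Subdivision.
Variables (T : finType) (r : T) (k : nat) (q : seq bool -> seq T).
Hypotheses (L : layout k setT r q) (q0 : q [::] = [:: r]).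
Implicit Types (s t : seq bool) (x z p : T).
Local Notation par := (parent r k q).

Lemma layP x : exists2 s, size s <= k & x \in q s.
Proof. exact/(lay_mem L). Qed.

Lemma lay_path_uniq s : size s <= k -> uniq (lay_path r q s).
Proof.
case: s => [|c s] sk /=; first exact: (lay_uniq L).
rewrite (lay_uniq L) // andbT; apply/negP => lq.
have lq' : last r (q s) \in q s by apply: last_mem (lay_ne L (ltnW sk)).
have /(congr1 size)/= := lay_disj L (ltnW sk) sk lq' lq; lia.
Qed.

Lemma lay_path_snd s x z : size s <= k -> infix [:: x; z] (lay_path r q s) ->
  exists c s', s = c :: s' /\ z \in q s.
Proof.
case: s => [|c s] sk /=; first by rewrite q0 infix2_single.
rewrite infix2_consE => xz; exists c, s; split=> //.
case/orP: xz => [/andP[_ /eqP/ohead_mem]//|/mem_infix]; apply.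
by rewrite !inE eqxx orbT.
Qed.

Lemma parent_path s x z : size s <= k -> z \in q s -> par x z ->
  infix [:: x; z] (lay_path r q s).
Proof.
move=> sk zs [t tk xz]; have [_ [_ [_ zt]]] := lay_path_snd tk xz.
by rewrite (lay_disj L sk tk zs zt).
Qed.

Lemma parent_uniq x y z : par x z -> par y z -> x = y.
Proof.
move=> xz yz; have [s sk zs] := layP z; have Us := lay_path_uniq sk.
have [xs _ Ex] := infix2_index Us (parent_path sk zs xz).
have [ys _ Ey] := infix2_index Us (parent_path sk zs yz).
by apply: (index_inj r xs ys); lia.
Qed.

Lemma parent_exists z : z != r -> exists x, par x z.
Proof.
have [[|c s] sk zs zr] := layP z; first by rewrite q0 inE (negbTE zr) in zs.
by have [p pz] := infix2_pred (last r (q s)) zs; exists p, (c :: s).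
Qed.

Lemma parent_root x : ~ par x r.
Proof.
case=> s sk xr; have [c [s' [Es rs]]] := lay_path_snd sk xr.
have r0 : r \in q [::] by rewrite q0 inE.
by have := lay_disj L sk (leq0n k : size [::] <= k) rs r0; rewrite Es.
Qed.

(** Either both pairs lie on one path, where the index increases, or each code would be a child of
    the other, against their sizes. *)
Lemma parent_acyclic x z : par x z -> par z x -> False.
Proof.
case=> s sk xz [t tk zx].
have [c [s' [Es zs]]] := lay_path_snd sk xz.
have [d [t' [Et xt]]] := lay_path_snd tk zx.
have [xs _ E1] := infix2_index (lay_path_uniq sk) xz.
have [zt _ E2] := infix2_index (lay_path_uniq tk) zx.
case: (eqVneq s t) => [st|st]; first by rewrite st in E1; lia.
have s't : s' = t.
  have s'k : size s' <= k by move: sk; rewrite Es; apply: ltnW.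
  move: xs; rewrite Es /= inE -Es => /orP[/eqP xl|xs]; last first.
    by rewrite (lay_disj L sk tk xs xt) eqxx in st.
  by apply: (lay_disj L s'k tk _ xt); rewrite xl; apply: last_mem (lay_ne L s'k).
have t's : t' = s.
  have t'k : size t' <= k by move: tk; rewrite Et; apply: ltnW.
  move: zt; rewrite Et /= inE -Et => /orP[/eqP zl|zt]; last first.
    by rewrite (lay_disj L sk tk zs zt) eqxx in st.
  by apply: (lay_disj L t'k sk _ zs); rewrite zl; apply: last_mem (lay_ne L t'k).
have := congr1 size Es; have := congr1 size Et; rewrite s't t's /=; lia.
Qed.

(** A vertex that is not last in its list has only one child, its successor; hence a common parent
    of two vertices is a branching vertex, and they start the lists of its two children. *)
Lemma siblingsP x z : siblings k q x z <-> x != z /\ exists p, par p x /\ par p z.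
Proof.
split=> [[s [c [sk xc zc]]]|[xz [p [px pz]]]].
  split.
    apply/eqP => xz; rewrite -xz in zc.
    have /(congr1 (head c)) :=
      lay_disj L (sk : size (c :: s) <= k) (sk : size (~~ c :: s) <= k)
        (ohead_mem xc) (ohead_mem zc).
    by rewrite /=; case: (c).
  exists (last r (q s)); split; [exists (c :: s)|exists (~~ c :: s)] => //=.
    by rewrite infix2_consE eqxx xc eqxx.
  by rewrite infix2_consE eqxx zc eqxx.
have [s sk xs] := layP x; have [t tk zt] := layP z.
have {px} ps := parent_path sk xs px; have {pz} pt := parent_path tk zt pz.
have [[c [s' [Es _]]] [d [t' [Et _]]]] := (lay_path_snd sk ps, lay_path_snd tk pt).
have [pis _ Es1] := infix2_index (lay_path_uniq sk) ps.
have [pit _ Et1] := infix2_index (lay_path_uniq tk) pt.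
have st : s != t.
  apply: contraNneq xz => st; rewrite st in Es1 xs.
  have mem u : u \in q t -> u \in lay_path r q t by rewrite Et /= inE => ->; rewrite orbT.
  by apply/eqP; apply: (index_inj r (mem _ xs) (mem _ zt)); lia.
have last_out u v : size u <= k ->
    infix [:: last r (q u); v] (lay_path r q u) -> False.
  move=> uk; have [l E] : exists l, lay_path r q u = rcons l (last r (q u)).
    have := lay_ne L uk; case: u uk => [|a u] uk /=; case/lastP: (q _) => // l b _.
      by exists l; rewrite last_rcons.
    by exists (last r (q u) :: l); rewrite last_rcons.
  by have := lay_path_uniq uk; rewrite E => /(infix2_last v)/negbTE->.
have cases u a u' v : u = a :: u' -> size u <= k -> infix [:: p; v] (lay_path r q u) ->
    p \in lay_path r q u -> p \in q u \/ p = last r (q u') /\ ohead (q u) = Some v.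
  move=> -> uk /=; rewrite infix2_consE => /orP[/andP[/eqP pl /eqP oh] _|/mem_infix H _].
    by right.
  by left; apply: H; rewrite inE eqxx.
have s'k : size s' <= k by move: sk; rewrite Es; apply: ltnW.
have t'k : size t' <= k by move: tk; rewrite Et; apply: ltnW.
have lastin u : size u <= k -> last r (q u) \in q u.
  by move=> uk; apply: last_mem (lay_ne L uk).
case: (cases _ _ _ _ Es sk ps pis) => [pqs|[pls ohs]]; case: (cases _ _ _ _ Et tk pt pit) => [pqt|[plt oht]].
- by rewrite (lay_disj L sk tk pqs pqt) eqxx in st.
- have st' : s = t' by apply: (lay_disj L sk t'k pqs); rewrite plt lastin.
  by case: (last_out s x sk); rewrite st' -plt -?st'.
- have ts' : t = s' by apply: (lay_disj L tk s'k pqt); rewrite pls lastin.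
  by case: (last_out t z tk); rewrite ts' -pls -?ts'.
have st' : s' = t'.
  have ps' : p \in q s' by rewrite pls lastin.
  have pt' : p \in q t' by rewrite plt lastin.
  exact: (lay_disj L s'k t'k ps' pt').
have dc : d = ~~ c.
  by move: st; rewrite Es Et st'; case: (c) (d) => -[]; rewrite ?eqxx.
exists s', c; rewrite -Es -dc {2}st' -Et; split=> //.
by move: sk; rewrite Es.
Qed.

Definition tree_rel : rel T := fun x z => `[< par x z \/ par z x >].

Lemma tree_sym : symmetric tree_rel.
Proof. by move=> x z; apply/asboolP/asboolP; tauto. Qed.

Lemma tree_irr : irreflexive tree_rel.
Proof. by move=> x; apply/asboolP => -[] p; apply: (parent_acyclic p p). Qed.

Definition tree_graph : sgraph := SGraph tree_sym tree_irr.

Definition inn s := if q s is x :: l then belast x l else [::].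

Lemma innE s : size s <= k -> q s = rcons (inn s) (last r (q s)).
Proof. by move/(lay_ne L); rewrite /inn; case: (q s) => // x l _; rewrite -lastI. Qed.

Lemma inn_sub s x : size s <= k -> x \in inn s -> x \in q s /\ x != last r (q s).
Proof.
move=> sk xs; have := lay_uniq L sk; rewrite (innE sk) last_rcons rcons_uniq mem_rcons inE xs orbT.
by case/andP=> ns _; split=> //; apply: contraNneq ns => <-.
Qed.

Definition tree_br (s : bintree k) : tree_graph := last r (q s).

Definition tree_inner (u v : bintree k) : seq tree_graph :=
  if is_child u v then inn v else rev (inn u).

Lemma childP (u v : bintree k) : reflect (exists c, v = c :: u :> seq bool) (is_child u v).
Proof. by apply: (iffP existsP) => -[c E]; exists c; apply/eqP. Qed.

Lemma is_childF (u v : bintree k) : is_child u v -> is_child v u = false.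
Proof.
case/childP=> c Ev; apply/negbTE/negP => /childP[d Eu].
by have := congr1 size Ev; rewrite Eu /=; lia.
Qed.

Lemma tree_path (u v : bintree k) : is_child u v ->
  tree_br u :: rcons (tree_inner u v) (tree_br v) = lay_path r q v.
Proof.
move=> uv; rewrite /tree_inner uv /tree_br -innE ?size_bseq //.
by case/childP: uv => c ->.
Qed.

Lemma tree_path_rev (u v : bintree k) : is_child u v ->
  tree_br v :: rcons (tree_inner v u) (tree_br u) = rev (lay_path r q v).
Proof.
move=> uv; rewrite -(tree_path uv) /tree_inner uv is_childF //.
by rewrite rev_cons rev_rcons.
Qed.

Lemma tree_subdivision : is_subdivision (bintree k) tree_graph.
Proof.
exists tree_br, tree_inner.
have low u v : u -- v -> exists (a b : bintree k), [/\ is_child a b, [set u; v] = [set a; b] &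
    forall x, x \in tree_inner u v -> x \in inn b].
  case/orP=> uv; first by exists u, v; split=> // x; rewrite /tree_inner uv.
  exists v, u; split=> //; first by rewrite setUC.
  by move=> x; rewrite /tree_inner is_childF // mem_rev.
split.
- move=> u v uv; apply: val_inj; apply: (lay_disj L (size_bseq u) (size_bseq v)).
    exact: last_mem (lay_ne L (size_bseq u)).
  by rewrite [last _ _]uv; apply: last_mem (lay_ne L (size_bseq v)).
- by move=> u v /orP[] uv; rewrite /tree_inner uv is_childF // revK.
- have Ui (u : bintree k) : uniq (inn u).
    by have := lay_uniq L (size_bseq u); rewrite (innE (size_bseq u)) rcons_uniq => /andP[].
  by move=> u v _; rewrite /tree_inner; case: ifP => _; rewrite ?rev_uniq Ui.
- move=> u v w /low[a [b [_ _ H]]]; apply/negP => /H /(inn_sub (size_bseq b))[wb].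
  have ww : tree_br w \in q w by apply: last_mem (lay_ne L (size_bseq w)).
  by rewrite /tree_br (lay_disj L (size_bseq w) (size_bseq b) ww wb) eqxx.
- move=> u v u' v' x /low[a [b [ab -> H]]] /low[a' [b' [ab' -> H']]].
  move=> /H /(inn_sub (size_bseq b))[xb _] /H' /(inn_sub (size_bseq b'))[xb' _].
  have bb := val_inj (lay_disj L (size_bseq b) (size_bseq b') xb xb').
  case/childP: ab => c Eb; case/childP: ab' => c' Eb'.
  rewrite -bb in Eb' *; rewrite Eb in Eb'; case: Eb' => _ aa.
  by rewrite (val_inj aa).
- move=> x; have [s sk xs] := layP x; have := xs; rewrite innE // mem_rcons inE.
  case/orP=> [/eqP xl|xi]; first by left; exists (Bseq sk).
  right; case: s sk xs xi => [|c s] sk xs xi; first by rewrite /inn q0 in xi.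
  have uv : is_child (Bseq (ltnW sk) : bintree k) (Bseq sk : bintree k) by apply/childP; exists c.
  exists (Bseq (ltnW sk)), (Bseq sk); split; last by rewrite /tree_inner uv.
  by rewrite /adj /= /bintree_rel uv.
move=> x y; split=> [|[u [v [/orP[uv|uv]]]]].
- have fwd u v : par u v -> exists (a b : bintree k), is_child a b /\ infix [:: u; v] (lay_path r q b).
    case=> s sk uv; have [c [s' [Es _]]] := lay_path_snd sk uv.
    have s'k : size s' <= k by move: sk; rewrite Es; apply: ltnW.
    by exists (Bseq s'k), (Bseq sk); split=> //; apply/childP; exists c.
  case/asboolP=> /fwd[a [b [ab xy]]].
    by exists a, b; rewrite tree_path //; split=> //; apply/orP; left.
  exists b, a; rewrite tree_path_rev //; split; first by apply/orP; right.
  by rewrite -infix_rev revK.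
- rewrite tree_path // => xy; apply/asboolP; left; exists v; rewrite ?size_bseq //.
rewrite tree_path_rev // => xy; apply/asboolP; right; exists u; rewrite ?size_bseq //.
by rewrite -infix_rev.
Qed.

End Subdivision.

(** * Clique minors *)

Section Preimage.
Variables (T T' : finType) (f : T' -> T) (e : rel T) (e' : rel T').
Hypothesis f_inj : injective f.
Hypothesis fe : forall u v, e (f u) (f v) -> e' u v.

Lemma ltn_card_inj x : x \notin codom f -> #|T'| < #|T|.
Proof.
move=> xf; rewrite -(card_codom f_inj); apply: proper_card.
by apply/properP; split; [apply/subsetP|exists x].
Qed.

Lemma touch_preim (A B : {set T}) : A \subset codom f -> B \subset codom f ->
  touch e A B -> touch e' (f @^-1: A) (f @^-1: B).
Proof.
move=> /subsetP Af /subsetP Bf /touchP[x [y [xA yB exy]]].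
case/codomP: (Af x xA) => u xu; case/codomP: (Bf y yB) => v yv.
by apply: (@touchI _ _ _ _ u v); rewrite ?inE -?xu -?yv //; apply: fe; rewrite -xu -yv.
Qed.

Lemma conn_preim (A : {set T}) : A \subset codom f -> conn e A ->
  conn e' (f @^-1: A).
Proof.
move=> Af cA; have [x xA] := conn_neq0 cA.
apply/andP; split.
  case/codomP: (subsetP Af x xA) => u xu.
  by apply/set0Pn; exists u; rewrite inE -xu.
apply/forallP => B; apply/implyP => /and3P[BA B0 BnA].
have fBA : f @: B \subset A.
  by apply/subsetP => _ /imsetP[u uB ->]; have := subsetP BA u uB; rewrite inE.
have fB0 : f @: B != set0.
  by case/set0Pn: B0 => u uB; apply/set0Pn; exists (f u); apply: imset_f.
have fBnA : f @: B != A.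
  apply: contraNneq BnA => fBA'; rewrite eqEsubset BA; apply/subsetP => u.
  by rewrite inE -fBA' => /imsetP[v vB /f_inj ->].
have dAf : A :\: f @: B \subset codom f.
  by apply: subset_trans Af; apply: subsetDl.
have := touch_preim (subset_trans fBA Af) dAf (conn_cut cA fBA fB0 fBnA).
apply: touchS; apply/subsetP => u; rewrite !inE.
  by case/imsetP => v vB /f_inj ->.
by case/andP => nB ->; rewrite andbT; apply: contraNN nB => uB; apply: imset_f.
Qed.

End Preimage.

(** Induction on the number of vertices: delete a vertex outside all branch sets, or contract an
    edge inside a branch set with two vertices. When neither is possible the branch sets are
    singletons covering G, which is then complete. *)
Lemma clique_model_minor (G : sgraph) n :
  clique_model (@adj G) n setT -> minor (complete n) G.
Proof.
have [m] := ubnP #|G|; elim: m => // m IH in G *; rewrite ltnS => Gm [B [cB _ dtB]].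
have dB i j : i < n -> j < n -> i != j -> [disjoint B i & B j].
  move=> ni nj; case: ltngtP => // ij _; first by case: (dtB i j ij nj).
  by rewrite disjoint_sym; case: (dtB j i ij ni).
have tB i j : i < n -> j < n -> i != j -> touch (@adj G) (B i) (B j).
  move=> ni nj; case: ltngtP => // ij _; first by case: (dtB i j ij nj).
  by rewrite touch_sym; [case: (dtB j i ij ni)|exact: adj_sym].
case: (boolP [exists x : G, [forall i : 'I_n, x \notin B i]]) => [/existsP[x /forallP xB]|cov].
  have in_codom (A : {set G}) : x \notin A -> A \subset codom (val : del_vertex x -> G).
    move=> xA; apply/subsetP => y yA.
    have yx : y \in [set~ x] by rewrite !inE; apply: contraNneq xA => <-.
    by apply/codomP; exists (Sub y yx); rewrite SubK.
  have xB' i : i < n -> x \notin B i by move=> ni; apply: (xB (Ordinal ni)).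
  apply: (MinorDelVertex (x := x)); apply: IH.
    apply: leq_trans Gm; apply: (ltn_card_inj val_inj (x := x)).
    by apply/codomP => -[u xu]; have := valP u; rewrite -xu !inE eqxx.
  exists (fun i => val @^-1: B i); split=> [i ni|//|i j ij jn].
    by apply: (conn_preim val_inj _ (in_codom _ (xB' i ni)) (cB i ni)) => u v.
  have ni := ltn_trans ij jn; split.
    apply/disjP => u; rewrite !inE => ui uj.
    by have /disjP/(_ _ ui uj) := dB i j ni jn (negbT (ltn_eqF ij)).
  apply: (touch_preim (e := @adj G) _ (in_codom _ (xB' i ni)) (in_codom _ (xB' j jn))).
    by [].
  exact: tB (negbT (ltn_eqF ij)).
have {}cov x : exists2 i, i < n & x \in B i.
  move: cov; rewrite negb_exists => /forallP/(_ x); rewrite negb_forall.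
  by case/existsP => i; rewrite negbK; exists i.
case: (boolP [exists i : 'I_n, 1 < #|B i|]) => [/existsP[i Bi2]|small].
  have ni := ltn_ord i; have [x xB] := conn_neq0 (cB i ni).
  have xnB : [set x] != B i by apply: contraTneq Bi2 => <-; rewrite cards1.
  have x0 : [set x] != set0 by apply/set0Pn; exists x; rewrite inE.
  have xsB : [set x] \subset B i by rewrite sub1set.
  have /touchP[_ [y [/set1P-> yB' xy]]] := conn_cut (cB i ni) xsB x0 xnB.
  have [yx yB] : y != x /\ y \in B i by move: yB'; rewrite !inE => /andP.
  have xy' : x != y by rewrite eq_sym.
  pose x' : contract x y := Sub x xy'.
  have yBj j : j < n -> j != i -> y \notin B j.
    move=> nj ji; apply/negP => yj.
    by have /disjP/(_ y yj yB) := dB j i nj ni ji.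
  have in_codom (A : {set G}) : y \notin A -> A \subset codom (val : contract x y -> G).
    move=> xA; apply/subsetP => z zA.
    have zy : z != y by apply: contraNneq xA => <-.
    by apply/codomP; exists (Sub z zy); rewrite SubK.
  have adjC (u v : contract x y) : val u -- val v -> u -- v.
    move=> uv; rewrite /adj /= /contract_rel uv orTb andbT.
    by apply: contraTneq uv => ->; rewrite adj_irr.
  have adjy (v : contract x y) : v != x' -> y -- val v -> x' -- v.
    by move=> vx yv; rewrite /adj /= /contract_rel eq_sym vx yv eqxx orbT.
  apply: (MinorContract xy); apply: IH.
    apply: leq_trans Gm; apply: (ltn_card_inj val_inj (x := y)).
    by apply/codomP => -[u yu]; have := valP u; rewrite -yu eqxx.
  have dB' j k : j < n -> k < n -> j != k ->
      [disjoint (val : contract x y -> G) @^-1: B j & val @^-1: B k].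
    move=> nj nk jk; apply/disjP => u; rewrite !inE => uj uk.
    by have /disjP/(_ _ uj uk) := dB j k nj nk jk.
  have tB' j k : j < n -> k < n -> k != j -> k != i ->
      touch (@adj (contract x y)) (val @^-1: B j) (val @^-1: B k).
    move=> nj nk kj ki; have := tB j k nj nk; rewrite eq_sym => /(_ kj).
    case/touchP=> a [b [aj bk ab]].
    have yk := yBj k nk ki; have by' : b != y by apply: contraNneq yk => <-.
    case: (eqVneq a y) => [ay|ay].
      have ji : j = i.
        apply/eqP; apply: contraT => ji; by have := yBj j nj ji; rewrite -ay aj.
      have bx : Sub b by' != x'.
        rewrite -val_eqE /=; apply: contraTneq bk => ->; apply/negP => xk.
        by have /disjP/(_ x xk xB) := dB k i nk ni ki.
      apply: (@touchI _ _ _ _ x' (Sub b by')); rewrite ?inE ?SubK ?ji //.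
      by apply: adjy; rewrite // SubK -ay.
    apply: (@touchI _ _ _ _ (Sub a ay) (Sub b by')); rewrite ?inE ?SubK //.
    by apply: adjC; rewrite !SubK.
  have c_sym := @adj_sym (contract x y).
  exists (fun i => val @^-1: B i); split=> [j nj|//|j k jk kn]; last first.
    have nj := ltn_trans jk kn; have jk' := negbT (ltn_eqF jk).
    split; first exact: dB'.
    case: (eqVneq k i) => ki; last by apply: tB' => //; rewrite eq_sym.
    by rewrite touch_sym //; apply: tB' => //; rewrite -ki.
  case: (eqVneq j i) => [->|ji]; last first.
    exact: (conn_preim val_inj adjC (in_codom _ (yBj j nj ji)) (cB j nj)).
  apply: (@conn_from _ _ c_sym _ x'); first by rewrite inE.
  (* A cut on the side of x lifts to the uncontracted branch set by putting y back beside x. *)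
  move=> C xC CB CnB; pose C' := y |: val @: C.
  have C'B : C' \subset B i.
    rewrite subUset sub1set yB; apply/subsetP => _ /imsetP[u uC ->].
    by have := subsetP CB u uC; rewrite inE.
  have C'0 : C' != set0 by apply/set0Pn; exists y; rewrite setU11.
  have C'nB : C' != B i.
    apply: contraNneq CnB => E; rewrite eqEsubset CB; apply/subsetP => u.
    rewrite inE -E => /setU1P[uy|/imsetP[v vC /val_inj -> //]].
    by have := valP u; rewrite uy eqxx.
  have /touchP[a [b [aC /setDP[bB bC] ab]]] := conn_cut (cB i ni) C'B C'0 C'nB.
  have by' : b != y by apply: contraNneq bC => ->; rewrite setU11.
  have bC' : Sub b by' \notin C.
    by apply: contraNN bC => bC; apply/setU1P; right; apply/imsetP; exists (Sub b by').
  have bD : Sub b by' \in val @^-1: B i :\: C by rewrite !inE bC' SubK.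
  case/setU1P: aC => [ay|/imsetP[u uC au]].
    apply: (touchI xC bD); apply: adjy; rewrite ?SubK -?ay //.
    by apply: contraNneq bC' => ->.
  by apply: (touchI uC bD); apply: adjC; rewrite SubK -au.
have pickB (i : 'I_n) : exists x, B i == [set x].
  have [x xB] := conn_neq0 (cB i (ltn_ord i)); exists x; rewrite eq_sym eqEcard sub1set xB cards1.
  by move: small; rewrite negb_exists => /forallP/(_ i); rewrite -leqNgt.
pose phi (i : complete n) : G := xchoose (pickB i).
have phiP (i : 'I_n) : B i = [set phi i] by apply/eqP; apply: (xchooseP (pickB i)).
have phi_inj : injective phi.
  move=> i j ij; apply/eqP; apply: contraT => nij.
  have /disjP/(_ (phi i)) := dB i j (ltn_ord i) (ltn_ord j) nij.
  by rewrite !phiP !inE ij eqxx => /(_ isT isT).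
apply: MinorIso; exists phi.
  apply: (inj_card_bij phi_inj); rewrite -(card_codom phi_inj).
  apply: subset_leq_card; apply/subsetP => x _; have [i ni xB] := cov x.
  apply/codomP; exists (Ordinal ni); apply/eqP; rewrite -in_set1.
  by rewrite -(phiP (Ordinal ni)).
move=> i j; rewrite [RHS]/adj /= /complete_rel; case: (eqVneq i j) => [->|ij].
  by rewrite adj_irr.
have := tB i j (ltn_ord i) (ltn_ord j) ij; rewrite !phiP.
by case/touchP => _ [_ [/set1P-> /set1P->]].
Qed.

(** * Conclusion *)

Lemma iso_sym (G H : sgraph) : iso G H -> iso H G.
Proof.
case=> f [g fK gK] fE; exists g; first by exists f.
by move=> x y; rewrite -fE !gK.
Qed.

(** * The line graph of the tree of a layout *)

Section LineGraph.
Variables (T : finType) (r : T) (k : nat) (q : seq bool -> seq T).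
Hypotheses (L : layout k setT r q) (q0 : q [::] = [:: r]).
Local Notation par := (parent r k q).
Local Notation H := (tree_graph L q0).
Variables (K : sgraph) (f : K -> T).
Hypotheses (f_inj : injective f) (f_onto : forall x, x != r <-> exists u, f u = x).
Hypothesis f_adj : forall u v,
  u -- v <-> [\/ par (f u) (f v), par (f v) (f u) | siblings k q (f u) (f v)].

(* The edge of the tree joining a vertex to its parent is represented in K by *)
(* that vertex.                                                               *)
Lemma line_graph_iso : iso (line_graph H) K.
Proof.
apply: iso_sym.
have fr u : f u != r by apply/f_onto; exists u.
pose pi u := odflt r [pick p | `[< par p (f u) >]].
have piP u : par (pi u) (f u).
  have [p pu] := parent_exists L q0 (fr u).
  by rewrite /pi; case: pickP => [p' /asboolP//|/(_ p)/asboolP].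
pose ed u : {set H} := [set f u; pi u].
have edP u : ed u \in edges H.
  rewrite inE; apply/existsP; exists (f u); apply/existsP; exists (pi u).
  by rewrite eqxx andbT; apply/asboolP; right.
pose psi u : line_graph H := Sub (ed u) (edP u).
have ed_inj : injective ed.
  move=> u v E; apply: f_inj; have := piP u; have := piP v.
  have : f u \in ed v by rewrite -E !inE eqxx.
  rewrite !inE => /orP[/eqP//|/eqP fu]; have : f v \in ed u by rewrite E !inE eqxx.
  rewrite !inE => /orP[/eqP//|/eqP fv]; rewrite -fu -fv => pv pu.
  by case: (parent_acyclic L q0 pv pu).
have psi_inj : injective psi by move=> u v /(congr1 val); apply: ed_inj.
have lower x z : par x z -> exists u, ed u = [set x; z].
  move=> xz; have [u fu] : exists u, f u = z.
    by apply/f_onto; apply/eqP => zr; rewrite zr in xz; case: (parent_root L q0 xz).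
  exists u; rewrite /ed fu setUC; congr [set _; _].
  by apply: (parent_uniq L q0 (piP u)); rewrite fu.
exists psi.
  apply: (inj_card_bij psi_inj); rewrite -(card_codom psi_inj).
  apply: subset_leq_card; apply/subsetP => -[E EP] _; have := EP.
  rewrite inE => /existsP[x /existsP[z /andP[/asboolP xz /eqP Exz]]].
  have [u uE] : exists u, ed u = E.
    by case: xz => /lower[u uE]; exists u; rewrite uE Exz // setUC.
  by apply/codomP; exists u; apply: val_inj; rewrite /= uE.
move=> u v; rewrite [LHS]/adj /= /line_rel (inj_eq psi_inj) /=.
case: (eqVneq u v) => [->|uv] /=; first by rewrite adj_irr.
have fuv : f u != f v by rewrite (inj_eq f_inj).
apply/idP/idP => [/set0Pn[w]|/f_adj H].
  rewrite !inE => /andP[/orP[]/eqP wu /orP[]/eqP wv]; apply/f_adj.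
  - by rewrite -wu wv eqxx in fuv.
  - by apply: Or31; rewrite -wu wv.
  - by apply: Or32; rewrite -wv wu.
  apply: Or33; apply/(siblingsP L q0); split=> //; exists (pi u); split=> //.
  by rewrite -wu wv.
case: H => [p|p|/(siblingsP L q0)[_ [p [pu pv]]]]; apply/set0Pn.
- exists (f u); rewrite !inE eqxx /=; apply/orP; right; apply/eqP.
  exact: parent_uniq L q0 _ _ _ p (piP v).
- exists (f v); rewrite !inE eqxx andbT; apply/orP; right; apply/eqP.
  exact: parent_uniq L q0 _ _ _ p (piP u).
exists p; rewrite !inE; apply/andP; split; apply/orP; right; apply/eqP.
  exact: parent_uniq L q0 _ _ _ pu (piP u).
exact: parent_uniq L q0 _ _ _ pv (piP v).
Qed.

End LineGraph.

(** * Layouts transported to an induced subgraph *)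

Section Restriction.
Variables (G : sgraph) (k : nat) (U : {set G}) (r : G) (q : seq bool -> seq G).
Hypotheses (L : layout k U r q) (q0 : q [::] = [:: r]).

Definition sub_lay s : seq {x | x \in U} := pmap insub (q s).

Lemma val_sub_lay s : size s <= k -> map val (sub_lay s) = q s.
Proof.
move=> sk; rewrite /sub_lay pmap_filter; last exact: insubK.
apply/all_filterP/allP => x xs; have xU : x \in U by apply/(lay_mem L); exists s.
by rewrite insubT.
Qed.

Lemma root_mem : r \in U.
Proof. by apply/(lay_mem L); exists [::]; rewrite // q0 mem_head. Qed.

Local Notation r' := (Sub r root_mem : {x | x \in U}).

Lemma sub_lay_root : sub_lay [::] = [:: r'].
Proof. by apply: (inj_map val_inj); rewrite val_sub_lay // q0. Qed.

Lemma sub_layout : layout k setT r' sub_lay.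
Proof.
have mem s x : size s <= k -> (x \in sub_lay s) = (val x \in q s).
  by move=> sk; rewrite -(val_sub_lay sk) mem_map //; apply: val_inj.
split.
- by rewrite sub_lay_root.
- by move=> s sk; have := lay_ne L sk; rewrite -(val_sub_lay sk); case: (sub_lay s).
- by move=> s sk; have := lay_uniq L sk; rewrite -(val_sub_lay sk) map_inj_uniq //; apply: val_inj.
- by move=> s t x sk tk; rewrite !mem //; apply: (lay_disj L).
move=> x; split=> // _; have /(lay_mem L)[s sk xs] := valP x.
by exists s; rewrite ?mem.
Qed.

Lemma infix2_map (A B : eqType) (g : A -> B) x z l : injective g ->
  infix [:: g x; g z] (map g l) = infix [:: x; z] l.
Proof.
move=> g_inj; elim: l => [|a l IH] //; rewrite map_cons !infix2_consE IH.
rewrite (inj_eq g_inj); congr (_ && _ || _); case: l {IH} => //= b l.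
by rewrite !(inj_eq (@Some_inj _)) (inj_eq g_inj).
Qed.

Lemma sub_parent x z : parent r' k sub_lay x z <-> parent r k q (val x) (val z).
Proof.
have pE s : size s <= k -> map val (lay_path r' sub_lay s) = lay_path r q s.
  case: s => [|c s] sk /=; first exact: val_sub_lay.
  rewrite val_sub_lay //; congr (_ :: _); rewrite -(val_sub_lay (ltnW sk)).
  by apply/esym; exact: (last_map val (sub_lay s) r').
by split=> -[s sk xz]; exists s => //; move: xz; rewrite -pE // infix2_map //; apply: val_inj.
Qed.

Lemma sub_siblings x z : siblings k sub_lay x z <-> siblings k q (val x) (val z).
Proof.
have oE s w : size s <= k -> (ohead (sub_lay s) = Some w <-> ohead (q s) = Some (val w)).
  move=> sk; rewrite -(val_sub_lay sk); case: (sub_lay s) => //= a l.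
  by split=> [[->]//|[/val_inj->]].
by split=> -[s [c [sk xc zc]]]; exists s, c; split=> //; apply/oE.
Qed.

End Restriction.

Lemma parent_default (T : finType) (x0 x1 : T) k U y (q : seq bool -> seq T) u v :
  layout k U y q -> parent x0 k q u v -> parent x1 k q u v.
Proof.
move=> L [s sk uv]; exists s => //; case: s sk uv => [//|c s] sk /=.
by have := lay_ne L (ltnW sk); case: (q s).
Qed.

Section Conclusion.
Variables (G : sgraph) (k : nat) (y : G) (U : {set G}).

Lemma itree_claw : itree (@adj G) true false k y U ->
  exists H : sgraph, is_subdivision (bintree k) H /\ induced_subgraph H G.
Proof.
move/(@itree_layout_top G y false) => [r [U' [q [[L adjL] q0]]]].
exists (tree_graph (sub_layout L q0) (sub_lay_root L q0)); split.
  exact: tree_subdivision.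
exists U', id; first by exists id.
move=> u v; apply/idP/asboolP => [/(adjL _ _ (valP u) (valP v))[p|p|[]//]|[/sub_parent p|/sub_parent p]].
- by left; apply/sub_parent; apply: parent_default L p.
- by right; apply/sub_parent; apply: parent_default L p.
- by apply/(adjL _ _ (valP u) (valP v)); apply: Or31; apply: parent_default L p.
by apply/(adjL _ _ (valP u) (valP v)); apply: Or32; apply: parent_default L p.
Qed.

(** H has the vertices of the layout but only its parent edges. The root is removed because it has
    no parent edge to represent; the remaining vertices induce the line graph of H in G. *)
Lemma itree_triangle : itree (@adj G) false true k y U ->
  exists H : sgraph, is_subdivision (bintree k) H /\
    induced_subgraph (line_graph H) G.
Proof.
move/(@itree_layout_top G y true) => [r [U' [q [[L adjL] q0]]]].
exists (tree_graph (sub_layout L q0) (sub_lay_root L q0)); split.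
  exact: tree_subdivision.
have inU' (u : induced (U' :\ r)) : val u \in U' by have := valP u; rewrite inE => /andP[].
exists (U' :\ r).
apply: (@line_graph_iso _ _ _ _ (sub_layout L q0) (sub_lay_root L q0) (induced (U' :\ r))
  (fun u => Sub (val u) (inU' u))).
- by move=> u v /(congr1 val) /= /val_inj.
- move=> x; split=> [xr|[u <-]].
    have xU : val x \in U' :\ r by rewrite !inE (valP x) andbT.
    by exists (Sub (val x) xU); apply: val_inj.
  by have := valP u; rewrite !inE => /andP[].
move=> u v; split=> [/(adjL _ _ (inU' u) (inU' v))[p|p|[_ sb]]|adjuv].
- by apply: Or31; apply/sub_parent; apply: parent_default L p.
- by apply: Or32; apply/sub_parent; apply: parent_default L p.
- by apply: Or33; apply/(sub_siblings L).
apply/(adjL _ _ (inU' u) (inU' v)); case: adjuv => [/sub_parent p|/sub_parent p|/(sub_siblings L) sb].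
- by apply: Or31; apply: parent_default L p.
- by apply: Or32; apply: parent_default L p.
by apply: Or33.
Qed.

End Conclusion.

Theorem theorem2 (n : nat) :
  exists f : nat -> nat, forall (k : nat) (G : sgraph),
    minor_free (complete n) G -> f k <= pathwidth G ->
    (exists H : sgraph,
       is_subdivision (bintree k) H /\ induced_subgraph H G) \/
    (exists H : sgraph,
       is_subdivision (bintree k) H /\ induced_subgraph (line_graph H) G).
Proof.
(* Height k + k for [itree_ramsey], tripled by [induced_minor_itree], plus one level whose root
   branch set serves as the set Y there. *)
have [M MP] := choice (fun k => clique_or_induced_tree n (3 * (k + k)).+1).
exists (fun k => (btree_size (M k)).+1) => k G noK pw.
have ngood : ~ good (@adj G) (btree_size (M k)) setT.
  by move/good_pathwidth => le; have := leq_trans pw le; rewrite ltnn.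
have adjs := @adj_sym G.
have [B [cB dB tB]] := tree_model adjs (@preorder_parent_lt (M k)) ngood.
case: (MP k _ _ _ _ adjs (preorder_btm cB dB tB)) => [[C [cC _ dtC]]|].
  by case: noK; apply: clique_model_minor; exists C; split.
case=> Z [U [/ibtmS[Z1 [A1 [_ [A2 [_ m1 _ [_ dZ _ t1 _] [_ n1 _]]]]]] _]].
have dZ1 : [disjoint Z & A1] by clear - dZ; set_auto.
have [y [W [mW _ _ _ _]]] := induced_minor_itree adjs m1 dZ1 t1 n1.
have [W' _ [claw|tri]] := itree_ramsey mW erefl.
  by left; apply: itree_claw claw.
by right; apply: itree_triangle tri.
Qed.
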